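(* Let $(M,\Sigma,\pi)$ be a non-planar, r-framed, 2-ruled 4-fold in $\mathbb{R}^7$, with $\Sigma$ a connected real analytic 2-manifold, defined by orthogonal real analytic maps $\phi_1,\phi_2:\Sigma\to\mathcal{S}^6$ and a real analytic map $\psi:\Sigma\to\mathbb{R}^7$ by $$M=\{r_1\phi_1(\sigma)+r_2\phi_2(\sigma)+\psi(\sigma): r_1,r_2\in\mathbb{R},\ \sigma\in\Sigma\}.$$ Then $M$ is coassociative if and only if there exist, locally (near each point of $\Sigma$), oriented coordinates $(s,t)$ on $\Sigma$ such that $$\varphi\Big(\phi_1,\phi_2,\frac{\partial\phi_j}{\partial s}\Big)\equiv0\ \ (j=1,2),\qquad \varphi\Big(\phi_1,\phi_2,\frac{\partial\psi}{\partial s}\Big)\equiv0,$$ $$\frac{\partial\phi_1}{\partial t}=\phi_1\times\phi_2\times\frac{\partial\phi_1}{\partial s}+f\phi_2,\qquad \frac{\partial\phi_2}{\partial t}=\phi_1\times\phi_2\times\frac{\partial\phi_2}{\partial s}-f\phi_1,\qquad \frac{\partial\psi}{\partial t}=\phi_1\times\phi_2\times\frac{\partial\psi}{\partial s}+g_1\phi_1+g_2\phi_2$$ for some real analytic real-valued functions $f,g_1,g_2$ (defined on the domain of the coordinates), where $\times$ denotes the triple cross product on $\mathbb{R}^7$ defined by $\ast\varphi$.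
   Context: Write $d\mathbf{x}_{ij\ldots k}=dx_i\wedge dx_j\wedge\cdots\wedge dx_k$. On $\mathbb{R}^7$ let $$\varphi=d\mathbf{x}_{123}+d\mathbf{x}_{145}+d\mathbf{x}_{167}+d\mathbf{x}_{246}-d\mathbf{x}_{257}-d\mathbf{x}_{347}-d\mathbf{x}_{356},$$ $$\ast\varphi=d\mathbf{x}_{4567}+d\mathbf{x}_{2367}+d\mathbf{x}_{2345}+d\mathbf{x}_{1357}-d\mathbf{x}_{1346}-d\mathbf{x}_{1256}-d\mathbf{x}_{1247}.$$ A 4-dimensional submanifold of $\mathbb{R}^7$ is coassociative if, for a suitable orientation, $\ast\varphi$ restricts to the Riemannian volume form on each of its tangent spaces. The triple cross product on $\mathbb{R}^7$ is defined by $g(x\times y\times z,w)=\ast\varphi(x,y,z,w)$ for all $w$, with $g$ the Euclidean metric. A 2-ruled 4-fold $(M,\Sigma,\pi)$ in $\mathbb{R}^n$ is an (immersed) 4-dimensional submanifold $M$ with a smooth map $\pi:M\to\Sigma$ to a 2-manifold such that every fibre $\pi^{-1}(\sigma)$ is an affine 2-plane. An r-framing is a smoothly varying choice of oriented orthonormal basis $(\phi_1(\sigma),\phi_2(\sigma))$ of (the direction of) each fibre; $M$ is then the image of $\iota_M:\mathbb{R}^2\times\Sigma\to\mathbb{R}^n$, $\iota_M(r_1,r_2,\sigma)=r_1\phi_1(\sigma)+r_2\phi_2(\sigma)+\psi(\sigma)$. ''Orthogonal'' maps means $g(\phi_1,\phi_2)\equiv0$. $M$ may have singularities, namely points where $\iota_M$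 fails to be an immersion, provided these form a nowhere dense subset of each fibre $\mathbb{R}^2\times\{\sigma\}$; ''coassociative'' then refers to the nonsingular part. ''Non-planar'' means that $M$ is not contained in an affine 4-plane. Local coordinates $(s,t)$ on $\Sigma$ are oriented if $\ast\varphi(\phi_1,\phi_2,\partial\iota_M/\partial s,\partial\iota_M/\partial t)>0$ at the points where $\iota_M$ is an immersion. *)

(* Defs.v *)
From HB Require Import structures.
From mathcomp Require Import all_boot all_order all_algebra.
From mathcomp Require Import all_classical all_reals all_analysis.
From mathcomp Require Import ring.

Set Implicit Arguments.
Unset Strict Implicit.
Unset Printing Implicit Defensive.

Import Order.TTheory GRing.Theory Num.Theory.
Import numFieldNormedType.Exports.

Local Open Scope classical_set_scope.
Local Open Scope ring_scope.

Section EuclideanR7.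
Variable R : realType.
Implicit Types u v w x y z : 'rV[R]_7.

Definition dot u v : R := \sum_(i < 7) u 0 i * v 0 i.

(* dx_I, for I = (i_1, ..., i_k) with the 1-based indices of R^7, evaluated on
   the k rows of V. *)
Definition dx k (I : k.-tuple nat) (V : 'M[R]_(k, 7)) : R :=
  \det (\matrix_(a < k, b < k) V a (inord (tnth I b).-1)).

Definition phi_form (V : 'M[R]_(3, 7)) : R :=
  dx [tuple 1; 2; 3]%N V + dx [tuple 1; 4; 5]%N V + dx [tuple 1; 6; 7]%N V
  + dx [tuple 2; 4; 6]%N V - dx [tuple 2; 5; 7]%N V - dx [tuple 3; 4; 7]%N V
  - dx [tuple 3; 5; 6]%N V.

Definition starphi_form (V : 'M[R]_(4, 7)) : R :=
  dx [tuple 4; 5; 6; 7]%N V + dx [tuple 2; 3; 6; 7]%N V + dx [tuple 2; 3; 4; 5]%N V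
  + dx [tuple 1; 3; 5; 7]%N V - dx [tuple 1; 3; 4; 6]%N V
  - dx [tuple 1; 2; 5; 6]%N V - dx [tuple 1; 2; 4; 7]%N V.

Definition phi x y z : R := phi_form (\matrix_(a < 3) tnth [tuple x; y; z] a).

Definition starphi x y z w : R :=
  starphi_form (\matrix_(a < 4) tnth [tuple x; y; z; w] a).

(* Characterised by dot (cross3 x y z) w = starphi x y z w; see cross3P and
   cross3_unique. *)
Definition cross3 x y z : 'rV[R]_7 :=
  \row_(i < 7) starphi x y z (delta_mx 0 i).

End EuclideanR7.

Section Cross3.
Variable R : realType.
Implicit Types u v w x y z : 'rV[R]_7.

Lemma dx4_linear (I : 4.-tuple nat) x y z (c : R) v w :
  dx I (\matrix_(a < 4) tnth [tuple x; y; z; c *: v + w] a) =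
  c * dx I (\matrix_(a < 4) tnth [tuple x; y; z; v] a) +
  dx I (\matrix_(a < 4) tnth [tuple x; y; z; w] a).
Proof.
rewrite /dx -[X in _ = _ + X]mul1r.
apply: (determinant_multilinear (i0 := ord_max)).
- by apply/rowP => b; rewrite !mxE !(tnth_nth 0) /= ?mxE mul1r.
- by apply/matrixP => a b; rewrite !mxE !(tnth_nth 0);
    case: a => [[|[|[|[|]]]]].
- by apply/matrixP => a b; rewrite !mxE !(tnth_nth 0);
    case: a => [[|[|[|[|]]]]].
Qed.

Lemma starphi_linear x y z (c : R) v w :
  starphi x y z (c *: v + w) = c * starphi x y z v + starphi x y z w.
Proof. by rewrite /starphi /starphi_form !dx4_linear; ring. Qed.

Lemma cross3P x y z w : dot (cross3 x y z) w = starphi x y z w.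
Proof.
have starphi0 : starphi x y z 0 = 0.
  by have := starphi_linear x y z (-1) 0 0; rewrite scaler0 addr0 mulN1r addNr.
have starphiD v v' : starphi x y z (v + v') = starphi x y z v + starphi x y z v'.
  by rewrite -[v]scale1r starphi_linear mul1r scale1r.
rewrite [in RHS](row_sum_delta w) (big_morph _ starphiD starphi0).
apply: eq_bigr => i _.
by rewrite mxE mulrC -[w 0 i *: _]addr0 starphi_linear starphi0 addr0.
Qed.

Lemma cross3_unique x y z u :
  (forall w, dot u w = starphi x y z w) -> u = cross3 x y z.
Proof.
move=> h; apply/rowP => i; rewrite mxE -h /dot (bigD1 i) //= big1 => [|j ji].
  by rewrite mxE !eqxx mulr1 addr0.
by rewrite mxE (negPf ji) andbF mulr0.
Qed.

End Cross3.

Section RealAnalytic.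
Variable R : realType.

(* A power series in two variables centred at a, absolutely convergent on the
   closed polydisc of radius rho, represents f on the open polydisc (the norm of
   'rV[R]_2 is the sup norm). *)
Definition analytic_at (f : 'rV[R]_2 -> R) (a : 'rV[R]_2) : Prop :=
  exists (c : nat -> nat -> R) (rho : R),
    [/\ 0 < rho,
        cvgn (fun N => \sum_(i < N) \sum_(j < N) `|c i j| * rho ^+ (i + j)) &
        forall h : 'rV[R]_2, `|h| < rho ->
          (fun N => \sum_(i < N) \sum_(j < N)
             c i j * h 0 0 ^+ i * h 0 1 ^+ j) @ \oo --> f (a + h)].

Definition analytic_on n (D : set 'rV[R]_2) (f : 'rV[R]_2 -> 'rV[R]_n) : Prop :=
  forall a, D a -> forall i : 'I_n, analytic_at (fun u => f u 0 i) a.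

End RealAnalytic.

Section AnalyticSurface.
Variables (R : realType) (S : topologicalType).

(* param is the inverse of coord; only coord on dom, and param on coord @` dom,
   are meaningful. *)
Record chart := Chart {
  dom : set S;
  coord : S -> 'rV[R]_2;
  param : 'rV[R]_2 -> S }.

Definition codom_chart (x : chart) : set 'rV[R]_2 := coord x @` dom x.

Definition topological_chart (x : chart) : Prop :=
  [/\ open (dom x), open (codom_chart x),
      forall p, dom x p -> param x (coord x p) = p,
      {within dom x, continuous (coord x)} &
      {within codom_chart x, continuous (param x)}].

Definition analytic_transition (x y : chart) : Prop :=
  analytic_on (coord x @` (dom x `&` dom y)) (coord y \o param x).

Definition analytic_atlas (A : set chart) : Prop :=
  [/\ forall x, A x -> topological_chart x,
      forall p, exists2 x, A x & dom x p &
      forall x y, A x -> A y -> analytic_transition x y].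

Definition analytic_2manifold (A : set chart) : Prop :=
  [/\ hausdorff_space S, @second_countable S & analytic_atlas A].

(* Membership in the maximal atlas generated by A. *)
Definition local_coordinates (A : set chart) (x : chart) : Prop :=
  topological_chart x /\
  forall y, A y -> analytic_transition x y /\ analytic_transition y x.

Definition analytic_map n (A : set chart) (f : S -> 'rV[R]_n) : Prop :=
  forall x, A x -> analytic_on (codom_chart x) (f \o param x).

Definition analytic_fun_in (x : chart) (f : S -> R) : Prop :=
  forall a, codom_chart x a -> analytic_at (f \o param x) a.

Definition pder n (x : chart) (i : 'I_2) (f : S -> 'rV[R]_n) (p : S) : 'rV[R]_n :=
  'D_(delta_mx 0 i) (f \o param x) (coord x p).

End AnalyticSurface.

Section ParametrizedFourfold.
Variables (R : realType) (S : topologicalType) (A : set (chart R S)).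
Variable iota : 'rV[R]_2 -> S -> 'rV[R]_7.

(* The rows are the partial derivatives of iota along r_1, r_2, s, t. *)
Definition coordinate_frame (x : chart R S) (r : 'rV[R]_2) (p : S) :
    'M[R]_(4, 7) :=
  \matrix_(a < 4) tnth [tuple 'D_(delta_mx 0 0) (iota ^~ p) r;
                              'D_(delta_mx 0 1) (iota ^~ p) r;
                              pder x 0 (iota r) p;
                              pder x 1 (iota r) p] a.

Definition immersion_at (r : 'rV[R]_2) (p : S) : Prop :=
  exists x, [/\ A x, dom x p & row_free (coordinate_frame x r p)].

Definition tangent_basis (r : 'rV[R]_2) (p : S) (B : 'M[R]_(4, 7)) : Prop :=
  exists x, [/\ A x, dom x p, row_free (coordinate_frame x r p) &
                (B == coordinate_frame x r p)%MS].

(* An orientation of the nonsingular part of iota, given by the positively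
   oriented bases of its tangent spaces: at each nonsingular point they form one
   of the two orientation classes, and this class varies continuously. *)
Definition orientation (o : 'rV[R]_2 -> S -> 'M[R]_(4, 7) -> Prop) : Prop :=
  [/\ forall r p B, o r p B -> tangent_basis r p B,
      forall r p B (P : 'M[R]_4), tangent_basis r p B -> 0 < \det P ->
        (o r p (P *m B) <-> o r p B),
      forall r p B (P : 'M[R]_4), tangent_basis r p B -> \det P < 0 ->
        (o r p (P *m B) <-> ~ o r p B) &
      forall x r p, A x -> dom x p -> immersion_at r p ->
        \forall q \near (r, p),
          o q.1 q.2 (coordinate_frame x q.1 q.2) <->
          o r p (coordinate_frame x r p)].

(* The Riemannian volume form of an oriented 4-plane takes the value \det P on
   the rows of P *m E, where E is an oriented orthonormal basis. *)
Definition coassociative : Prop :=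
  exists2 o, orientation o &
    forall r p (E : 'M[R]_(4, 7)), o r p E -> E *m E^T = 1%:M ->
      forall P : 'M[R]_4, starphi_form (P *m E) = \det P.

Definition planar : Prop :=
  exists (c : 'rV[R]_7) (V : 'M[R]_(4, 7)),
    row_free V /\ forall r p, (iota r p - c <= V)%MS.

Definition nowhere_dense (T : topologicalType) (D : set T) : Prop :=
  interior (closure D) = set0.

Definition fibrewise_generic_immersion : Prop :=
  forall p, nowhere_dense [set r | ~ immersion_at r p].

End ParametrizedFourfold.

Section TwoRuled.
Variables (R : realType) (S : topologicalType).
Variables (phi1 phi2 psi : S -> 'rV[R]_7).

Definition ruled (r : 'rV[R]_2) (p : S) : 'rV[R]_7 :=
  r 0 0 *: phi1 p + r 0 1 *: phi2 p + psi p.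

Definition oriented_coordinates (A : set (chart R S)) (x : chart R S) : Prop :=
  local_coordinates A x /\
  forall r p, dom x p -> immersion_at A ruled r p ->
    0 < starphi (phi1 p) (phi2 p) (pder x 0 (ruled r) p) (pder x 1 (ruled r) p).

Definition ruled_coassociative_system (x : chart R S) : Prop :=
  exists f g1 g2 : S -> R,
    [/\ analytic_fun_in x f, analytic_fun_in x g1, analytic_fun_in x g2 &
      forall p, dom x p ->
      [/\ phi (phi1 p) (phi2 p) (pder x 0 phi1 p) = 0 /\
          phi (phi1 p) (phi2 p) (pder x 0 phi2 p) = 0,
          phi (phi1 p) (phi2 p) (pder x 0 psi p) = 0,
          pder x 1 phi1 p =
            cross3 (phi1 p) (phi2 p) (pder x 0 phi1 p) + f p *: phi2 p,
          pder x 1 phi2 p =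
            cross3 (phi1 p) (phi2 p) (pder x 0 phi2 p) - f p *: phi1 p &
          pder x 1 psi p =
            cross3 (phi1 p) (phi2 p) (pder x 0 psi p)
            + g1 p *: phi1 p + g2 p *: phi2 p]].

End TwoRuled.

(* Main.v *)
(* For orthonormal e1, e2 put J z = e1 x e2 x z; it is a complex structure on the
   orthogonal complement W of e1, e2 and the vector dual to phi(e1, e2, -). A
   4-plane spanned by e1, e2, A, B is coassociative up to orientation exactly when
   the components of A, B orthogonal to e1, e2 lie in W and span a J-complex line.
   If the system holds, every tangent space is of this form, with B = J A modulo
   e1, e2, and the sign of *phi provides the orientation.

   Conversely, the tangent vectors of the ruled fourfold along a fibre are affine
   in (r_1, r_2), and density of the immersed points makes the complex-line
   condition hold on the whole fibre. Comparing coefficients gives an alternative: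
   either d_t = mu d_s modulo phi_1, phi_2 on phi_1, phi_2 and psi, for one complex
   function mu (with i acting as J), or all these derivatives lie in a single
   4-plane span(phi_1, phi_2, v, J v). If the first fails at a point, the second
   holds near it, equality of mixed derivatives shows that the 4-plane is constant,
   and by the identity theorem on the connected surface the fourfold is planar,
   which is excluded. So the first holds near each point; as mu is analytic and not
   real, the Beltrami equation w_t = mu w_s has an analytic solution that is a local
   diffeomorphism (majorant series), and in the coordinates Re w, Im w the relation
   becomes d_t = J d_s modulo phi_1, phi_2. *)

From HB Require Import structures.
From mathcomp Require Import all_boot all_order all_algebra.
From mathcomp Require Import all_classical all_reals all_analysis.
From mathcomp Require Import ring lra.
Require Import Defs.
Import Order.TTheory GRing.Theory Num.Theory.
Import numFieldNormedType.Exports.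
Local Open Scope classical_set_scope.
Local Open Scope ring_scope.

Set Implicit Arguments.
Unset Strict Implicit.
Unset Printing Implicit Defensive.

(** * Power series and analytic functions of two variables *)

Section Sequences.
Variable R : realType.

(** Three choices carry the argument. Analyticity is a statement about power series, so everything
    analytic is done in the normed algebra of series with a weighted absolutely summable norm: its
    submultiplicative bounds yield composition and, by a contraction, the inverse function theorem,
    while the Beltrami equation is solved by majorising coefficients. The complex-line condition is
    written without division, as [dot A A *: B = dot A B *: A + dot (J A) B *: J A]; it then holds
    trivially at [A = 0], is polynomial along a fibre, and so extends from the dense set of immersed
    points. Finally, the degenerate alternative is a set of equations, but the failure of d_t = mu
    d_s is an open condition, and that is what allows the 4-plane to be differentiated. Its normal
    derivative is J-complex linear, so equality of mixed derivatives at two points of a fibre with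
    different complex ratios of velocities forces it to vanish. Constancy of the plane then follows,
    without integrating a frame equation, from the squared projection of a fixed normal vector,
    which has zero gradient and vanishes at one point. *)

Lemma cvg_sum_ord (T : Type) (F : set_system T) (FF : Filter F) n
    (f : 'I_n -> T -> R) (l : 'I_n -> R) :
  (forall i, f i @ F --> l i) ->
  (fun x => \sum_(i < n) f i x) @ F --> \sum_(i < n) l i.
Proof. by move=> h; apply: cvg_big => [|i _]; [exact: add_continuous|exact: h]. Qed.

Lemma cvgn_ext (u v : nat -> R) (l : R) :
  (forall N, u N = v N) -> u @ \oo --> l -> v @ \oo --> l.
Proof. by move=> /funext ->. Qed.

Lemma cvgnD (u v : nat -> R) (a b : R) :
  u @ \oo --> a -> v @ \oo --> b -> (fun n => u n + v n) @ \oo --> a + b.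
Proof. by move=> ua vb; exact: cvgD. Qed.

Lemma cvgnB (u v : nat -> R) (a b : R) :
  u @ \oo --> a -> v @ \oo --> b -> (fun n => u n - v n) @ \oo --> a - b.
Proof. by move=> ua vb; exact: cvgB. Qed.

Lemma cvgnZ (u : nat -> R) (k a : R) :
  u @ \oo --> a -> (fun n => k * u n) @ \oo --> k * a.
Proof. by move=> ua; apply: cvgM => //; exact: cvg_cst. Qed.

Lemma cvg_dist_le (u : nat -> R) (l x e : R) :
  u @ \oo --> l -> (\forall n \near \oo, `|u n - x| <= e) -> `|l - x| <= e.
Proof.
move=> ul h.
have : (fun n => `|u n - x|) @ \oo --> `|l - x|.
  by apply: cvg_norm; apply: cvgB => //; exact: cvg_cst.
by move/cvgr_to_le; apply.
Qed.

Lemma sum_ord_nondecreasing (B : nat -> R) : (forall n, 0 <= B n) ->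
  {homo (fun N => \sum_(n < N) B n) : n m / (n <= m)%N >-> n <= m}.
Proof.
move=> B0; apply: homo_leq => // [x y z|n]; first exact: le_trans.
by rewrite big_ord_recr /= lerDl.
Qed.

Lemma bounded_sum_cvg (B : nat -> R) (C : R) : (forall n, 0 <= B n) ->
  (forall N, \sum_(n < N) B n <= C) -> cvgn (fun N => \sum_(n < N) B n).
Proof.
move=> B0 BC; apply: nondecreasing_is_cvgn; first exact: sum_ord_nondecreasing.
by exists C => _ [N _ <-].
Qed.

Lemma sum_tail_le (a B : nat -> R) K K' : (K <= K')%N ->
  (forall n, `|a n| <= B n) ->
  `|\sum_(n < K') a n - \sum_(n < K) a n| <=
    \sum_(n < K') B n - \sum_(n < K) B n.
Proof.
move=> KK' aB.
have E (u : nat -> R) :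
    \sum_(n < K') u n - \sum_(n < K) u n = \sum_(K <= n < K') u n.
  apply/eqP; rewrite subr_eq addrC -!(big_mkord xpredT u).
  by apply/eqP/big_cat_nat.
rewrite !E; apply: le_trans (ler_norm_sum _ _ _) _.
by apply: ler_sum => n _; exact: aB.
Qed.

Lemma dominated_sum_cvg (a B : nat -> R) (C : R) :
  (forall n, `|a n| <= B n) -> (forall N, \sum_(n < N) B n <= C) ->
  cvgn (fun N => \sum_(n < N) a n).
Proof.
move=> aB BC.
have : cvgn (fun N => \sum_(n < N) `|a n|).
  refine (@bounded_sum_cvg (fun n => `|a n|) C _ _) => // N.
  by apply: le_trans (BC N); apply: ler_sum.
have E (u : nat -> R) : (fun N => \sum_(n < N) u n) = series u.
  by apply/funext => N; rewrite /series /= big_mkord.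
by rewrite (E a) (E (fun n => `|a n|)) => h; have := @normed_cvg R R^o a h.
Qed.

(** Dominated convergence for series: both tails beyond a common [K] are at most the tail of [B],
    and the remaining finite sum converges term by term. It exchanges an infinite sum of power
    series with the limit of their box sums. *)
Lemma tannery (a : nat -> nat -> R) (b B S : nat -> R) (C s : R) :
  (forall n M, `|a n M| <= B n) -> (forall N, \sum_(n < N) B n <= C) ->
  (forall n, a n @ \oo --> b n) ->
  (forall M, (fun K => \sum_(n < K) a n M) @ \oo --> S M) ->
  (fun K => \sum_(n < K) b n) @ \oo --> s ->
  S @ \oo --> s.
Proof.
move=> aB BC ab aS bs.
have B0 n : 0 <= B n by apply: le_trans (aB n 0%N).
have bB n : `|b n| <= B n.
  have := ab n => /cvg_norm/cvgr_to_le; apply; exact: nearW.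
have cT := bounded_sum_cvg B0 BC.
set T := fun N => _ in cT; set L := limn T.
have TL N : T N <= L.
  by apply: nondecreasing_cvgn_le => //; exact: sum_ord_nondecreasing.
apply/cvgrPdist_le => e e0.
have e3 : 0 < e / 3 by rewrite divr_gt0.
have [K _ hK] : \forall K \near \oo, `|L - T K| <= e / 3.
  by move/cvgrPdist_le : cT; apply.
have {}hK : L - T K <= e / 3 by apply: le_trans (ler_norm _) (hK K _) => /=.
have tail (u : nat -> R) l : (forall n, `|u n| <= B n) ->
    (fun K => \sum_(n < K) u n) @ \oo --> l -> `|l - \sum_(n < K) u n| <= e / 3.
  move=> uB ul; apply: (cvg_dist_le ul); exists K => // K' /= KK'.
  apply: le_trans (sum_tail_le KK' uB) _; apply: le_trans hK.
  by rewrite lerD2r; exact: TL.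
have fin : (fun M => \sum_(n < K) a n M) @ \oo --> \sum_(n < K) b n.
  by apply: cvg_sum_ord => i; exact: ab.
have /cvgrPdist_le/(_ _ e3) := fin; apply: filterS => M hM.
have h1 := tail _ _ bB bs.
have h2 := tail (a^~ M) _ (aB ^~ M) (aS M).
rewrite (_ : s - S M = (s - \sum_(n < K) b n) +
  (\sum_(n < K) b n - \sum_(n < K) a n M) + (\sum_(n < K) a n M - S M));
  last by ring.
apply: le_trans (ler_normD _ _) _; apply: le_trans (lerD (ler_normD _ _) (lexx _)) _.
rewrite [X in _ + X](distrC); lra.
Qed.

(** The terms whose larger index is exactly [n]. Square partial sums of a double series thus become
    partial sums of an ordinary series, to which the one-index convergence results apply. *)
Definition shell (V : zmodType) (F : nat -> nat -> V) n : V :=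
  \sum_(i < n.+1) F i n + \sum_(j < n) F n j.

Lemma box_shell (V : zmodType) (F : nat -> nat -> V) N :
  \sum_(i < N) \sum_(j < N) F i j = \sum_(n < N) shell F n.
Proof.
elim: N => [|N IH]; first by rewrite !big_ord0.
rewrite [RHS]big_ord_recr /= -IH /shell big_ord_recr /=.
under eq_bigr do rewrite big_ord_recr /=.
rewrite big_split /= [\sum_(j < N.+1) F N j]big_ord_recr /=.
by rewrite [\sum_(i < N.+1) F i N]big_ord_recr /= -!addrA; congr (_ + (_ + _)); rewrite addrC.
Qed.

End Sequences.

(** * Power series in two variables with a weighted summable norm *)

Section PowerSeries.
Variable R : realType.
Implicit Types (s t B : R) (c d : nat -> nat -> R) (h k : 'rV[R]_2) (f g : 'rV[R]_2 -> R).

Lemma norm_coord_le n (h : 'rV[R]_n) i : `|h 0 i| <= `|h|.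
Proof.
rewrite {2}/Num.norm /= mx_normrE.
exact: (le_bigmax _ (fun ij : 'I_1 * 'I_n => `|h ij.1 ij.2|) (0, i)).
Qed.

Lemma norm_row_le n (h : 'rV[R]_n) (t : R) :
  0 <= t -> (forall i, `|h 0 i| <= t) -> `|h| <= t.
Proof.
move=> t0 ht; rewrite /Num.norm /= mx_normrE.
by apply/bigmax_leP; split=> // -[i j] _ /=; rewrite (ord1 i).
Qed.

Lemma norm_row_lt n (h : 'rV[R]_n) (t : R) :
  0 < t -> (forall i, `|h 0 i| < t) -> `|h| < t.
Proof.
move=> t0 ht; rewrite /Num.norm /= mx_normrE.
by apply/bigmax_ltP; split=> // -[i j] _ /=; rewrite (ord1 i).
Qed.

Definition row2 (x y : R) : 'rV[R]_2 := \row_i (if i == 0 then x else y).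

Lemma row2_0 x y : row2 x y 0 0 = x. Proof. by rewrite mxE. Qed.
Lemma row2_1 x y : row2 x y 0 1 = y. Proof. by rewrite mxE. Qed.

Lemma row2E h : row2 (h 0 0) (h 0 1) = h.
Proof.
by apply/rowP => -[[|[|]]] // i; rewrite mxE /=; congr (h 0 _); apply/val_inj.
Qed.

Lemma row2P h h' : h 0 0 = h' 0 0 -> h 0 1 = h' 0 1 -> h = h'.
Proof. by move=> e0 e1; rewrite -(row2E h) -(row2E h') e0 e1. Qed.

Lemma forall_I2 (P : 'I_2 -> Prop) : P 0 -> P 1 -> forall i, P i.
Proof.
move=> P0 P1 [[|[|]]] // i.
  by rewrite (_ : Ordinal i = 0) //; apply/val_inj.
by rewrite (_ : Ordinal i = 1) //; apply/val_inj.
Qed.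

Definition psum c h N : R :=
  \sum_(i < N) \sum_(j < N) c i j * h 0 0 ^+ i * h 0 1 ^+ j.

(** The weighted l1 norm on the polydisc of radius [t], kept as an upper bound on all box sums. The
    bound is submultiplicative and also bounds the values of the function, so [psr t B] acts as a
    ball of radius [B] in a Banach algebra. *)
Definition pnorm_le (t B : R) c : Prop :=
  forall N, \sum_(i < N) \sum_(j < N) `|c i j| * t ^+ (i + j) <= B.

Definition pser (t B : R) c f : Prop :=
  [/\ 0 < t, pnorm_le t B c & forall h, `|h| < t -> psum c h @ \oo --> f h].

Definition psr (t B : R) f : Prop := exists c, pser t B c f.

Lemma pnorm_ge0 t B c : pnorm_le t B c -> 0 <= B.
Proof. by move/(_ 0%N); rewrite big_ord0. Qed.

Lemma monomial_le c h t i j : `|h| <= t ->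
  `|c i j * h 0 0 ^+ i * h 0 1 ^+ j| <= `|c i j| * t ^+ (i + j).
Proof.
move=> ht; rewrite !normrM !normrX exprD -mulrA ler_wpM2l //.
by apply: ler_pM; rewrite ?exprn_ge0 // lerXn2r ?nnegrE // ?(le_trans _ ht) //;
  exact: norm_coord_le.
Qed.

Lemma psum_le t B c h N : pnorm_le t B c -> `|h| <= t -> `|psum c h N| <= B.
Proof.
move=> cB ht; apply: le_trans (ler_norm_sum _ _ _) (le_trans _ (cB N)).
apply: ler_sum => i _; apply: le_trans (ler_norm_sum _ _ _) _.
by apply: ler_sum => j _; exact: monomial_le.
Qed.

Lemma coef_le t B c i j : 0 <= t -> pnorm_le t B c -> `|c i j| * t ^+ (i + j) <= B.
Proof.
move=> t0 cB; apply: le_trans (cB (maxn i j).+1).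
have hi : (i < (maxn i j).+1)%N by rewrite ltnS leq_maxl.
have hj : (j < (maxn i j).+1)%N by rewrite ltnS leq_maxr.
have pos (a b : nat) : 0 <= `|c a b| * t ^+ (a + b) by rewrite mulr_ge0 ?exprn_ge0.
rewrite (bigD1 (Ordinal hi)) //= (bigD1 (Ordinal hj)) //= -addrA lerDl.
by apply: addr_ge0; apply: sumr_ge0 => a _ //; exact: sumr_ge0.
Qed.

Lemma shell_le (F G : nat -> nat -> R) n :
  (forall i j, `|F i j| <= G i j) -> `|shell F n| <= shell G n.
Proof.
move=> FG; apply: le_trans (ler_normD _ _) _.
by apply: lerD; apply: le_trans (ler_norm_sum _ _ _) _; apply: ler_sum.
Qed.

Lemma pnorm_cvg t B c h : pnorm_le t B c -> `|h| <= t -> cvgn (psum c h).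
Proof.
move=> cB ht.
rewrite (_ : psum c h = fun N => \sum_(n < N)
    shell (fun i j => c i j * h 0 0 ^+ i * h 0 1 ^+ j) n); last first.
  by apply/funext => N; rewrite -box_shell.
refine (@dominated_sum_cvg _ _ (shell (fun i j => `|c i j| * t ^+ (i + j))) B _ _).
  by move=> n; apply: shell_le => i j; exact: monomial_le.
by move=> N; rewrite -box_shell.
Qed.

Definition pev c h : R := limn (psum c h).

Lemma pser_pev t B c : 0 < t -> pnorm_le t B c -> pser t B c (pev c).
Proof. by move=> t0 cB; split => // h /ltW ht; exact: (pnorm_cvg cB ht). Qed.

Lemma pser_le t B c f h : pser t B c f -> `|h| < t -> `|f h| <= B.
Proof.
case=> t0 cB cf ht; have := cf _ ht => /cvg_norm/cvgr_to_le; apply.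
by apply: nearW => N; exact: psum_le (ltW ht).
Qed.

Lemma psr_le t B f h : psr t B f -> `|h| < t -> `|f h| <= B.
Proof. by move=> [c]; exact: pser_le. Qed.

Lemma pser_ext t B c f g : (forall h, `|h| < t -> f h = g h) ->
  pser t B c f -> pser t B c g.
Proof. by move=> fg [t0 cB cf]; split => // h ht; rewrite -fg //; exact: cf. Qed.

Lemma psr_ext t B f g : (forall h, `|h| < t -> f h = g h) ->
  psr t B f -> psr t B g.
Proof. by move=> fg [c cf]; exists c; exact: pser_ext cf. Qed.

Lemma pser_mono t B B' c f : B <= B' -> pser t B c f -> pser t B' c f.
Proof. by move=> BB [t0 cB cf]; split => // N; exact: le_trans (cB N) BB. Qed.

Lemma psr_mono t B B' f : B <= B' -> psr t B f -> psr t B' f.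
Proof. by move=> BB [c cf]; exists c; exact: pser_mono cf. Qed.

Lemma pser_shrink t t' B c f : 0 < t' -> t' <= t -> pser t B c f -> pser t' B c f.
Proof.
move=> t'0 tt' [t0 cB cf]; split => // [N|h ht]; last exact: cf (lt_le_trans ht _).
apply: le_trans (cB N); apply: ler_sum => i _; apply: ler_sum => j _.
by rewrite ler_wpM2l // lerXn2r // nnegrE ltW.
Qed.

Lemma psr_shrink t t' B f : 0 < t' -> t' <= t -> psr t B f -> psr t' B f.
Proof. by move=> t'0 tt' [c cf]; exists c; exact: pser_shrink cf. Qed.

Lemma pserD t B B' c d f g : pser t B c f -> pser t B' d g ->
  pser t (B + B') (fun i j => c i j + d i j) (fun h => f h + g h).
Proof.
move=> [t0 cB cf] [_ dB dg]; split => // [N|h ht].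
  apply: le_trans (lerD (cB N) (dB N)); rewrite -big_split /=.
  apply: ler_sum => i _; rewrite -big_split /=; apply: ler_sum => j _.
  by rewrite -mulrDl ler_wpM2r ?exprn_ge0 ?(ltW t0) // ler_normD.
rewrite (_ : psum _ h = psum c h \+ psum d h); first exact: cvgD (cf _ ht) (dg _ ht).
apply/funext => N /=; rewrite /psum -big_split /=; apply: eq_bigr => i _.
by rewrite -big_split /=; apply: eq_bigr => j _; rewrite !mulrDl.
Qed.

Lemma pserZ t B a c f : pser t B c f ->
  pser t (`|a| * B) (fun i j => a * c i j) (fun h => a * f h).
Proof.
move=> [t0 cB cf]; split => // [N|h ht].
  apply: le_trans (ler_wpM2l (normr_ge0 a) (cB N)); rewrite mulr_sumr.
  apply: ler_sum => i _; rewrite mulr_sumr; apply: ler_sum => j _.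
  by rewrite normrM mulrA.
rewrite (_ : psum _ h = fun N => a * psum c h N).
  by apply: cvgM; [exact: cvg_cst|exact: cf].
apply/funext => N /=; rewrite /psum mulr_sumr; apply: eq_bigr => i _.
by rewrite mulr_sumr; apply: eq_bigr => j _; rewrite !mulrA.
Qed.

Lemma pser0 t : 0 < t -> pser t 0 (fun _ _ => 0) (fun _ => 0).
Proof.
move=> t0; split => // [N|h _].
  by rewrite big1 // => i _; rewrite big1 // => j _; rewrite normr0 mul0r.
rewrite (_ : psum _ h = cst 0); first exact: cvg_cst.
apply/funext => N; rewrite /psum big1 // => i _; rewrite big1 // => j _.
by rewrite !mul0r.
Qed.

Definition cst_coef (a : R) (i j : nat) : R := if (i + j)%N is 0%N then a else 0.

Lemma pser_cst t a : 0 < t -> pser t `|a| (cst_coef a) (fun _ => a).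
Proof.
move=> t0.
have E (F : nat -> nat -> R) N :
    (forall i j, (i + j)%N != 0%N -> F i j = 0) ->
    \sum_(i < N.+1) \sum_(j < N.+1) F i j = F 0%N 0%N.
  move=> F0; rewrite big_ord_recl big_ord_recl big1 => [|j _]; last first.
    by rewrite F0.
  by rewrite addr0 big1 ?addr0 // => i _; rewrite big1 // => j _; rewrite F0.
split => // [[|N]|h _]; first by rewrite big_ord0.
  rewrite (E (fun i j => `|cst_coef a i j| * t ^+ (i + j))) ?mulr1 //.
  by move=> i j; rewrite /cst_coef; case: (i + j)%N => // n _; rewrite normr0 mul0r.
(* The empty box sum is 0 and not [a]; the sequence is constant only from index 1 on. *)
rewrite -(cvg_shiftn 1) /=; rewrite (_ : (fun N => _) = cst a); first exact: cvg_cst.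
apply/funext => N; rewrite /psum addn1.
rewrite (E (fun i j => cst_coef a i j * h 0 0 ^+ i * h 0 1 ^+ j)) ?mulr1 //.
by move=> i j; rewrite /cst_coef; case: (i + j)%N => // n _; rewrite !mul0r.
Qed.

Lemma psum_at0 c N : psum c 0 N.+1 = c 0%N 0%N.
Proof.
rewrite /psum big_ord_recl big_ord_recl big1 => [|j _]; last first.
  by rewrite !mxE lift0 !expr0n /= mulr0.
rewrite big1 ?addr0 ?expr0 ?mulr1 // => i _; rewrite big1 // => j _.
by rewrite !mxE lift0 !expr0n /= mulr0 mul0r.
Qed.

Lemma pser_at0 t B c f : pser t B c f -> f 0 = c 0%N 0%N.
Proof.
move=> [t0 _ /(_ 0)]; rewrite normr0 => /(_ t0) cf.
have c0 : psum c 0 @ \oo --> c 0%N 0%N.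
  rewrite -(cvg_shiftn 1) /= (_ : (fun N => _) = cst (c 0%N 0%N)); first exact: cvg_cst.
  by apply/funext => N; rewrite addn1 psum_at0.
by move/cvg_lim: cf => <- //; move/cvg_lim: c0 => <-.
Qed.

Definition swap h := row2 (h 0 1) (h 0 0).

Lemma swapK : involutive swap.
Proof. by move=> h; rewrite /swap row2_0 row2_1 row2E. Qed.

Lemma norm_swap h : `|swap h| = `|h|.
Proof.
have le k : `|swap k| <= `|k|.
  apply: norm_row_le => //.
  by apply: forall_I2; rewrite ?row2_0 ?row2_1 norm_coord_le.
by apply/eqP; rewrite eq_le le -{1}(swapK h) le.
Qed.

Lemma pser_swap t B c f : pser t B c f ->
  pser t B (fun i j => c j i) (fun h => f (swap h)).
Proof.
move=> [t0 cB cf]; split => // [N|h ht].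
  by rewrite exchange_big /=; under eq_bigr do under eq_bigr do rewrite addnC; exact: cB.
rewrite (_ : psum _ h = psum c (swap h)); first by apply: cf; rewrite norm_swap.
apply/funext => N; rewrite /psum exchange_big; apply: eq_bigr => i _.
by apply: eq_bigr => j _; rewrite row2_0 row2_1 mulrAC.
Qed.

Definition shift0 c i j : R := if i is i'.+1 then c i' j else 0.

Lemma sum_shift0 (F : nat -> nat -> R) N :
  \sum_(i < N.+1) \sum_(j < N.+1) (if nat_of_ord i is i'.+1 then F i' j else 0) =
  \sum_(i < N) \sum_(j < N) F i j + \sum_(i < N) F i N.
Proof.
rewrite big_ord_recl big1 // add0r -big_split /=.
by apply: eq_bigr => i _; rewrite big_ord_recr.
Qed.

(** Multiplication by a coordinate, and termwise differentiation, turn a square box into a rectangle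
    with one more row or column than a square. That edge is at most the increment of the box sums of
    the norm, which tends to 0 because these sums converge. *)
Lemma edge_cvg0 t B c h : 0 < t -> pnorm_le t B c -> `|h| <= t ->
  (fun N => \sum_(i < N) c i N * h 0 0 ^+ i * h 0 1 ^+ N) @ \oo --> (0 : R).
Proof.
move=> t0 cB ht; have t0' := ltW t0.
pose a N := \sum_(i < N) \sum_(j < N) `|c i j| * t ^+ (i + j).
have ac : cvgn a.
  rewrite (_ : a = fun N => \sum_(n < N) shell (fun i j => `|c i j| * t ^+ (i + j)) n).
    refine (@bounded_sum_cvg _ _ B _ _) => N; last by rewrite -box_shell.
    by apply: addr_ge0; apply: sumr_ge0 => i _; rewrite mulr_ge0 // exprn_ge0.
  by apply/funext => N; rewrite -box_shell.
have da : (fun N => a (N + 1)%N - a N) @ \oo --> (0 : R).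
  rewrite -(subrr (limn a)); apply: cvgB => //.
  by rewrite (cvg_shiftn 1 a).
apply/norm_cvg0P; apply: (@squeeze_cvgr _ _ _ _ (fun=> 0) _ _ _ _ (cvg_cst 0) da).
apply: nearW => N; rewrite normr_ge0 /=; apply: le_trans (ler_norm_sum _ _ _) _.
rewrite /a addn1 big_ord_recr /= addrAC; apply: ler_wpDr.
  by rewrite sumr_ge0 // => j _; rewrite mulr_ge0 // exprn_ge0.
rewrite -sumrB; apply: ler_sum => i _; rewrite big_ord_recr /= addrAC subrr add0r.
exact: monomial_le ht.
Qed.

Lemma pser_shift0 t B c f : pser t B c f ->
  pser t (t * B) (shift0 c) (fun h => h 0 0 * f h).
Proof.
move=> [t0 cB cf]; have t0' := ltW t0; split => // [[|N]|h ht].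
- by rewrite big_ord0 mulr_ge0 // (pnorm_ge0 cB).
- rewrite (_ : \sum_(i < _) _ = \sum_(i < N.+1) \sum_(j < N.+1)
      (if nat_of_ord i is i'.+1 then t * (`|c i' j| * t ^+ (i' + j)) else 0)); last first.
    apply: eq_bigr => -[[|i] hi] _; apply: eq_bigr => j _ /=.
      by rewrite /shift0 normr0 mul0r.
    by rewrite addSn exprS mulrCA.
  rewrite (sum_shift0 (fun i j => t * (`|c i j| * t ^+ (i + j)))).
  apply: le_trans (ler_wpM2l t0' (cB N.+1)).
  rewrite [X in _ <= t * X]big_ord_recr /= mulrDr ler_wpDr //.
    by rewrite mulr_ge0 // sumr_ge0 // => j _; rewrite mulr_ge0 // exprn_ge0.
  rewrite mulr_sumr -big_split /=; apply: ler_sum => i _.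
  by rewrite big_ord_recr /= mulrDr mulr_sumr.
rewrite -(cvg_shiftn 1) /=; have ex := edge_cvg0 t0 cB (ltW ht).
have : (fun N => h 0 0 * (psum c h N + \sum_(i < N) c i N * h 0 0 ^+ i * h 0 1 ^+ N))
    @ \oo --> h 0 0 * f h.
  by rewrite -[f h]addr0; apply: cvgM; [exact: cvg_cst|apply: cvgD => //; exact: cf].
apply: cvg_trans; apply: near_eq_cvg; apply: nearW => N.
rewrite addn1 mulrDr /psum !mulr_sumr.
rewrite (_ : \sum_(i < N.+1) _ = \sum_(i < N.+1) \sum_(j < N.+1)
      (if nat_of_ord i is i'.+1 then h 0 0 * (c i' j * h 0 0 ^+ i' * h 0 1 ^+ j) else 0)).
  rewrite (sum_shift0 (fun i j => h 0 0 * (c i j * h 0 0 ^+ i * h 0 1 ^+ j))).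
  by congr (_ + _); apply: eq_bigr => i _; rewrite mulr_sumr.
apply: eq_bigr => -[[|i] hi] _; apply: eq_bigr => j _ /=.
  by rewrite /shift0 !mul0r.
by rewrite /= exprS; ring.
Qed.

Lemma pser_shift1 t B c f : pser t B c f ->
  pser t (t * B) (fun i j => shift0 (fun i j => c j i) j i) (fun h => h 0 1 * f h).
Proof.
move=> /pser_swap/pser_shift0/pser_swap; apply: pser_ext => h _.
by rewrite swapK row2_0.
Qed.

End PowerSeries.

(** * Series, products, composition and inversion of power series *)

Section PowerSeriesAlgebra.
Variable R : realType.
Implicit Types (s t B : R) (c d : nat -> nat -> R) (h : 'rV[R]_2) (f g : 'rV[R]_2 -> R).

Lemma pser_sum t n (B : 'I_n -> R) (c : 'I_n -> nat -> nat -> R)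
    (f : 'I_n -> 'rV[R]_2 -> R) : 0 < t ->
  (forall m, pser t (B m) (c m) (f m)) ->
  pser t (\sum_m B m) (fun i j => \sum_m c m i j) (fun h => \sum_m f m h).
Proof.
move=> t0; elim: n B c f => [|n IH] B c f cf.
  rewrite big_ord0 (_ : (fun _ _ => _) = fun _ _ => 0); last first.
    by apply/funext => i; apply/funext => j; rewrite big_ord0.
  by apply: pser_ext (pser0 t0) => h _; rewrite big_ord0.
rewrite big_ord_recl (_ : (fun i j => _) =
    fun i j => c ord0 i j + \sum_(m < n) c (lift ord0 m) i j); last first.
  by apply/funext => i; apply/funext => j; rewrite big_ord_recl.
apply: pser_ext (pserD (cf ord0) (IH _ _ _ (fun m => cf (lift ord0 m)))) => h _.
by rewrite big_ord_recl.
Qed.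

(** Completeness of the algebra: if the norms are summable, the sum is the power series of the
    summed coefficients. [tannery] exchanges the sum over [n] with the limit over boxes. *)
Lemma pser_series t (B : R) (Bn : nat -> R) (c : nat -> nat -> nat -> R)
    (c' : nat -> nat -> R) (fn : nat -> 'rV[R]_2 -> R) f :
  (forall n, pser t (Bn n) (c n) (fn n)) ->
  (forall N, \sum_(n < N) Bn n <= B) ->
  (forall i j, (fun K => \sum_(n < K) c n i j) @ \oo --> c' i j) ->
  (forall h, `|h| < t -> (fun K => \sum_(n < K) fn n h) @ \oo --> f h) ->
  pser t B c' f.
Proof.
move=> cf BB cc ff; have t0 : 0 < t by case: (cf 0%N).
have K_box K : pnorm_le t B (fun i j => \sum_(n < K) c n i j).
  have [_ + _] := pser_sum t0 (fun n : 'I_K => cf n).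
  by move=> h N; exact: le_trans (h N) (BB K).
split => // [N|h ht].
- have : (fun K => \sum_(i < N) \sum_(j < N) `|\sum_(n < K) c n i j| * t ^+ (i + j))
      @ \oo --> \sum_(i < N) \sum_(j < N) `|c' i j| * t ^+ (i + j).
    apply: cvg_sum_ord => i; apply: cvg_sum_ord => j.
    by apply: cvgM; [apply: cvg_norm; exact: cc|exact: cvg_cst].
  by move/cvgr_to_le; apply; apply: nearW => K; exact: K_box.
- apply: (@tannery _ (fun n M => psum (c n) h M) (fn^~ h) Bn _ B) => //.
  + by move=> n M; have [_ cB _] := cf n; exact: psum_le cB (ltW ht).
  + by move=> n; have [_ _] := cf n; apply.
  + move=> M.
    have E K : \sum_(n < K) psum (c n) h M = \sum_(i < M) \sum_(j < M)
        (\sum_(n < K) c n i j) * h 0 0 ^+ i * h 0 1 ^+ j.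
      rewrite exchange_big; apply: eq_bigr => i _; rewrite exchange_big.
      by apply: eq_bigr => j _; rewrite !mulr_suml.
    under eq_fun do rewrite E.
    apply: cvg_sum_ord => i; apply: cvg_sum_ord => j.
    by apply: cvgM; [apply: cvgM|]; [exact: cc|exact: cvg_cst|exact: cvg_cst].
  + exact: ff.
Qed.

(** The coefficient sums converge by domination: a coefficient of index [(i, j)] is at most the norm
    of its series divided by [t ^+ (i + j)]. *)
Lemma psr_series t (B : R) (Bn : nat -> R) (fn : nat -> 'rV[R]_2 -> R) f :
  (forall n, psr t (Bn n) (fn n)) ->
  (forall N, \sum_(n < N) Bn n <= B) ->
  (forall h, `|h| < t -> (fun K => \sum_(n < K) fn n h) @ \oo --> f h) ->
  psr t B f.
Proof.
move=> /choice[c cf] BB ff.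
have t0 : 0 < t by case: (cf 0%N).
exists (fun i j => limn (fun K => \sum_(n < K) c n i j)).
apply: (pser_series cf BB) => // i j.
have tn : 0 < t ^+ (i + j) by rewrite exprn_gt0.
refine (@dominated_sum_cvg R (fun n => c n i j) (fun n => Bn n / t ^+ (i + j)) (B / t ^+ (i + j)) _ _).
- move=> n; rewrite ler_pdivlMr //; have [_ cB _] := cf n.
  exact: coef_le (ltW t0) cB.
- by move=> N; rewrite -mulr_suml ler_pM2r ?invr_gt0.
Qed.

Lemma pser_box t (B : R) (b : nat -> nat -> R) (c : nat -> nat -> nat -> nat -> R)
    (c' : nat -> nat -> R) (g : nat -> nat -> 'rV[R]_2 -> R) f :
  (forall i j, pser t (b i j) (c i j) (g i j)) ->
  (forall N, \sum_(i < N) \sum_(j < N) b i j <= B) ->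
  (forall k l, (fun N => \sum_(i < N) \sum_(j < N) c i j k l) @ \oo --> c' k l) ->
  (forall h, `|h| < t -> (fun N => \sum_(i < N) \sum_(j < N) g i j h) @ \oo --> f h) ->
  pser t B c' f.
Proof.
move=> cg bB cc gf; have t0 : 0 < t by case: (cg 0%N 0%N).
apply: (@pser_series t B (shell b) (fun n k l => shell (fun i j => c i j k l) n) c'
  (fun n h => shell (fun i j => g i j h) n)) => //.
- by move=> n; apply: pserD; exact: pser_sum.
- by move=> N; rewrite -box_shell.
- move=> k l; have := cc k l; apply: cvg_trans; apply: near_eq_cvg; apply: nearW => N.
  by rewrite -box_shell.
- move=> h ht; have := gf _ ht; apply: cvg_trans; apply: near_eq_cvg; apply: nearW => N.
  by rewrite -box_shell.
Qed.

Lemma psr_box t (B : R) (b : nat -> nat -> R) (g : nat -> nat -> 'rV[R]_2 -> R) f :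
  (forall i j, psr t (b i j) (g i j)) ->
  (forall N, \sum_(i < N) \sum_(j < N) b i j <= B) ->
  (forall h, `|h| < t -> (fun N => \sum_(i < N) \sum_(j < N) g i j h) @ \oo --> f h) ->
  psr t B f.
Proof.
move=> cg bB gf; have t0 : 0 < t by have [? []] := cg 0%N 0%N.
have /choice[c {}cg] : forall ij : nat * nat, psr t (b ij.1 ij.2) (g ij.1 ij.2).
  by case.
apply: (@psr_series t B (shell b) (fun n h => shell (fun i j => g i j h) n)) => //.
- move=> n; eexists; apply: pserD; apply: pser_sum => // m.
    exact: (cg (nat_of_ord m, n)).
  exact: (cg (n, nat_of_ord m)).
- by move=> N; rewrite -box_shell.
- move=> h ht; have := gf _ ht; apply: cvg_trans; apply: near_eq_cvg; apply: nearW => N.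
  by rewrite -box_shell.
Qed.

Definition mono_coef i j c k l : R :=
  if (i <= k)%N && (j <= l)%N then c (k - i)%N (l - j)%N else 0.

Lemma pser_monomial t B i j c f : pser t B c f ->
  pser t (t ^+ (i + j) * B) (mono_coef i j c) (fun h => h 0 0 ^+ i * h 0 1 ^+ j * f h).
Proof.
move=> cf; elim: i => [|i IH].
  elim: j => [|j IH].
    rewrite mul1r (_ : mono_coef 0 0 c = c).
      by apply: pser_ext cf => h _; rewrite !mul1r.
    by apply/funext => k; apply/funext => l; rewrite /mono_coef !subn0.
  rewrite add0n exprS -mulrA (_ : mono_coef 0 j.+1 c =
      fun k l => shift0 (fun k l => mono_coef 0 j c l k) l k).
    by apply: pser_ext (pser_shift1 IH) => h _; rewrite !mul1r exprS mulrA.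
  by apply/funext => k; apply/funext => -[|l]; rewrite /mono_coef //= !leq0n.
rewrite addSn exprS -mulrA (_ : mono_coef i.+1 j c = shift0 (mono_coef i j c)).
  by apply: pser_ext (pser_shift0 IH) => h _; rewrite exprS !mulrA.
by apply/funext => -[|k]; apply/funext => l.
Qed.

Definition cauchy c d k l : R :=
  \sum_(i < k.+1) \sum_(j < l.+1) c i j * d (k - i)%N (l - j)%N.

(** The product is the double series of the monomials of [f] multiplied by [g]. Its coefficient of
    index [(k, l)] no longer changes once the box contains [(k, l)], which the shift by [(k + l).+1]
    guarantees. *)
Lemma pserM t B B' c d f g : pser t B c f -> pser t B' d g ->
  pser t (B * B') (cauchy c d) (fun h => f h * g h).
Proof.
move=> [t0 cB cf] dg; have B'0 : 0 <= B' by case: dg => _ /pnorm_ge0.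
apply: (@pser_box t _ (fun i j => `|c i j| * (t ^+ (i + j) * B'))
  (fun i j k l => c i j * mono_coef i j d k l) _
  (fun i j h => c i j * (h 0 0 ^+ i * h 0 1 ^+ j * g h))).
- by move=> i j; apply: pserZ; exact: pser_monomial.
- move=> N; apply: le_trans (ler_wpM2r B'0 (cB N)); rewrite mulr_suml.
  apply: ler_sum => i _; rewrite mulr_suml; apply: ler_sum => j _.
  by rewrite mulrA.
- move=> k l; rewrite -(cvg_shiftn (k + l).+1) /=.
  rewrite (_ : (fun N => _) = cst (cauchy c d k l)); first exact: cvg_cst.
  apply/funext => N; rewrite /cauchy.
  have Z n m (F : nat -> R) : (m <= n)%N ->
      (forall i, (m <= i)%N -> F i = 0) -> \sum_(i < n) F i = \sum_(i < m) F i.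
    move=> mn F0; rewrite -!(big_mkord xpredT) (big_cat_nat (leq0n m) mn) /=.
    rewrite [X in _ + X = _]big_nat_cond [X in _ + X = _]big1 ?addr0 // => i.
    by rewrite andbT => /andP[+ _]; exact: F0.
  rewrite (@Z _ k.+1 (fun i => \sum_(j < _) c i j * mono_coef i j d k l)).
  + apply: eq_bigr => i _.
    rewrite (@Z _ l.+1 (fun j => c i j * mono_coef i j d k l)).
    * by apply: eq_bigr => j _; rewrite /mono_coef -ltnS ltn_ord -ltnS ltn_ord.
    * by rewrite addnS ltnS addnA leq_addl.
    * by move=> j lj; rewrite /mono_coef [(j <= l)%N]leqNgt lj andbF mulr0.
  + by rewrite addnS ltnS addnCA leq_addr.
  + by move=> i ki; rewrite big1 // => j _; rewrite /mono_coef leqNgt ki mulr0.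
- move=> h ht.
  have -> : (fun N => \sum_(i < N) \sum_(j < N) c i j * (h 0 0 ^+ i * h 0 1 ^+ j * g h))
      = fun N => psum c h N * g h.
    apply/funext => N; rewrite /psum mulr_suml; apply: eq_bigr => i _.
    by rewrite mulr_suml; apply: eq_bigr => j _; rewrite !mulrA.
  by apply: cvgM; [exact: cf|exact: cvg_cst].
Qed.

Lemma psrD t B B' f g : psr t B f -> psr t B' g -> psr t (B + B') (fun h => f h + g h).
Proof. by move=> [c cf] [d dg]; eexists; exact: pserD cf dg. Qed.

Lemma psrM t B B' f g : psr t B f -> psr t B' g -> psr t (B * B') (fun h => f h * g h).
Proof. by move=> [c cf] [d dg]; eexists; exact: pserM cf dg. Qed.

Lemma psrZ t B a f : psr t B f -> psr t (`|a| * B) (fun h => a * f h).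
Proof. by move=> [c cf]; eexists; exact: pserZ cf. Qed.

Lemma psr_cst (t a : R) : 0 < t -> psr t `|a| (fun _ => a).
Proof. by eexists; exact: pser_cst. Qed.

Lemma psrX t B f n : psr t B f -> psr t (B ^+ n) (fun h => f h ^+ n).
Proof.
move=> cf; have t0 : 0 < t by case: cf => c [].
elim: n => [|n IH]; first by rewrite expr0 -(@normr1 R); exact: psr_cst.
by rewrite exprS; apply: psr_ext (psrM cf IH) => h _; rewrite exprS.
Qed.

Lemma psr_coord (t : R) i : 0 < t -> psr t t (fun h => h 0 i).
Proof.
move=> t0; rewrite -[X in psr _ X _]mulr1 -[X in _ * X](@normr1 R).
move: i; apply: forall_I2; eexists.
  by apply: pser_ext (pser_shift0 (pser_cst 1 t0)) => h _; rewrite mulr1.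
by apply: pser_ext (pser_shift1 (pser_cst 1 t0)) => h _; rewrite mulr1.
Qed.

Lemma psr_ge0 t B f : psr t B f -> 0 <= B.
Proof. by move=> [c [_ /pnorm_ge0]]. Qed.

(** Substitution into the double series: [p ^+ i * q ^+ j] has norm at most [s' ^+ (i + j)], so the
    norm of [f] dominates. The strict inequality [s' < s] keeps the arguments in the open polydisc,
    where [f] is known to equal its series. *)
Lemma psr_comp t s s' B f p q : psr s B f -> psr t s' p -> psr t s' q -> s' < s ->
  psr t B (fun h => f (row2 (p h) (q h))).
Proof.
move=> [c [s0 cB cf]] pp qq s's.
have s'0 := psr_ge0 pp.
apply: (@psr_box t B (fun i j => `|c i j| * (s' ^+ i * s' ^+ j))
  (fun i j h => c i j * (p h ^+ i * q h ^+ j))).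
- by move=> i j; apply: psrZ; apply: psrM; exact: psrX.
- move=> N; apply: le_trans (cB N).
  apply: ler_sum => i _; apply: ler_sum => j _; rewrite -exprD ler_wpM2l //.
  by rewrite lerXn2r // ?nnegrE // ltW.
- move=> h ht.
  have hs : `|row2 (p h) (q h)| < s.
    apply: norm_row_lt => //; apply: forall_I2; rewrite ?row2_0 ?row2_1;
    exact: le_lt_trans (psr_le _ ht) s's.
  have := cf _ hs; apply: cvg_trans; apply: near_eq_cvg; apply: nearW => N.
  apply: eq_bigr => i _; apply: eq_bigr => j _.
  by rewrite row2_0 row2_1 mulrA.
Qed.

(** Translation is composition with the two functions [k 0 i + h 0 i], of norm at most the norm of
    [k] plus [t]; no rearrangement of the series has to be written down. *)
Lemma psr_recenter s B f (k : 'rV[R]_2) t : psr s B f -> 0 < t -> `|k| + t < s ->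
  psr t B (fun h => f (k + h)).
Proof.
move=> fs t0 kt.
have pk i : psr t (`|k| + t) (fun h => k 0 i + h 0 i).
  apply: psr_mono (psrD (psr_cst (k 0 i) t0) (psr_coord i t0)).
  by rewrite lerD2r norm_coord_le.
apply: psr_ext (psr_comp fs (pk 0) (pk 1) kt) => h _; congr (f _).
by apply: row2P; rewrite ?row2_0 ?row2_1 !mxE.
Qed.

(** Every surviving monomial has degree at least [n], hence gains at least the factor [(t / s) ^+ n]
    on the smaller polydisc. *)
Lemma pser_small s B c f n t :
  (forall i j, (i + j < n)%N -> c i j = 0) -> 0 < t -> t <= s ->
  pser s B c f -> pser t ((t / s) ^+ n * B) c f.
Proof.
move=> c0 t0 ts cf; have [_ _ cf'] := pser_shrink t0 ts cf.
have [s0 cB _] := cf; split => // N.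
apply: le_trans (ler_wpM2l _ (cB N)); last by rewrite exprn_ge0 // divr_ge0 ?ltW.
rewrite mulr_sumr; apply: ler_sum => i _; rewrite mulr_sumr; apply: ler_sum => j _.
have [/c0 ->|nij] := ltnP (i + j) n; first by rewrite normr0 !mul0r mulr0.
rewrite mulrCA ler_wpM2l // -(subnK nij) [t ^+ _]exprD [s ^+ _]exprD.
rewrite expr_div_n mulrCA mulrAC -!mulrA divff ?mulr1; last first.
  by rewrite expf_neq0 // gt_eqF.
by rewrite ler_wpM2r ?exprn_ge0 ?(ltW t0) // lerXn2r // nnegrE ltW.
Qed.

Lemma psr_small s B f e : psr s B f -> f 0 = 0 -> 0 < e ->
  exists2 t, 0 < t <= s & psr t e f.
Proof.
move=> [c cf] f0 e0; have [s0 cB _] := cf; have B0 := pnorm_ge0 cB.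
have c0 : c 0%N 0%N = 0 by rewrite -(pser_at0 cf).
(* Chosen so that [(t / s) * B <= e]; the [+ 1] keeps the quotient meaningful when [B = 0]. *)
pose t := Num.min s (s * e / (B + 1)).
have B1 : 0 < B + 1 by rewrite ltr_wpDl.
have t0 : 0 < t by rewrite lt_min s0 divr_gt0 ?mulr_gt0.
have ts : t <= s by rewrite ge_min lexx.
exists t; first by rewrite t0.
exists c; apply: pser_mono (pser_small (n := 1) _ t0 ts cf); last first.
  by case=> [|//] [].
have te : t <= s * e / (B + 1) by rewrite ge_min lexx orbT.
rewrite expr1 mulrAC ler_pdivrMr // mulrC [e * s]mulrC.
have := te; rewrite ler_pdivlMr // => te'; apply: le_trans te'.
rewrite mulrC; nra.
Qed.

Lemma psr_inv1B t B f : psr t B f -> B < 1 -> psr t (1 - B)^-1 (fun h => (1 - f h)^-1).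
Proof.
move=> fB B1; have B0 := psr_ge0 fB.
have gs (a : R) : `|a| < 1 -> (fun K => \sum_(n < K) a ^+ n) @ \oo --> (1 - a)^-1.
  move=> a1; rewrite -[X in _ --> X]mul1r.
  have := @cvg_geometric_series _ 1 _ a1; apply: cvg_trans; apply: near_eq_cvg.
  apply: nearW => N; rewrite /series /= big_mkord; apply: eq_bigr => i _.
  by rewrite /geometric /= mul1r.
apply: (@psr_series t _ (fun n => B ^+ n) (fun n h => f h ^+ n)).
- by move=> n; exact: psrX.
- move=> N; have hB : `|B| < 1 by rewrite ger0_norm.
  have := gs _ hB => /cvgr_to_ge; apply; exists N => // M /= NM.
  by apply: (sum_ord_nondecreasing (B := fun n => B ^+ n)) => // n; exact: exprn_ge0.
- by move=> h ht; apply: gs; exact: le_lt_trans (psr_le fB ht) B1.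
Qed.

End PowerSeriesAlgebra.

(** * Termwise differentiation of power series *)

Section Derivatives.
Variable R : realType.
Implicit Types (s t B : R) (c d : nat -> nat -> R) (h k u a : 'rV[R]_2) (f g : 'rV[R]_2 -> R).

Lemma bernoulli_pow (y : R) n : 0 <= y -> n%:R * y <= (1 + y) ^+ n.
Proof.
move=> y0; suff : 1 + n%:R * y <= (1 + y) ^+ n by apply: le_trans; rewrite lerDr.
elim: n => [|n IH]; first by rewrite mul0r addr0.
have y1 : 0 <= 1 + y by rewrite addr_ge0.
rewrite exprS; apply: le_trans (ler_wpM2l y1 IH).
have := mulr_ge0 (ler0n R n) (mulr_ge0 y0 y0).
by rewrite -natr1; set m := n%:R; lra.
Qed.

(** Bernoulli's inequality for [q = Num.sqrt (s / t)] gives [n * (q - 1) <= q ^+ n]; squaring turns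
    the right side into [(s / t) ^+ n]. The square of the degree is the price of a second-order
    remainder. *)
Lemma sqr_geometric_bound (t s : R) : 0 < t -> t < s ->
  exists2 C, 0 < C & forall n, n%:R ^+ 2 * t ^+ n <= C * s ^+ n.
Proof.
move=> t0 ts; pose q := Num.sqrt (s / t); pose y := q - 1.
have q1 : 1 < q.
  by rewrite -sqrtr1 ltr_sqrt ?divr_gt0 // ?ltr_pdivlMr ?mul1r // (lt_trans t0).
have y0 : 0 < y by rewrite subr_gt0.
exists (y ^- 2); first by rewrite invr_gt0 exprn_gt0.
move=> n; have := bernoulli_pow n (ltW y0).
rewrite /y addrCA subrr addr0 -/y => hn.
have sE : s = q ^+ 2 * t.
  by rewrite sqr_sqrtr ?divfK ?gt_eqF // divr_ge0 ?ltW // (lt_trans t0).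
rewrite {}[in X in _ <= X]sE exprMn mulrA ler_wpM2r ?exprn_ge0 ?(ltW t0) //.
rewrite ler_pdivlMl ?exprn_gt0 // -exprMn -exprM mulnC exprM lerXn2r //.
- by rewrite nnegrE mulr_ge0 // ltW.
- by rewrite nnegrE exprn_ge0 // ltW // (lt_trans _ q1).
- by rewrite mulrC.
Qed.

(** The factor [t] on the left, and [t ^+ 2] in the second-order versions, replaces the exponents
    [n - 1] and [n - 2] on the right; no case distinction on [n] or on [t = 0] is then needed in the
    statement. *)
Lemma pow_diff_le (t e x x' : R) n : `|x| <= t -> `|x'| <= t -> `|x' - x| <= e ->
  `|x' ^+ n - x ^+ n| * t <= n%:R * t ^+ n * e.
Proof.
move=> xt x't xe; have t0 := le_trans (normr_ge0 _) xt.
have e0 := le_trans (normr_ge0 _) xe.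
elim: n => [|n IH]; first by rewrite subrr normr0 !mul0r.
have -> : x' ^+ n.+1 - x ^+ n.+1 = x' * (x' ^+ n - x ^+ n) + (x' - x) * x ^+ n.
  by rewrite !exprS; ring.
have h1 : `|x' * (x' ^+ n - x ^+ n)| * t <= t * (n%:R * t ^+ n * e).
  by rewrite normrM -[leLHS]mulrA ler_pM // ?mulr_ge0.
have h2 : `|(x' - x) * x ^+ n| * t <= e * t ^+ n * t.
  rewrite normrM ler_wpM2r // ler_pM // normrX lerXn2r // nnegrE //.
apply: le_trans (ler_wpM2r t0 (ler_normD _ _)) _; rewrite mulrDl.
apply: le_trans (lerD h1 h2) _; rewrite -natr1 exprS le_eqVlt; apply/orP; left.
by apply/eqP; ring.
Qed.

Lemma pow_deriv_le (t x : R) n : `|x| <= t -> `|n%:R * x ^+ n.-1| * t <= n%:R * t ^+ n.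
Proof.
move=> xt; have t0 := le_trans (normr_ge0 _) xt.
case: n => [|n]; first by rewrite !mul0r normr0 mul0r.
rewrite normrM normr_nat normrX -mulrA ler_wpM2l // exprSr ler_wpM2r //.
by rewrite lerXn2r // nnegrE.
Qed.

Lemma pow_taylor_le (t e x x' : R) n : `|x| <= t -> `|x'| <= t -> `|x' - x| <= e ->
  `|x' ^+ n - x ^+ n - (x' - x) * (n%:R * x ^+ n.-1)| * t ^+ 2
    <= n%:R ^+ 2 * t ^+ n * e ^+ 2.
Proof.
move=> xt x't xe; have t0 := le_trans (normr_ge0 _) xt.
have e0 := le_trans (normr_ge0 _) xe.
elim: n => [|n IH]; first by rewrite subrr !mul0r mulr0 subr0 normr0 mul0r expr0n /= !mul0r.
set r := x' ^+ n - x ^+ n - (x' - x) * (n%:R * x ^+ n.-1) in IH.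
have -> : x' ^+ n.+1 - x ^+ n.+1 - (x' - x) * (n.+1%:R * x ^+ n) =
    x' * r + (x' - x) ^+ 2 * (n%:R * x ^+ n.-1).
  rewrite /r -natr1; case: n {IH r} => [|n] /=; first by ring.
  by rewrite !exprS -natr1; ring.
have h1 : `|x' * r| * t ^+ 2 <= t * (n%:R ^+ 2 * t ^+ n * e ^+ 2).
  by rewrite normrM -[leLHS]mulrA ler_pM // ?mulr_ge0 // exprn_ge0.
have h2 : `|(x' - x) ^+ 2 * (n%:R * x ^+ n.-1)| * t ^+ 2 <= e ^+ 2 * (n%:R * t ^+ n) * t.
  rewrite normrM [t ^+ 2]expr2 [leLHS]mulrA ler_wpM2r // -[leLHS]mulrA ler_pM //; first by rewrite mulr_ge0.
    by rewrite normrX lerXn2r // nnegrE.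
  exact: pow_deriv_le.
apply: le_trans (ler_wpM2r (exprn_ge0 _ t0) (ler_normD _ _)) _; rewrite mulrDl.
apply: le_trans (lerD h1 h2) _; rewrite -natr1 [t ^+ n.+1]exprS -subr_ge0.
rewrite (_ : _ - _ = (n%:R + 1) * (t * t ^+ n) * e ^+ 2); last by ring.
by rewrite !mulr_ge0 ?exprn_ge0 ?addr_ge0.
Qed.

(** The second-order Taylor remainder at [(x, y)] of the monomial of exponents [i] and [j],
    evaluated at [(x', y')]. *)
Definition mono_rem i j (x y x' y' : R) : R :=
  x' ^+ i * y' ^+ j - x ^+ i * y ^+ j - (x' - x) * (i%:R * x ^+ i.-1 * y ^+ j)
    - (y' - y) * (x ^+ i * (j%:R * y ^+ j.-1)).

Lemma mono_rem_le i j (t e x y x' y' : R) :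
  `|x| <= t -> `|x'| <= t -> `|x' - x| <= e ->
  `|y| <= t -> `|y'| <= t -> `|y' - y| <= e ->
  `|mono_rem i j x y x' y'| * t ^+ 2 <= (i + j)%:R ^+ 2 * t ^+ (i + j) * e ^+ 2.
Proof.
move=> xt x't xe yt y't ye; have t0 := le_trans (normr_ge0 _) xt.
have e0 := le_trans (normr_ge0 _) xe.
set Rx := x' ^+ i - x ^+ i - (x' - x) * (i%:R * x ^+ i.-1).
set Ry := y' ^+ j - y ^+ j - (y' - y) * (j%:R * y ^+ j.-1).
have -> : mono_rem i j x y x' y' = Rx * y' ^+ j
    + (x' - x) * (i%:R * x ^+ i.-1) * (y' ^+ j - y ^+ j) + x ^+ i * Ry.
  by rewrite /mono_rem /Rx /Ry; ring.
have pX (z : R) n : `|z| <= t -> `|z ^+ n| <= t ^+ n.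
  by move=> zt; rewrite normrX lerXn2r // nnegrE.
have h1 : `|Rx * y' ^+ j| * t ^+ 2 <= i%:R ^+ 2 * t ^+ i * e ^+ 2 * t ^+ j.
  rewrite normrM mulrAC ler_pM //; [by rewrite mulr_ge0 ?exprn_ge0| |exact: pX].
  exact: pow_taylor_le.
have h2 : `|(x' - x) * (i%:R * x ^+ i.-1) * (y' ^+ j - y ^+ j)| * t ^+ 2 <=
    e * (i%:R * t ^+ i) * (j%:R * t ^+ j * e).
  rewrite normrM [t ^+ 2]expr2 (_ : _ * (t * t) = `|(x' - x) * (i%:R * x ^+ i.-1)| * t
     * (`|y' ^+ j - y ^+ j| * t)); last by ring.
  rewrite ler_pM ?mulr_ge0 //; last exact: pow_diff_le.
  rewrite normrM -[leLHS]mulrA ler_pM ?mulr_ge0 //.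
  exact: pow_deriv_le.
have h3 : `|x ^+ i * Ry| * t ^+ 2 <= t ^+ i * (j%:R ^+ 2 * t ^+ j * e ^+ 2).
  rewrite normrM -[leLHS]mulrA ler_pM //; [by rewrite mulr_ge0 ?exprn_ge0|exact: pX|].
  exact: pow_taylor_le.
apply: le_trans (ler_wpM2r (exprn_ge0 _ t0) (ler_normD _ _)) _; rewrite mulrDl.
apply: le_trans (lerD (ler_wpM2r (exprn_ge0 _ t0) (ler_normD _ _)) h3) _.
rewrite mulrDl; apply: le_trans (lerD (lerD h1 h2) (lexx _)) _.
rewrite natrD exprD -subr_ge0.
rewrite (_ : _ - _ = i%:R * j%:R * (t ^+ i * t ^+ j) * e ^+ 2); last by ring.
by rewrite !mulr_ge0 ?exprn_ge0.
Qed.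

Definition D0 c i j : R := i.+1%:R * c i.+1 j.
Definition D1 c i j : R := j.+1%:R * c i j.+1.

Lemma D0_D1 c : D0 (D1 c) = D1 (D0 c).
Proof. by apply/funext => i; apply/funext => j; rewrite /D0 /D1 mulrCA. Qed.

Lemma pnorm_sqr s B c t : 0 < t -> t < s -> pnorm_le s B c ->
  exists B', forall N,
    \sum_(i < N) \sum_(j < N) `|c i j| * ((i + j)%:R ^+ 2 * t ^+ (i + j)) <= B'.
Proof.
move=> t0 ts cB; have [C C0 hC] := sqr_geometric_bound t0 ts.
exists (C * B) => N; apply: le_trans (ler_wpM2l (ltW C0) (cB N)).
rewrite mulr_sumr; apply: ler_sum => i _; rewrite mulr_sumr; apply: ler_sum => j _.
by rewrite [leRHS]mulrCA ler_wpM2l.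
Qed.

Lemma pnorm_D0 s B c t : 0 < t -> t < s -> pnorm_le s B c ->
  exists B', pnorm_le t B' (D0 c).
Proof.
move=> t0 ts cB; have [B' hB'] := pnorm_sqr t0 ts cB.
exists (B' / t) => N; rewrite ler_pdivlMr //; apply: le_trans (hB' N.+1).
rewrite big_ord_recl; apply: ler_wpDl.
  by apply: sumr_ge0 => j _; rewrite !mulr_ge0 ?exprn_ge0 // ltW.
rewrite mulr_suml; apply: ler_sum => i _; rewrite big_ord_recr /=; apply: ler_wpDr.
  by rewrite !mulr_ge0 ?exprn_ge0 // ltW.
rewrite mulr_suml; apply: ler_sum => j _; rewrite /D0 normrM normr_nat.
rewrite /bump /= add1n addSn [t ^+ (i + j).+1]exprS.
rewrite (_ : _ * t = `|c i.+1 j| * (i.+1%:R * (t * t ^+ (i + j)))); last by ring.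
rewrite ler_wpM2l // ler_wpM2r ?mulr_ge0 ?exprn_ge0 ?(ltW t0) //.
by rewrite -natrX ler_nat (leq_trans (leq_addr j _)) // -[X in (X <= _)%N]expn1 leq_pexp2l.
Qed.

Lemma pnorm_D1 s B c t : 0 < t -> t < s -> pnorm_le s B c ->
  exists B', pnorm_le t B' (D1 c).
Proof.
move=> t0 ts cB; have s0 := lt_trans t0 ts.
have [_ cB' _] := pser_swap (pser_pev s0 cB).
have [B' hB'] := pnorm_D0 t0 ts cB'; exists B'.
by have [_ + _] := pser_swap (pser_pev t0 hB').
Qed.

Lemma pev_swap t B c h : 0 < t -> pnorm_le t B c -> `|h| < t ->
  pev (fun i j => c j i) h = pev c (swap h).
Proof.
move=> t0 cB ht; have [_ _ /(_ _ ht)] := pser_swap (pser_pev t0 cB).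
by move/cvg_lim => <-.
Qed.

(** The derivative of the box of side [N + 1] is the box of side [N] of [D0 c] plus an edge, and the
    edge tends to 0. *)
Lemma psum_D0_cvg t B c k : 0 < t -> pnorm_le t B (D0 c) -> `|k| < t ->
  (fun N => \sum_(i < N) \sum_(j < N) c i j * (i%:R * k 0 0 ^+ i.-1 * k 0 1 ^+ j))
    @ \oo --> pev (D0 c) k.
Proof.
move=> t0 cB kt; rewrite -(cvg_shiftn 1) /=.
have [_ _ /(_ _ kt) h] := pser_pev t0 cB.
have := cvgnD h (edge_cvg0 t0 cB (ltW kt)); rewrite addr0; apply: cvgn_ext => N /=.
apply/esym.
rewrite addn1 /psum -(sum_shift0 (fun i j => D0 c i j * k 0 0 ^+ i * k 0 1 ^+ j)).
apply: eq_bigr => -[[|i] hi] _ /=; apply: eq_bigr => j _; first by rewrite !mul0r mulr0.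
by rewrite /D0; ring.
Qed.

Lemma psum_D1_cvg t B c k : 0 < t -> pnorm_le t B (D1 c) -> `|k| < t ->
  (fun N => \sum_(i < N) \sum_(j < N) c i j * (k 0 0 ^+ i * (j%:R * k 0 1 ^+ j.-1)))
    @ \oo --> pev (D1 c) k.
Proof.
move=> t0 cB kt.
have [_ cB' _] := pser_swap (pser_pev t0 cB).
have kt' : `|swap k| < t by rewrite norm_swap.
have := psum_D0_cvg (c := fun i j => c j i) t0 cB' kt'.
rewrite (pev_swap t0 cB kt') swapK; apply: cvgn_ext => N.
rewrite exchange_big; apply: eq_bigr => i _; apply: eq_bigr => j _.
by rewrite row2_0 row2_1; ring.
Qed.

(** Each monomial has a quadratic remainder by [mono_rem_le], and [pnorm_sqr] sums the constants
    because [t < s]. Differentiability and the values of the partial derivatives are read off this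
    single estimate. *)
Lemma pser_remainder s B c f t : pser s B c f -> 0 < t -> t < s ->
  exists C, forall k h, `|k| < t -> `|k + h| < t ->
   `|f (k + h) - f k - h 0 0 * pev (D0 c) k - h 0 1 * pev (D1 c) k| <= C * `|h| ^+ 2.
Proof.
move=> [s0 cB cf] t0 ts; have [B' hB'] := pnorm_sqr t0 ts cB.
have [B0 hB0] := pnorm_D0 t0 ts cB; have [B1 hB1] := pnorm_D1 t0 ts cB.
exists (B' / t ^+ 2) => k h kt kht.
have t2 : 0 < t ^+ 2 by rewrite exprn_gt0.
have lim : (fun N => \sum_(i < N) \sum_(j < N) c i j *
    mono_rem i j (k 0 0) (k 0 1) ((k + h) 0 0) ((k + h) 0 1)) @ \oo -->
    f (k + h) - f k - h 0 0 * pev (D0 c) k - h 0 1 * pev (D1 c) k.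
  have l0 := cvgnZ (k := h 0 0) (psum_D0_cvg t0 hB0 kt).
  have l1 := cvgnZ (k := h 0 1) (psum_D1_cvg t0 hB1 kt).
  have := cvgnB (cvgnB (cvgnB (cf _ (lt_trans kht ts)) (cf _ (lt_trans kt ts))) l0) l1.
  apply: cvgn_ext => N /=.
  rewrite /psum !mulr_sumr -!sumrB; apply: eq_bigr => i _.
  rewrite !mulr_sumr -!sumrB; apply: eq_bigr => j _.
  by rewrite /mono_rem !mxE; ring.
have := cvg_dist_le (x := 0) (e := B' / t ^+ 2 * `|h| ^+ 2) lim; rewrite subr0.
apply; apply: nearW => N; rewrite subr0 mulrAC ler_pdivlMr //.
have kc i := le_trans (norm_coord_le k i) (ltW kt).
have khc i := le_trans (norm_coord_le (k + h) i) (ltW kht).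
have hc i : `|(k + h) 0 i - k 0 i| <= `|h|.
  by rewrite mxE addrC addKr norm_coord_le.
apply: le_trans (ler_wpM2r (ltW t2) (ler_norm_sum _ _ _)) _.
apply: le_trans (ler_wpM2r (exprn_ge0 2 (normr_ge0 h)) (hB' N)).
rewrite !mulr_suml; apply: ler_sum => i _.
apply: le_trans (ler_wpM2r (ltW t2) (ler_norm_sum _ _ _)) _.
rewrite !mulr_suml; apply: ler_sum => j _.
rewrite normrM -[leLHS]mulrA -[leRHS]mulrA ler_wpM2l //.
by apply: mono_rem_le.
Qed.

Lemma differentiable_gradient f u (g0 g1 C r : R) : 0 < r ->
  (forall h, `|h| < r -> `|f (u + h) - f u - h 0 0 * g0 - h 0 1 * g1| <= C * `|h| ^+ 2) ->
  [/\ differentiable f u, 'D_(delta_mx 0 0) f u = g0 & 'D_(delta_mx 0 1) f u = g1].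
Proof.
move=> r0 hf.
pose L (h : 'rV[R]_2) : R := h 0 0 * g0 + h 0 1 * g1.
have L_lin : linear L.
  by move=> a x y; rewrite /L !mxE /= /GRing.scale /=; ring.
pose LlM := GRing.isLinear.Build _ _ _ _ _ L_lin.
pose LL : {linear 'rV[R]_2 -> R} := HB.pack L LlM.
have Lc : continuous LL.
  have co i (b : R) : continuous (fun h : 'rV[R]_2 => h 0 i * b).
    by move=> x; exact: (cvgM (@coord_continuous _ _ _ 0 i x) (cvg_cst b)).
  by move=> x; exact: (cvgD (@co 0 g0 x) (@co 1 g1 x)).
have [dE df] : 'd f u = LL :> (_ -> _) /\ differentiable f u.
  suff eq : f \o shift u = (cst (f u) + (LL : 'rV[R]_2 -> R^o) : 'rV[R]_2 -> R^o) +o_ (0 : 'rV[R]_2) id.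
    have dE := @diff_unique _ _ _ f LL u Lc eq.
    by split=> //; apply/diff_locallyP; rewrite dE.
  apply/eqaddoP => e e0.
  have C1 : 0 < `|C| + 1 by rewrite ltr_wpDl.
  have H1 : \forall h \near nbhs (0 : 'rV[R]_2), `|h| < r.
    exact: (@nbhs0_lt R 'rV[R]_2 r r0).
  have H2 : \forall h \near nbhs (0 : 'rV[R]_2), `|h| < e / (`|C| + 1).
    by apply: (@nbhs0_lt R 'rV[R]_2); rewrite divr_gt0.
  apply: filterS2 H1 H2 => h hr; rewrite ltr_pdivlMr // => hC.
  rewrite /= !fctE /= [h + u]addrC opprD addrA /L opprD addrA.
  apply: le_trans (hf h hr) _.
  rewrite expr2 mulrA ler_wpM2r //; apply: le_trans (ltW hC).
  rewrite mulrC ler_wpM2l //; apply: le_trans (ler_norm _) _.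
  by rewrite lerDl.
split => //; rewrite deriveE // dE /= /L !mxE /=.
  by rewrite mul1r mul0r addr0.
by rewrite mul1r mul0r add0r.
Qed.

Lemma pser_differentiable s B c f u a : pser s B c (fun h => f (a + h)) -> `|u - a| < s ->
  [/\ differentiable f u, 'D_(delta_mx 0 0) f u = pev (D0 c) (u - a)
    & 'D_(delta_mx 0 1) f u = pev (D1 c) (u - a)].
Proof.
move=> cf us; pose t := (`|u - a| + s) / 2.
have s0 : 0 < s by case: cf.
have ut : `|u - a| < t by rewrite /t; lra.
have ts : t < s by rewrite /t; lra.
have t0 : 0 < t by apply: le_lt_trans ut.
have [C hC] := pser_remainder cf t0 ts.
apply: (@differentiable_gradient _ _ _ _ C (t - `|u - a|)); first by rewrite subr_gt0.
move=> h hr; have E : a + (u - a) = u by rewrite addrC subrK.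
have := hC (u - a) h ut; rewrite /= addrA E; apply.
by apply: le_lt_trans (ler_normD _ _) _; rewrite addrC -ltrBrDr.
Qed.

End Derivatives.

(** * Real analytic functions of two variables *)

Section Analytic.
Variable R : realType.
Implicit Types (s t B : R) (c d : nat -> nat -> R) (h k u v a : 'rV[R]_2).
Implicit Types (f g : 'rV[R]_2 -> R).

Lemma near_rowP n (a : 'rV[R]_n) (P : 'rV[R]_n -> Prop) :
  (\forall u \near a, P u) <-> exists2 r : R, 0 < r & forall h : 'rV[R]_n, `|h| < r -> P (a + h).
Proof.
split=> [/nbhs_ballP[r r0 hr]|[r r0 hr]].
  exists r => // h ht; apply: hr; rewrite -ball_normE /=.
  by rewrite opprD addrA subrr sub0r normrN.
apply/nbhs_ballP; exists r => // u; rewrite -ball_normE /= => au.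
by rewrite -[u](subrK a) addrC; apply: hr; rewrite distrC.
Qed.

(** Convergence of the norm series on the closed polydisc is the same as boundedness of its box
    sums, because these increase by nonnegative shells. *)
Lemma analytic_atP f a : analytic_at f a <-> exists t B, psr t B (fun h => f (a + h)).
Proof.
have E (c : nat -> nat -> R) (t : R) : 0 < t ->
    (fun N => \sum_(i < N) \sum_(j < N) `|c i j| * t ^+ (i + j)) =
    psum (fun i j => `|c i j|) (row2 t t).
  move=> t0; apply/funext => N; apply: eq_bigr => i _; apply: eq_bigr => j _.
  by rewrite row2_0 row2_1 exprD mulrA.
split=> [[c [t [t0 ct cf]]]|[t [B [c [t0 cB cf]]]]].
  exists t, (limn (fun N => \sum_(i < N) \sum_(j < N) `|c i j| * t ^+ (i + j))), c.
  split => // N; apply: (nondecreasing_cvgn_le _ ct).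
  move=> n m nm; rewrite !(box_shell (fun i j => `|c i j| * t ^+ (i + j))); apply: sum_ord_nondecreasing => // l.
  by apply: addr_ge0; apply: sumr_ge0 => i _; rewrite mulr_ge0 ?exprn_ge0 // ltW.
exists c, t; split => //; rewrite E //.
apply: (@pnorm_cvg _ t B).
  by move=> N; under eq_bigr do under eq_bigr do rewrite normr_id; exact: cB.
apply: norm_row_le (ltW t0) _.
by apply: forall_I2; rewrite ?row2_0 ?row2_1 gtr0_norm.
Qed.

Lemma analytic_near_eq f g a : (\forall u \near a, f u = g u) ->
  analytic_at f a -> analytic_at g a.
Proof.
move=> /near_rowP[r r0 fg] /analytic_atP[t [B ft]]; apply/analytic_atP.
have t0 : 0 < t by case: ft => c [].
exists (Num.min t r), B; have m0 : 0 < Num.min t r by rewrite lt_min t0.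
apply: (@psr_ext _ _ _ (fun h => f (a + h))).
  by move=> h; rewrite lt_min => /andP[_ hr]; exact: fg.
by apply: psr_shrink ft; rewrite ?ge_min ?lexx.
Qed.

Lemma analytic_ext f g a : f =1 g -> analytic_at f a -> analytic_at g a.
Proof. by move=> /funext ->. Qed.

Lemma analytic_common2 f g a : analytic_at f a -> analytic_at g a ->
  exists t B B', [/\ 0 < t, psr t B (fun h => f (a + h)) & psr t B' (fun h => g (a + h))].
Proof.
move=> /analytic_atP[t [B ft]] /analytic_atP[t' [B' gt']].
have t0 : 0 < t by case: ft => c [].
have t'0 : 0 < t' by case: gt' => c [].
have m0 : 0 < Num.min t t' by rewrite lt_min t0.
exists (Num.min t t'), B, B'; split => //.
  by apply: psr_shrink ft; rewrite ?ge_min ?lexx.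
by apply: psr_shrink gt'; rewrite ?ge_min ?lexx ?orbT.
Qed.

Lemma analytic_cst x a : analytic_at (fun _ => x) a.
Proof. by apply/analytic_atP; exists 1, `|x|; exact: psr_cst. Qed.

Lemma analytic_coord i a : analytic_at (fun u => u 0 i) a.
Proof.
apply/analytic_atP; exists 1, (`|a 0 i| + 1).
apply: psr_ext (psrD (psr_cst (a 0 i) ltr01) (psr_coord i ltr01)) => h _.
by rewrite mxE.
Qed.

Lemma analyticD f g a : analytic_at f a -> analytic_at g a ->
  analytic_at (fun u => f u + g u) a.
Proof.
move=> fa ga; have [t [B [B' [t0 ft gt]]]] := analytic_common2 fa ga.
by apply/analytic_atP; exists t, (B + B'); exact: psrD ft gt.
Qed.

Lemma analyticM f g a : analytic_at f a -> analytic_at g a ->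
  analytic_at (fun u => f u * g u) a.
Proof.
move=> fa ga; have [t [B [B' [t0 ft gt]]]] := analytic_common2 fa ga.
by apply/analytic_atP; exists t, (B * B'); exact: psrM ft gt.
Qed.

Lemma analyticN f a : analytic_at f a -> analytic_at (fun u => - f u) a.
Proof.
move=> fa; apply: analytic_ext (analyticM (analytic_cst (-1) a) fa) => u.
by rewrite mulN1r.
Qed.

Lemma analyticB f g a : analytic_at f a -> analytic_at g a ->
  analytic_at (fun u => f u - g u) a.
Proof. by move=> fa ga; apply: analyticD fa (analyticN ga). Qed.

Lemma analytic_sum n (F : 'I_n -> 'rV[R]_2 -> R) a :
  (forall i, analytic_at (F i) a) -> analytic_at (fun u => \sum_i F i u) a.
Proof.
elim: n F => [|n IH] F Fa.
  apply: analytic_ext (analytic_cst 0 a) => u.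
  by rewrite big_ord0.
apply: analytic_ext (analyticD (Fa ord0) (IH _ (fun i => Fa (lift ord0 i)))) => u.
by rewrite big_ord_recl.
Qed.

(** [1 - f / f a] vanishes at [a], so its norm is at most [2^-1] on a small polydisc, and the
    geometric series inverts [f / f a] there. *)
Lemma analyticV f a : f a != 0 -> analytic_at f a -> analytic_at (fun u => (f u)^-1) a.
Proof.
move=> fa0 fa.
have : analytic_at (fun u => 1 - (f a)^-1 * f u) a.
  by apply: analyticB (analytic_cst 1 a) (analyticM (analytic_cst _ a) fa).
move=> /analytic_atP[t [B gt]].
have g0 : 1 - (f a)^-1 * f (a + 0) = 0 by rewrite addr0 mulVf // subrr.
have half : (0 : R) < 2^-1 by rewrite invr_gt0.
have [t' /andP[t'0 _] gt'] := psr_small gt g0 half.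
have h1 : (2^-1 : R) < 1 by lra.
apply/analytic_atP; exists t', (`|(f a)^-1| * (1 - 2^-1)^-1).
apply: psr_ext (psrZ (f a)^-1 (psr_inv1B gt' h1)) => h _ /=.
by rewrite opprB addrC subrK invfM invrK mulrA mulVf // mul1r.
Qed.

Lemma analytic_comp f (F : 'rV[R]_2 -> 'rV[R]_2) a :
  (forall i, analytic_at (fun u => F u 0 i) a) -> analytic_at f (F a) ->
  analytic_at (f \o F) a.
Proof.
move=> Fa /analytic_atP[s [B fs]].
have s0 : 0 < s by case: fs => c [].
have s20 : 0 < s / 2 by rewrite divr_gt0.
have Fi i : exists2 t, 0 < t & psr t (s / 2) (fun h => F (a + h) 0 i - F a 0 i).
  have /analytic_atP[t [B' Ft]] : analytic_at (fun u => F u 0 i - F a 0 i) a.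
    exact: analyticB (Fa i) (analytic_cst _ a).
  have [|t' /andP[t'0 _] ?] := psr_small Ft _ s20; last by exists t'.
  by rewrite addr0 subrr.
have [t t0 F0] := Fi 0; have [t' t'0 F1] := Fi 1.
have m0 : 0 < Num.min t t' by rewrite lt_min t0.
apply/analytic_atP; exists (Num.min t t'), B.
have {}F0 : psr (Num.min t t') (s / 2) (fun h => F (a + h) 0 0 - F a 0 0).
  by apply: psr_shrink F0; rewrite ?ge_min ?lexx.
have {}F1 : psr (Num.min t t') (s / 2) (fun h => F (a + h) 0 1 - F a 0 1).
  by apply: psr_shrink F1; rewrite ?ge_min ?lexx ?orbT.
have s2s : s / 2 < s by lra.
apply: psr_ext (psr_comp fs F0 F1 s2s) => h _ /=; congr (f _).
by apply: row2P; rewrite mxE ?row2_0 ?row2_1 addrC subrK.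
Qed.

Lemma analytic_near f a : analytic_at f a -> \forall u \near a, analytic_at f u.
Proof.
move=> /analytic_atP[t [B ft]]; have t0 : 0 < t by case: ft => c [].
apply/near_rowP; exists (t / 2); first by rewrite divr_gt0.
move=> h ht; apply/analytic_atP; exists ((t / 2 - `|h|) / 2), B.
apply: (@psr_ext _ _ _ (fun k => f (a + (h + k)))) => [k _|].
  by rewrite addrA.
by apply: (psr_recenter ft); lra.
Qed.

Lemma analytic_pser f a : analytic_at f a -> exists t B c, pser t B c (fun h => f (a + h)).
Proof. by move=> /analytic_atP[t [B [c cf]]]; exists t, B, c. Qed.

Lemma analytic_differentiable f a : analytic_at f a -> differentiable f a.
Proof.
move=> /analytic_pser[t [B [c cf]]]; have t0 : 0 < t by case: cf.
have aa : `|a - a| < t by rewrite subrr normr0.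
by have [] := pser_differentiable cf aa.
Qed.

Definition Dcoef (i : 'I_2) c := if i == 0 then D0 c else D1 c.

Lemma pser_derive s B c f a i u : pser s B c (fun h => f (a + h)) -> `|u - a| < s ->
  'D_(delta_mx 0 i) f u = pev (Dcoef i c) (u - a).
Proof.
move=> cf us; have [_ h0 h1] := pser_differentiable cf us.
by move: i; apply: forall_I2.
Qed.

Lemma pser_Dcoef s B c f i : pser s B c f ->
  exists B', pser (s / 2) B' (Dcoef i c) (pev (Dcoef i c)).
Proof.
move=> [s0 cB _]; have s20 : 0 < s / 2 by rewrite divr_gt0.
have s2 : s / 2 < s by lra.
move: i; apply: forall_I2.
  by have [B' cB'] := pnorm_D0 s20 s2 cB; exists B'; exact: pser_pev.
by have [B' cB'] := pnorm_D1 s20 s2 cB; exists B'; exact: pser_pev.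
Qed.

Lemma analytic_derive_pser f a i s B c : pser s B c (fun h => f (a + h)) ->
  exists B', pser (s / 2) B' (Dcoef i c) (fun h => 'D_(delta_mx 0 i) f (a + h)).
Proof.
move=> cf; have [B' cB'] := pser_Dcoef i cf; exists B'.
have s0 : 0 < s by case: cf.
apply: pser_ext cB' => h hs; rewrite (pser_derive i cf); first by rewrite addrC addKr.
by rewrite addrC addKr; lra.
Qed.

Lemma analytic_derive f a i : analytic_at f a ->
  analytic_at (fun u => 'D_(delta_mx 0 i) f u) a.
Proof.
move=> /analytic_pser[s [B [c cf]]]; have [B' cB'] := analytic_derive_pser i cf.
by apply/analytic_atP; exists (s / 2), B', (Dcoef i c).
Qed.

Lemma analytic_schwarz f a : analytic_at f a ->
  'D_(delta_mx 0 0) (fun u => 'D_(delta_mx 0 1) f u) a =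
  'D_(delta_mx 0 1) (fun u => 'D_(delta_mx 0 0) f u) a.
Proof.
move=> /analytic_pser[s [B [c cf]]]; have s0 : 0 < s by case: cf.
have aa : `|a - a| < s / 2 by rewrite subrr normr0 divr_gt0.
have [B0 c0] := analytic_derive_pser 0 cf; have [B1 c1] := analytic_derive_pser 1 cf.
by rewrite (pser_derive 0 c1 aa) (pser_derive 1 c0 aa) /Dcoef /= D0_D1.
Qed.

(** Induction on the degree: the constant coefficient is the value at 0, and a coefficient of degree
    [n.+1] is, up to a nonzero integer factor, one of degree [n] of a partial derivative, which
    vanishes near 0 as well. *)
Lemma pser_zero_coef s B c f e : pser s B c f -> 0 < e ->
  (forall h, `|h| < e -> f h = 0) -> forall i j, c i j = 0.
Proof.
move=> cf e0 f0 i j; move: {-1}(i + j)%N (erefl (i + j)%N) => n.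
elim: n s B c f e i j cf e0 f0 => [|n IH] s B c f e i j cf e0 f0.
  case: i => [|//] /=; case: j => // _.
  by rewrite -(pser_at0 cf) f0 // normr0.
have s0 : 0 < s by case: cf.
have cf' : pser s B c (fun h => f (0 + h)) by apply: pser_ext cf => h _; rewrite add0r.
have m0 : 0 < Num.min e (s / 2) by rewrite lt_min e0 divr_gt0.
have step l : forall i j, (i + j)%N = n -> Dcoef l c i j = 0.
  move=> i' j'; have [B' cB'] := pser_Dcoef l cf; apply: IH cB' m0 _ => h.
  rewrite lt_min => /andP[he hs].
  have := @pser_derive _ _ _ _ _ l h cf'; rewrite subr0 => <-; last by lra.
  rewrite (@near_eq_derive _ _ _ _ (cst 0)) ?derive_cst //.
  apply/near_rowP; exists (e - `|h|); first by rewrite subr_gt0.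
  move=> k ke /=; apply: f0; apply: le_lt_trans (ler_normD _ _) _; lra.
case: i => [|i] /=.
  case: j => [//|j]; rewrite add0n => -[jn].
  have := step 1 0%N j jn; rewrite /Dcoef /= /D1 => /eqP.
  by rewrite mulf_eq0 pnatr_eq0 /= => /eqP.
rewrite addSn => -[ijn]; have := step 0 i j ijn; rewrite /Dcoef /= /D0 => /eqP.
by rewrite mulf_eq0 pnatr_eq0 /= => /eqP.
Qed.

Lemma psum_const c h N : (forall i j, (0 < i + j)%N -> c i j = 0) ->
  psum c h N.+1 = c 0%N 0%N.
Proof.
move=> c0; rewrite /psum big_ord_recl big_ord_recl big1 => [|j _]; last first.
  by rewrite c0 ?mul0r // lift0.
rewrite big1 ?addr0 ?expr0 ?mulr1 // => i _; rewrite big1 // => j _.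
by rewrite c0 ?mul0r // lift0.
Qed.

Lemma pser_const s B c f h : pser s B c f -> (forall i j, (0 < i + j)%N -> c i j = 0) ->
  `|h| < s -> f h = c 0%N 0%N.
Proof.
move=> [_ _ cf] c0 hs.
have ch : psum c h @ \oo --> c 0%N 0%N.
  rewrite -(cvg_shiftn 1) /=; apply: cvgn_ext (cvg_cst (c 0%N 0%N)) => N.
  by rewrite addn1 psum_const.
by move/cvg_lim: (cf _ hs) => <- //; move/cvg_lim: ch => <-.
Qed.

Lemma analytic_gradient0 f a : analytic_at f a ->
  (forall i, \forall u \near a, 'D_(delta_mx 0 i) f u = 0) ->
  \forall u \near a, f u = f a.
Proof.
move=> /analytic_pser[s [B [c cf]]] grad0; have s0 : 0 < s by case: cf.
have Dc i : forall m l : nat, Dcoef i c m l = 0.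
  have [B' cB'] := analytic_derive_pser i cf.
  have /near_rowP[r r0 hr] := grad0 i.
  exact: (pser_zero_coef cB' r0 hr).
have c0 : forall i j, (0 < i + j)%N -> c i j = 0.
  move=> [|i] [|j] //= _.
  - have := Dc 1 0%N j; rewrite /Dcoef /= /D1 => /eqP.
    by rewrite mulf_eq0 pnatr_eq0 /= => /eqP.
  - have := Dc 0 i 0%N; rewrite /Dcoef /= /D0 => /eqP.
    by rewrite mulf_eq0 pnatr_eq0 /= => /eqP.
  - have := Dc 0 i j.+1; rewrite /Dcoef /= /D0 => /eqP.
    by rewrite mulf_eq0 pnatr_eq0 /= => /eqP.
apply/near_rowP; exists s => // h hs; rewrite (pser_const cf c0 hs).
by have := pser_at0 cf; rewrite /= addr0.
Qed.

Lemma analytic_identity f a : analytic_at f a -> exists2 r, 0 < r &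
  forall u, `|u - a| < r -> (\forall v \near u, f v = 0) ->
  forall v, `|v - a| < r -> f v = 0.
Proof.
move=> /analytic_atP[s [B cf]]; have s0 : 0 < s by case: cf => c [].
(* Two points of the ball of radius [s / 4] are less than [s / 2] apart, and the series recentred at
   such a point still has radius [s / 2], since [s / 4 + s / 2 < s]. *)
exists (s / 4); first by rewrite divr_gt0.
move=> u us /near_rowP[r r0 hr] v vs.
have [c cu] : psr (s / 2) B (fun h => f (u + h)).
  apply: (@psr_ext _ _ _ (fun h => f (a + ((u - a) + h)))).
    by move=> h _; rewrite addrA [a + _]addrC subrK.
  by apply: (psr_recenter cf); lra.
have c0 := pser_zero_coef cu r0 hr.
suff vu : `|v - u| < s / 2.
  by have := pser_const cu (fun i j _ => c0 i j) vu; rewrite addrC subrK => ->.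
rewrite (_ : v - u = (v - a) - (u - a)); last by rewrite opprB addrA subrK.
by apply: le_lt_trans (ler_normB _ _) _; lra.
Qed.

End Analytic.

(** * Beltrami equation and analytic inverse function theorem *)

Section Beltrami.
Variable R : realType.
Implicit Types (s t B : R) (c d p q x y : nat -> nat -> R) (h u v a : 'rV[R]_2).

Lemma cauchy_congr c d d' i n : (forall k l, (l <= n)%N -> d k l = d' k l) ->
  cauchy c d i n = cauchy c d' i n.
Proof.
move=> dd; apply: eq_bigr => k _; apply: eq_bigr => l _.
by rewrite dd // leq_subr.
Qed.

(** The second index is the power of t. The equation expresses column [m.+1] through the columns up
    to [m], so stage [n] of the table is final in the columns up to [n]; the real and imaginary
    parts are built together because the equation couples them. *)
Fixpoint beltrami_tab p q n : (nat -> nat -> R) * (nat -> nat -> R) :=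
  if n is m.+1 then
    let: (x, y) := beltrami_tab p q m in
    ((fun i j => if j == m.+1 then
        (cauchy p (D0 x) i m - cauchy q (D0 y) i m) / m.+1%:R else x i j),
     (fun i j => if j == m.+1 then
        (cauchy p (D0 y) i m + cauchy q (D0 x) i m) / m.+1%:R else y i j))
  else ((fun i j => ((i == 1%N) && (j == 0%N))%:R), (fun _ _ => 0)).

(* The coefficients of the formal solution w = x + i y of w_t = (p + i q) w_s
   with w(s, 0) = s. *)
Lemma beltrami_coef p q : exists x y,
  [/\ forall i, x i 0%N = (i == 1%N)%:R, forall i, y i 0%N = 0,
      forall i j, D1 x i j = cauchy p (D0 x) i j - cauchy q (D0 y) i j &
      forall i j, D1 y i j = cauchy p (D0 y) i j + cauchy q (D0 x) i j].
Proof.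
pose T := beltrami_tab p q.
have stab n j i : (j <= n)%N ->
    (T n).1 i j = (T j).1 i j /\ (T n).2 i j = (T j).2 i j.
  elim: n => [|n IH]; first by rewrite leqn0 => /eqP ->.
  rewrite leq_eqVlt => /predU1P[->//|]; rewrite ltnS => jn.
  rewrite /T /= -/(T n); case E : (T n) => [x y] /=.
  by rewrite ltn_eqF ?ltnS //; have := IH jn; rewrite E.
pose x i j := (T j).1 i j; pose y i j := (T j).2 i j.
have xn n i l : (l <= n)%N -> D0 (T n).1 i l = D0 x i l.
  by move=> ln; rewrite /D0 /x; congr (_ * _); exact: (stab n l i.+1 ln).1.
have yn n i l : (l <= n)%N -> D0 (T n).2 i l = D0 y i l.
  by move=> ln; rewrite /D0 /y; congr (_ * _); exact: (stab n l i.+1 ln).2.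
exists x, y; split => //.
- by move=> i; rewrite /x /= andbT.
- move=> i n; rewrite /D1 /x /T /= -/(T n).
  rewrite -(cauchy_congr p i (xn n)) -(cauchy_congr q i (yn n)).
  case: (T n) => [x' y'] /=; by rewrite eqxx mulrCA divff ?mulr1.
- move=> i n; rewrite /D1 /y /T /= -/(T n).
  rewrite -(cauchy_congr p i (yn n)) -(cauchy_congr q i (xn n)).
  case: (T n) => [x' y'] /=; by rewrite eqxx mulrCA divff ?mulr1.
Qed.

Lemma leq_bin_add m n i j : (m <= i)%N -> (n <= j)%N ->
  ('C(m + n, m) <= 'C(i + j, i))%N.
Proof.
move=> mi nj; apply: (@leq_trans 'C(m + j, m)).
  by apply: leq_bin2l; rewrite leq_add2l.
rewrite -[X in (X <= _)%N]bin_sub ?leq_addr // addKn.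
rewrite -[X in (_ <= X)%N]bin_sub ?leq_addr // addKn.
by apply: leq_bin2l; rewrite leq_add2r.
Qed.

Lemma geometric_half_le N : \sum_(i < N) (2^-1 : R) ^+ i <= 2.
Proof.
suff -> : \sum_(i < N) (2^-1 : R) ^+ i = 2 - 2 * 2^-1 ^+ N.
  by rewrite lerBlDr lerDl mulr_ge0 // exprn_ge0.
elim: N => [|N IH]; first by rewrite big_ord0 expr0 mulr1 subrr.
by rewrite big_ord_recr /= IH exprS; field.
Qed.

(** The coefficients of [1 / (1 - s (h_0 + K h_1))], a function whose derivative along [h_1] is [K]
    times its derivative along [h_0]. *)
Definition majorant (K s : R) i j : R := 'C(i + j, i)%:R * K ^+ j * s ^+ (i + j).

Lemma majorant_ge0 K s i j : 0 <= K -> 0 <= s -> 0 <= majorant K s i j.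
Proof. by move=> K0 s0; rewrite !mulr_ge0 ?exprn_ge0. Qed.

(** The bound on [p] grows at rate [s / 2] against [s] for the majorant, so the term of index
    [(k, l)] carries a factor [2^-1 ^+ (k + l)]; two geometric sums of at most 2 give the constant
    4. The condition [1 <= K] allows [K ^+ (j - l)] to be replaced by [K ^+ j]. *)
Lemma cauchy_majorant (M K s : R) p d i j : 0 <= M -> 1 <= K -> 0 <= s ->
  (forall k l, `|p k l| <= M * (s / 2) ^+ (k + l)) ->
  (forall k l, (l <= j)%N -> `|d k l| <= majorant K s k l) ->
  `|cauchy p d i j| <= 4 * M * majorant K s i j.
Proof.
move=> M0 K1 s0 pM dK; have K0 : 0 <= K by apply: le_trans K1.
have term (k : 'I_i.+1) (l : 'I_j.+1) : `|p k l * d (i - k)%N (j - l)%N| <=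
    M * majorant K s i j * (2^-1 ^+ k * 2^-1 ^+ l).
  have ki : (k <= i)%N by rewrite -ltnS. 
  have lj : (l <= j)%N by rewrite -ltnS.
  rewrite normrM; apply: le_trans (ler_pM _ _ (pM k l) (dK _ _ (leq_subr l j))) _ => //.
  have E : s ^+ (i + j) = s ^+ (k + l) * s ^+ (i - k + (j - l)).
    by rewrite -exprD addnACA !subnKC.
  have -> : M * (s / 2) ^+ (k + l) * majorant K s (i - k) (j - l) =
      ('C(i - k + (j - l), i - k)%:R * K ^+ (j - l)) *
      (M * s ^+ (i + j) * (2^-1 ^+ k * 2^-1 ^+ l)).
    rewrite /majorant exprMn E -[2^-1 ^+ k * _]exprD.
    by move: (s ^+ _) (s ^+ _) (K ^+ _) (2^-1 ^+ _) => *; ring.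
  have -> : M * majorant K s i j * (2^-1 ^+ k * 2^-1 ^+ l) =
      ('C(i + j, i)%:R * K ^+ j) * (M * s ^+ (i + j) * (2^-1 ^+ k * 2^-1 ^+ l)).
    rewrite /majorant -[2^-1 ^+ k * _]exprD.
    by move: (s ^+ _) (K ^+ _) (2^-1 ^+ _) => *; ring.
  rewrite ler_wpM2r ?mulr_ge0 ?exprn_ge0 //.
  apply: ler_pM; rewrite ?exprn_ge0 //.
    by rewrite ler_nat leq_bin_add ?leq_subr.
  by rewrite ler_weXn2l ?leq_subr.
apply: le_trans (ler_norm_sum _ _ _) _.
apply: (@le_trans _ _ (\sum_(k < i.+1) \sum_(l < j.+1)
    M * majorant K s i j * (2^-1 ^+ k * 2^-1 ^+ l))).
  apply: ler_sum => k _; apply: le_trans (ler_norm_sum _ _ _) _.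
  by apply: ler_sum => l _.
have -> : \sum_(k < i.+1) \sum_(l < j.+1)
    M * majorant K s i j * (2^-1 ^+ k * 2^-1 ^+ l) =
    M * majorant K s i j * ((\sum_(k < i.+1) 2^-1 ^+ k) * (\sum_(l < j.+1) 2^-1 ^+ l)).
  rewrite mulr_suml mulr_sumr; apply: eq_bigr => k _.
  by rewrite mulr_sumr mulr_sumr.
have W0 : 0 <= M * majorant K s i j by rewrite mulr_ge0 // majorant_ge0.
rewrite [4 * M * _](_ : _ = M * majorant K s i j * (2 * 2)); last by ring.
rewrite ler_wpM2l // ler_pM ?geometric_half_le //.
- by apply: sumr_ge0 => k _; rewrite exprn_ge0.
- by apply: sumr_ge0 => k _; rewrite exprn_ge0.
Qed.

(** Induction on the power of t. Bounds on [D0] in the columns up to [n] bound [D1] in column [n],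
    each of the two products costing [4 * M], whence [8 * M <= K]. In turn [D0 z i n.+1] is a
    multiple of [D1 z i.+1 n], and the majorant satisfies that relation exactly with the factor [K],
    so the induction closes. *)
Lemma beltrami_bound (M K s : R) p q x y : 0 <= M -> 1 <= K -> 8 * M <= K -> 0 <= s ->
  (forall k l, `|p k l| <= M * (s / 2) ^+ (k + l)) ->
  (forall k l, `|q k l| <= M * (s / 2) ^+ (k + l)) ->
  (forall i, `|D0 x i 0%N| <= (i == 0%N)%:R) -> (forall i, `|D0 y i 0%N| <= (i == 0%N)%:R) ->
  (forall i j, `|D1 x i j| <= `|cauchy p (D0 x) i j| + `|cauchy q (D0 y) i j|) ->
  (forall i j, `|D1 y i j| <= `|cauchy p (D0 y) i j| + `|cauchy q (D0 x) i j|) ->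
  (forall i j, `|D0 x i j| <= majorant K s i j /\ `|D0 y i j| <= majorant K s i j) /\
  (forall i j, `|D1 x i j| <= K * majorant K s i j /\ `|D1 y i j| <= K * majorant K s i j).
Proof.
move=> M0 K1 MK s0 pM qM x0 y0 x1 y1; have K0 : 0 <= K by apply: le_trans K1.
have step n : (forall i j, (j <= n)%N ->
      `|D0 x i j| <= majorant K s i j /\ `|D0 y i j| <= majorant K s i j) ->
    forall i, `|D1 x i n| <= K * majorant K s i n /\ `|D1 y i n| <= K * majorant K s i n.
  move=> IH i.
  have hx r : (forall k l, `|r k l| <= M * (s / 2) ^+ (k + l)) ->
      `|cauchy r (D0 x) i n| <= 4 * M * majorant K s i n.
    by move=> rM; apply: cauchy_majorant => // k l /(IH k l)[].
  have hy r : (forall k l, `|r k l| <= M * (s / 2) ^+ (k + l)) ->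
      `|cauchy r (D0 y) i n| <= 4 * M * majorant K s i n.
    by move=> rM; apply: cauchy_majorant => // k l /(IH k l)[].
  have W0 : 0 <= majorant K s i n by exact: majorant_ge0.
  have hK : 4 * M * majorant K s i n + 4 * M * majorant K s i n <= K * majorant K s i n.
    by rewrite -mulrDl ler_wpM2r //; lra.
  split; [apply: le_trans (x1 i n) _|apply: le_trans (y1 i n) _];
    apply: le_trans (lerD _ _) hK; by [exact: hx|exact: hy].
suff all n : forall i j, (j <= n)%N ->
      `|D0 x i j| <= majorant K s i j /\ `|D0 y i j| <= majorant K s i j.
  split=> i j; first exact: (all j).
  by apply: step => k l; exact: all.
elim: n => [|n IH] i j.
  rewrite leqn0 => /eqP ->.
  have W : (i == 0%N)%:R <= majorant K s i 0.
    rewrite /majorant; case: i => [|i] /=; first by rewrite bin0 !expr0 !mulr1.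
    by rewrite !mulr_ge0 ?exprn_ge0.
  by split; apply: le_trans W; [exact: x0|exact: y0].
rewrite leq_eqVlt => /predU1P[->|]; last by rewrite ltnS; exact: IH.
have E z : D0 z i n.+1 = i.+1%:R / n.+1%:R * D1 z i.+1 n.
  by rewrite /D0 /D1 mulrA divfK // pnatr_eq0.
have [hx hy] := step _ IH i.+1.
have n0 : (0 : R) < n.+1%:R by rewrite ltr0n.
have W : i.+1%:R / n.+1%:R * (K * majorant K s i.+1 n) = majorant K s i n.+1.
  have bE : i.+1%:R * 'C(i.+1 + n, i.+1)%:R = n.+1%:R * 'C(i + n.+1, i)%:R :> R.
    by rewrite -!natrM mul_bin_left addSnnS addKn.
  rewrite /majorant -[in X in _ = X]addSnnS exprS.
  move: bE; rewrite -[in X in _ = X -> _]addSnnS.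
  move: (s ^+ _) (K ^+ _) 'C(_, _)%:R 'C(_, _)%:R => z w b b' bE.
  have nz : n.+1%:R != 0 :> R by rewrite gt_eqF.
  have cancel X : n.+1%:R * (i.+1%:R / n.+1%:R * X) = i.+1%:R * X :> R.
    by rewrite mulrA (mulrC n.+1%:R) divfK.
  apply: (mulfI nz); rewrite cancel.
  rewrite (_ : i.+1%:R * _ = K * w * z * (i.+1%:R * b')); last by ring.
  by rewrite bE; ring.
have nD z : `|i.+1%:R / n.+1%:R * D1 z i.+1 n| = i.+1%:R / n.+1%:R * `|D1 z i.+1 n|.
  by rewrite normrM ger0_norm // divr_ge0.
by rewrite !E -W !nD; split; rewrite ler_wpM2l // ?divr_ge0.
Qed.

Lemma bin_le_exp2 n m : ('C(n, m) <= 2 ^ n)%N.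
Proof.
have [mn|/bin_small->//] := leqP m n.
rewrite (expnDn 1 1 n) (bigD1 (inord m)) //= inordK ?ltnS // !exp1n !muln1.
exact: leq_addr.
Qed.

Lemma pnorm_geometric (C L : R) c : 0 <= C -> 0 < L ->
  (forall i j, `|c i j| <= C * L ^+ (i + j)) -> pnorm_le ((2 * L)^-1) (C * 4) c.
Proof.
move=> C0 L0 cL N.
apply: (@le_trans _ _ (\sum_(i < N) \sum_(j < N) C * (2^-1 ^+ i * 2^-1 ^+ j))).
  apply: ler_sum => i _; apply: ler_sum => j _.
  apply: le_trans (ler_wpM2r _ (cL i j)) _.
    by rewrite exprn_ge0 // invr_ge0 mulr_ge0 // ltW.
  rewrite -exprD -mulrA ler_wpM2l // -exprMn invfM mulrCA divff ?mulr1 //.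
  by rewrite gt_eqF.
have -> : \sum_(i < N) \sum_(j < N) C * (2^-1 ^+ i * 2^-1 ^+ j) =
    C * ((\sum_(i < N) 2^-1 ^+ i) * (\sum_(j < N) 2^-1 ^+ j)).
  by rewrite mulr_suml mulr_sumr; apply: eq_bigr => k _; rewrite !mulr_sumr.
rewrite ler_wpM2l // (_ : 4 = 2 * 2); last by ring.
by rewrite ler_pM ?geometric_half_le //; apply: sumr_ge0 => k _; rewrite exprn_ge0.
Qed.

Lemma beltrami_solution (m1 m2 : 'rV[R]_2 -> R) a :
  analytic_at m1 a -> analytic_at m2 a -> exists S T : 'rV[R]_2 -> R,
  [/\ analytic_at S a, analytic_at T a,
      'D_(delta_mx 0 0) S a = 1, 'D_(delta_mx 0 0) T a = 0 &
      \forall u \near a,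
        'D_(delta_mx 0 1) S u =
          m1 u * 'D_(delta_mx 0 0) S u - m2 u * 'D_(delta_mx 0 0) T u /\
        'D_(delta_mx 0 1) T u =
          m1 u * 'D_(delta_mx 0 0) T u + m2 u * 'D_(delta_mx 0 0) S u].
Proof.
move=> m1a m2a.
have [r0 [B1 [B2 [r00 [p pr0] [q qr0]]]]] := analytic_common2 m1a m2a.
pose r := Num.min r0 1; have r_gt0 : 0 < r by rewrite lt_min r00 ltr01.
have rr0 : r <= r0 by rewrite ge_min lexx.
have r1 : r <= 1 by rewrite ge_min lexx orbT.
have pr := pser_shrink r_gt0 rr0 pr0; have qr := pser_shrink r_gt0 rr0 qr0.
have B10 : 0 <= B1 by case: pr => _ /pnorm_ge0.
have B20 : 0 <= B2 by case: qr => _ /pnorm_ge0.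
(* [M] dominates both coefficient series, [K] meets both conditions of [beltrami_bound], and
   [s / 2 = r^-1] is the growth rate of the coefficients of a series of radius [r]. The cap [r <= 1]
   gives [1 <= s]. *)
pose M := B1 + B2; pose K := 1 + 8 * M; pose s : R := 2 / r.
have M0 : 0 <= M by rewrite addr_ge0.
have K1 : 1 <= K by rewrite lerDl mulr_ge0.
have s1 : 1 <= s by rewrite ler_pdivlMr // mul1r; lra.
have s0 : 0 <= s by lra.
have coefM c B f : pser r B c f -> B <= M ->
    forall k l, `|c k l| <= M * (s / 2) ^+ (k + l).
  move=> [_ cB _] BM k l; rewrite /s mulrAC divff // mul1r exprVn ler_pdivlMr ?exprn_gt0 //.
  exact: le_trans (coef_le k l (ltW r_gt0) cB) BM.
have pM : forall k l, `|p k l| <= M * (s / 2) ^+ (k + l).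
  by apply: coefM pr _; rewrite lerDl.
have qM : forall k l, `|q k l| <= M * (s / 2) ^+ (k + l).
  by apply: coefM qr _; rewrite lerDr.
have [x [y [x0 y0 x1 y1]]] := beltrami_coef p q.
have [d0 d1] : (forall i j, `|D0 x i j| <= majorant K s i j /\ `|D0 y i j| <= majorant K s i j) /\
  (forall i j, `|D1 x i j| <= K * majorant K s i j /\ `|D1 y i j| <= K * majorant K s i j).
  apply: (@beltrami_bound M K s p q x y) => //.
  - by rewrite lerDr.
  - move=> i; rewrite /D0 x0; case: i => [|i]; first by rewrite mulr1 normr1.
    by rewrite mulr0 normr0.
  - by move=> i; rewrite /D0 y0 mulr0 normr0.
  - by move=> i j; rewrite x1; exact: ler_normB.
  - by move=> i j; rewrite y1; exact: ler_normD.
pose L := 2 * K * s.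
have L1 : 1 <= L.
  rewrite /L -[X in X <= _]mulr1 ler_pM //.
  by rewrite -[X in X <= _]mulr1 ler_pM //; lra.
have L0 : 0 < L by lra.
have mL i j : majorant K s i j <= L ^+ (i + j).
  rewrite /majorant /L [(2 * K * s) ^+ _]exprMn [(2 * K) ^+ _]exprMn.
  apply: ler_wpM2r; first exact: exprn_ge0.
  apply: ler_pM => //; first by apply: exprn_ge0; lra.
    by rewrite -natrX ler_nat bin_le_exp2.
  by rewrite ler_weXn2l ?leq_addl.
(* The bounds on [D0] and [D1] control every coefficient except the constant one, which is therefore
   assumed separately; the integer factors of the derivatives are at least 1. *)
have coefL z (z00 : `|z 0%N 0%N| <= K) :
    (forall i j, `|D0 z i j| <= majorant K s i j) ->
    (forall i j, `|D1 z i j| <= K * majorant K s i j) ->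
    forall i j, `|z i j| <= K * L ^+ (i + j).
  move=> zd0 zd1 i j.
  have nat_le (w : R) n : `|w| <= `|n.+1%:R * w|.
    by rewrite normrM normr_nat ler_peMl // ler1n.
  have stepL n m : K * majorant K s n m <= K * L ^+ (n + m).+1.
    rewrite ler_wpM2l //; first by lra.
    by apply: le_trans (mL n m) _; rewrite ler_weXn2l.
  case: i => [|i].
    case: j => [|j]; first by rewrite expr0 mulr1.
    apply: le_trans (nat_le _ j) _; apply: le_trans (zd1 0%N j) _.
    by rewrite add0n -[j in L ^+ j.+1]add0n.
  apply: le_trans (nat_le _ i) _; apply: le_trans (zd0 i j) _; rewrite addSn.
  by apply: le_trans (stepL i j); rewrite ler_peMl ?majorant_ge0 //; lra.
pose t := (2 * L)^-1; have t0 : 0 < t by rewrite invr_gt0; lra.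
have K0 : 0 <= K by lra.
have xt : pser t (K * 4) x (pev x).
  apply: pser_pev t0 _; apply: pnorm_geometric => //; apply: coefL.
  - by rewrite x0 normr0.
  - by move=> i j; case: (d0 i j).
  - by move=> i j; case: (d1 i j).
have yt : pser t (K * 4) y (pev y).
  apply: pser_pev t0 _; apply: pnorm_geometric => //; apply: coefL.
  - by rewrite y0 normr0.
  - by move=> i j; case: (d0 i j).
  - by move=> i j; case: (d1 i j).
pose S u := pev x (u - a); pose T u := pev y (u - a).
have aK h : a + h - a = h by rewrite addrC addKr.
have St : pser t (K * 4) x (fun h => S (a + h)) by rewrite /S; under eq_fun do rewrite aK.
have Tt : pser t (K * 4) y (fun h => T (a + h)) by rewrite /T; under eq_fun do rewrite aK.
have aat : `|a - a| < t by rewrite subrr normr0.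
exists S, T; split.
- by apply/analytic_atP; exists t, (K * 4), x.
- by apply/analytic_atP; exists t, (K * 4), y.
- have [B0 St0] := analytic_derive_pser 0 St.
  by have := pser_at0 St0; rewrite /= addr0 => ->; rewrite /Dcoef /= /D0 x0 mulr1.
- have [B0 Tt0] := analytic_derive_pser 0 Tt.
  by have := pser_at0 Tt0; rewrite /= addr0 => ->; rewrite /Dcoef /= /D0 y0 mulr0.
have [BS0 S0] := analytic_derive_pser 0 St; have [BS1 S1] := analytic_derive_pser 1 St.
have [BT0 T0] := analytic_derive_pser 0 Tt; have [BT1 T1] := analytic_derive_pser 1 Tt.
pose e := Num.min r (t / 2).
have e0 : 0 < e by rewrite lt_min r_gt0 divr_gt0.
have er : e <= r by rewrite ge_min lexx.
have et : e <= t / 2 by rewrite ge_min lexx orbT.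
have {}pr := pser_shrink e0 er pr; have {}qr := pser_shrink e0 er qr.
have {}S0 := pser_shrink e0 et S0; have {}S1 := pser_shrink e0 et S1.
have {}T0 := pser_shrink e0 et T0; have {}T1 := pser_shrink e0 et T1.
(* The equation is known between coefficients; it transfers to the functions because both sides are
   limits of the same box sums. *)
have uniq c B B' f g : pser e B c f -> pser e B' c g -> forall h, `|h| < e -> f h = g h.
  move=> [_ _ cf] [_ _ cg] h he.
  by move/cvg_lim: (cf _ he) => <- //; move/cvg_lim: (cg _ he) => <-.
apply/near_rowP; exists e => // h he; split.
  have rhs := pserD (pserM pr S0) (pserZ (-1) (pserM qr T0)).
  have E : (fun i j => cauchy p (Dcoef 0 x) i j + -1 * cauchy q (Dcoef 0 y) i j) = Dcoef 1 x.
    by apply/funext => i; apply/funext => j; rewrite /Dcoef /= x1 mulN1r.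
  by rewrite E in rhs; rewrite (uniq _ _ _ _ _ S1 rhs) //= mulN1r.
have rhs := pserD (pserM pr T0) (pserM qr S0).
have E : (fun i j => cauchy p (Dcoef 0 y) i j + cauchy q (Dcoef 0 x) i j) = Dcoef 1 y.
  by apply/funext => i; apply/funext => j; rewrite /Dcoef /= y1.
by rewrite E in rhs; rewrite (uniq _ _ _ _ _ T1 rhs).
Qed.

End Beltrami.

(** * A contraction in the algebra of power series *)

Section InverseFunction.
Variable R : realType.
Implicit Types (s t B e d L : R) (c : nat -> nat -> R) (h u v a y : 'rV[R]_2).
Implicit Types (f g p q : 'rV[R]_2 -> R).

Lemma psrB t B B' f g : psr t B f -> psr t B' g -> psr t (B + B') (fun h => f h - g h).
Proof.
move=> fB gB; have := psrD fB (psrZ (-1) gB); rewrite normrN1 mul1r.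
by apply: psr_ext => h _; rewrite mulN1r.
Qed.

Lemma psr_pow_diff t e d p p' n : 0 < e -> psr t e p -> psr t e p' ->
  psr t d (fun h => p h - p' h) ->
  psr t (n%:R * e ^+ n * (d / e)) (fun h => p h ^+ n - p' h ^+ n).
Proof.
move=> e0 pe p'e pd; have t0 : 0 < t by case: pe => c [].
elim: n => [|n IH].
  rewrite !mul0r -[X in psr t X](@normr0 _ R); apply: psr_ext (psr_cst 0 t0) => h _.
  by rewrite subrr.
have -> : n.+1%:R * e ^+ n.+1 * (d / e) = e * (n%:R * e ^+ n * (d / e)) + d * e ^+ n.
  by rewrite -natr1 exprS; field; rewrite gt_eqF.
apply: psr_ext (psrD (psrM pe IH) (psrM pd (psrX n p'e))) => h _.
by rewrite !exprS; ring.
Qed.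

(** After division by [e], a bound [L] on a weighted norm of the gradient at radius [e]; it makes
    substitution into the series Lipschitz with constant [L], both in the norm of the algebra and
    pointwise. *)
Definition lipschitz_bound e L c : Prop :=
  forall N, \sum_(i < N) \sum_(j < N) `|c i j| * ((i + j)%:R * e ^+ (i + j)) <= L * e.

Lemma psr_lipschitz s B c f t e d L p q p' q' : pser s B c f -> 0 < e -> e < s -> 0 <= L ->
  lipschitz_bound e L c ->
  psr t e p -> psr t e q -> psr t e p' -> psr t e q' ->
  psr t d (fun h => p h - p' h) -> psr t d (fun h => q h - q' h) ->
  psr t (L * d) (fun h => f (row2 (p h) (q h)) - f (row2 (p' h) (q' h))).
Proof.
move=> [s0 cB cf] e0 es L0 cL pe qe p'e q'e pd qd.
have d0 := psr_ge0 pd.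
apply: (@psr_box _ t _
  (fun i j => `|c i j| * ((i + j)%:R * e ^+ (i + j) * (d / e)))
  (fun i j h => c i j * (p h ^+ i * q h ^+ j - p' h ^+ i * q' h ^+ j))).
- move=> i j; apply: psrZ.
  have -> : (i + j)%:R * e ^+ (i + j) * (d / e) =
     i%:R * e ^+ i * (d / e) * e ^+ j + e ^+ i * (j%:R * e ^+ j * (d / e)).
    by rewrite natrD exprD; ring.
  apply: psr_ext (psrD (psrM (psr_pow_diff i e0 pe p'e pd) (psrX j qe))
    (psrM (psrX i p'e) (psr_pow_diff j e0 qe q'e qd))) => h _.
  by ring.
- move=> N; have -> : L * d = L * e * (d / e) by field; rewrite gt_eqF.
  apply: le_trans (ler_wpM2r _ (cL N)); last by rewrite divr_ge0 // ltW.
  rewrite mulr_suml; apply: ler_sum => i _; rewrite mulr_suml; apply: ler_sum => j _.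
  by rewrite !mulrA.
- move=> h ht.
  have hs p1 q1 : psr t e p1 -> psr t e q1 -> `|row2 (p1 h) (q1 h)| < s.
    move=> p1e q1e; apply: norm_row_lt => //; apply: forall_I2; rewrite ?row2_0 ?row2_1.
      exact: le_lt_trans (psr_le p1e ht) es.
    exact: le_lt_trans (psr_le q1e ht) es.
  have := cvgnB (cf _ (hs _ _ pe qe)) (cf _ (hs _ _ p'e q'e)); apply: cvgn_ext => N.
  rewrite /psum -sumrB; apply: eq_bigr => i _; rewrite -sumrB; apply: eq_bigr => j _.
  by rewrite !row2_0 !row2_1; ring.
Qed.

(** For a series of order at least 2 the sum is quadratic in [e]: the coefficients weighted by the
    squared degree are still summable at a smaller radius, and [pser_small] extracts [(e / r) ^+ 2].
    For small [e] this lies below [L * e]. *)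
Lemma lipschitz_small s B c f L : pser s B c f -> (forall i j, (i + j < 2)%N -> c i j = 0) ->
  0 < L -> exists2 e0, 0 < e0 & forall e, 0 < e -> e <= e0 -> lipschitz_bound e L c.
Proof.
move=> [s0 cB _] c2 L0; pose r := s / 2.
have r0 : 0 < r by rewrite divr_gt0.
have rs : r < s by rewrite /r; lra.
have [B' hB'] := pnorm_sqr r0 rs cB.
have B'0 : 0 <= B' by have := hB' 0%N; rewrite big_ord0.
exists (Num.min r (L * r ^+ 2 / (B' + 1))).
  by rewrite lt_min r0 divr_gt0 ?mulr_gt0 ?exprn_gt0 // ltr_wpDl.
move=> e e0; rewrite le_min => /andP[er eL].
pose c' i j := (i + j)%:R ^+ 2 * c i j.
have c'B : pnorm_le r B' c'.
  move=> N; apply: le_trans (hB' N); apply: ler_sum => i _; apply: ler_sum => j _.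
  rewrite /c' normrM ger0_norm ?exprn_ge0 // le_eqVlt; apply/orP; left.
  by apply/eqP; ring.
have c'2 i j : (i + j < 2)%N -> c' i j = 0 by move=> /c2 ij0; rewrite /c' ij0 mulr0.
have [_ small _] := pser_small c'2 e0 er (pser_pev r0 c'B).
move=> N; apply: (@le_trans _ _ ((e / r) ^+ 2 * B')).
  apply: le_trans (small N); apply: ler_sum => i _; apply: ler_sum => j _.
  rewrite /c' normrM ger0_norm ?exprn_ge0 // [_ * `|c i j|]mulrC -[leRHS]mulrA.
  rewrite ler_wpM2l // ler_wpM2r ?exprn_ge0 ?(ltW e0) //.
  rewrite -natrX ler_nat; case: (i + j)%N => // n.
  by rewrite -[X in (X <= _)%N]expn1 leq_pexp2l.
rewrite expr_div_n expr2 mulrAC ler_pdivrMr ?exprn_gt0 //.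
have B1 : 0 < B' + 1 by rewrite ltr_wpDl.
move: eL; rewrite ler_pdivlMr // => eL.
have : e * e * B' <= e * (e * (B' + 1)).
  by rewrite -mulrA ler_wpM2l ?(ltW e0) // ler_wpM2l ?(ltW e0) // lerDl.
move=> /le_trans; apply; rewrite (_ : L * e * r ^+ 2 = e * (L * r ^+ 2)); last by ring.
by rewrite ler_wpM2l ?(ltW e0).
Qed.

(** The algebra estimate applied to constant functions; the radius 1 of their polydisc is
    arbitrary. *)
Lemma lipschitz_point s B c f e L u v : pser s B c f -> 0 < e -> e < s -> 0 <= L ->
  lipschitz_bound e L c -> `|u| <= e -> `|v| <= e -> `|f u - f v| <= L * `|u - v|.
Proof.
move=> cf e0 es L0 cL ue ve.
have cst (w : 'rV[R]_2) i : `|w| <= e -> psr 1 e (fun _ => w 0 i).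
  by move=> we; apply: psr_mono (psr_cst (w 0 i) ltr01); exact: le_trans (norm_coord_le _ _) we.
have cstB i : psr 1 `|u - v| (fun _ => u 0 i - v 0 i).
  apply: psr_mono (psr_cst (u 0 i - v 0 i) ltr01).
  by have := norm_coord_le (u - v) i; rewrite !mxE.
have := psr_lipschitz cf e0 es L0 cL (cst u 0 ue) (cst u 1 ue) (cst v 0 ve) (cst v 1 ve)
  (cstB 0) (cstB 1).
have h0 : `|0 : 'rV[R]_2| < 1 :> R by rewrite normr0.
move=> /psr_le /(_ h0).
by rewrite !row2E.
Qed.

(* The inverse of id + N, for N of order at least 2 at the origin, is the limit
   of the iteration G |-> id - N o G, a contraction of a ball of the algebra of
   power series that converge absolutely on the polydisc of radius e / 2. *)
Lemma perturbed_identity_inverse s B (c : 'I_2 -> nat -> nat -> R)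
    (N : 'I_2 -> 'rV[R]_2 -> R) (r : R) : 0 < r ->
  (forall i, pser s B (c i) (N i)) ->
  (forall i k l, (k + l < 2)%N -> c i k l = 0) ->
  exists (e t : R) (G : 'I_2 -> 'rV[R]_2 -> R),
  [/\ [/\ 0 < e, e < s, e < r & 0 < t], forall i, psr t e (G i),
      forall y, `|y| < t -> forall i, G i y + N i (row2 (G 0 y) (G 1 y)) = y 0 i &
      forall u v, `|u| <= e -> `|v| <= e ->
        (forall i, u 0 i + N i u = v 0 i + N i v) -> u = v].
Proof.
move=> r0 cN c2; have s0 : 0 < s by case: (cN 0).
pose L : R := 2^-1; have L0 : 0 < L by rewrite invr_gt0.
have [e0 e00 he0] := lipschitz_small (cN 0) (c2 0) L0.
have [e1 e10 he1] := lipschitz_small (cN 1) (c2 1) L0.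
pose e := Num.min (Num.min e0 e1) (Num.min (s / 2) (r / 2)).
have e_gt0 : 0 < e by rewrite !lt_min e00 e10 !divr_gt0.
have ee0 : e <= e0 by rewrite !ge_min lexx.
have ee1 : e <= e1 by rewrite !ge_min lexx !orbT.
have ees : e < s.
  by apply: (@le_lt_trans _ _ (s / 2)); [rewrite !ge_min lexx !orbT|lra].
have eer : e < r.
  by apply: (@le_lt_trans _ _ (r / 2)); [rewrite !ge_min lexx !orbT|lra].
have cL : forall i, lipschitz_bound e L (c i).
  by apply: forall_I2; [exact: he0|exact: he1].
have L0' := ltW L0.
have N0 i : N i 0 = 0 by rewrite (pser_at0 (cN i)) c2.
(* Since [L = 2^-1], this gives [t + L * e = e], so the iteration preserves the ball of radius [e],
   and its increments, of norm [t * L ^+ n], add up to at most [e]. *)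
pose t := e / 2; have t0 : 0 < t by rewrite divr_gt0.
pose G := fix G n : 'I_2 -> 'rV[R]_2 -> R := if n is m.+1
  then fun i y => y 0 i - N i (row2 (G m 0 y) (G m 1 y)) else fun _ _ => 0.
have zero_psr d : 0 <= d -> psr t d (fun _ => 0).
  by move=> d0; apply: psr_mono (psr_cst 0 t0); rewrite normr0.
have Ge n : forall i, psr t e (G n i).
  elim: n => [|n IH] i; first exact: zero_psr (ltW e_gt0).
  have e0' := zero_psr e (ltW e_gt0).
  have B0 j : psr t e (fun h => G n j h - 0).
    by apply: psr_ext (IH j) => h _; rewrite subr0.
  have := psrB (psr_coord i t0)
    (psr_lipschitz (cN i) e_gt0 ees L0' (cL i) (IH 0) (IH 1) e0' e0' (B0 0) (B0 1)).
  rewrite (_ : t + L * e = e); last by rewrite /t /L; field.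
  apply: psr_ext => y _ /=; congr (_ - _).
  have -> : row2 0 0 = 0 :> 'rV[R]_2 by apply: row2P; rewrite ?row2_0 ?row2_1 mxE.
  by rewrite N0 subr0.
have dG n : forall i, psr t (t * L ^+ n) (fun y => G n.+1 i y - G n i y).
  elim: n => [|n IH] i.
    rewrite mulr1; apply: psr_ext (psr_coord i t0) => y _ /=.
    have -> : row2 0 0 = 0 :> 'rV[R]_2 by apply: row2P; rewrite ?row2_0 ?row2_1 mxE.
    by rewrite N0 !subr0.
  have := psr_lipschitz (cN i) e_gt0 ees L0' (cL i) (Ge n.+1 0) (Ge n.+1 1)
    (Ge n 0) (Ge n 1) (IH 0) (IH 1).
  rewrite (_ : L * (t * L ^+ n) = t * L ^+ n.+1); last by rewrite exprS; ring.
  move=> /(psrZ (-1)); rewrite normrN1 mul1r; apply: psr_ext => y _ /=.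
  by ring.
have tel i y K : \sum_(n < K) (G n.+1 i y - G n i y) = G K i y.
  elim: K => [|K IH]; first by rewrite big_ord0.
  by rewrite big_ord_recr /= IH addrC subrK.
have sumB K : \sum_(n < K) t * L ^+ n <= e.
  rewrite -mulr_sumr (_ : e = t * 2); last by rewrite /t; field.
  by rewrite ler_wpM2l ?(ltW t0) // geometric_half_le.
have Gcvg i y : `|y| < t -> cvgn (fun K => G K i y).
  move=> yt; under eq_fun do rewrite -tel.
  refine (@dominated_sum_cvg R (fun n => G n.+1 i y - G n i y) (fun n => t * L ^+ n) e _ sumB).
  by move=> n; exact: psr_le (dG n i) yt.
pose Gi i y := limn (fun K => G K i y).
have GE i : psr t e (Gi i).
  apply: (psr_series (fun n => dG n i) sumB) => y yt.
  by under eq_fun do rewrite tel; exact: Gcvg.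
exists e, t, Gi; split => //.
- move=> y yt i.
  pose w := row2 (Gi 0 y) (Gi 1 y).
  have wi j : w 0 j = Gi j y.
    by move: j; apply: forall_I2; rewrite ?row2_0 ?row2_1.
  have we : `|w| <= e.
    by apply: norm_row_le (ltW e_gt0) _ => j; rewrite wi; exact: psr_le (GE j) yt.
  pose wn n := row2 (G n 0 y) (G n 1 y).
  have wni n j : wn n 0 j = G n j y.
    by move: j; apply: forall_I2; rewrite ?row2_0 ?row2_1.
  have wne n : `|wn n| <= e.
    by apply: norm_row_le (ltW e_gt0) _ => j; rewrite wni; exact: psr_le (Ge n j) yt.
  have Ncvg : (fun n => N i (wn n)) @ \oo --> N i w.
    apply/cvgrPdist_le => d d0.
    have near_j j : \forall n \near \oo, `|Gi j y - G n j y| <= d.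
      by have /cvgrPdist_le := Gcvg j y yt; apply.
    apply: filterS2 (near_j 0) (near_j 1) => n h0 h1.
    apply: le_trans (lipschitz_point (cN i) e_gt0 ees L0' (cL i) we (wne n)) _.
    apply: (@le_trans _ _ (1 * `|w - wn n|)).
      by rewrite ler_wpM2r // /L; lra.
    rewrite mul1r; apply: norm_row_le (ltW d0) _ => j; rewrite !mxE.
    by move: j; apply: forall_I2.
  have lhs : (fun n => G n.+1 i y) @ \oo --> Gi i y.
    have : (fun n => G (n + 1)%N i y) @ \oo --> Gi i y.
      by rewrite (cvg_shiftn 1 (fun n => G n i y)); exact: Gcvg.
    by apply: cvgn_ext => n; rewrite addn1.
  have rhs : (fun n => G n.+1 i y) @ \oo --> y 0 i - N i w.
    exact: (cvgnB (cvg_cst (y 0 i)) Ncvg).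
  have -> : Gi i y = y 0 i - N i w.
    by move/cvg_lim: lhs => <- //; move/cvg_lim: rhs => ->.
  by rewrite subrK.
- move=> u v ue ve uv.
  have le i : `|(u - v) 0 i| <= L * `|u - v|.
    have -> : (u - v) 0 i = N i v - N i u.
      by have := uv i; rewrite !mxE; lra.
    rewrite distrC; exact: lipschitz_point (cN i) e_gt0 ees L0' (cL i) ue ve.
  have : `|u - v| <= L * `|u - v|.
    by apply: norm_row_le => //; rewrite mulr_ge0.
  move=> h; have : `|u - v| <= 0 by move: h; rewrite /L; lra.
  by rewrite normr_le0 subr_eq0 => /eqP.
Qed.

End InverseFunction.

(** * The analytic inverse function theorem *)

Section AnalyticInverse.
Variable R : realType.
Implicit Types (u v a : 'rV[R]_2) (f : 'rV[R]_2 -> R).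

Lemma analytic_continuous f a : analytic_at f a -> {for a, continuous f}.
Proof. by move=> /analytic_differentiable/differentiable_continuous. Qed.

Lemma analytic_norm_lt f u (t : R) : analytic_at f u -> `|f u| < t ->
  \forall v \near u, `|f v| < t.
Proof.
move=> /analytic_continuous fc fu.
exact: (cvgr_norm_lt _ fc _ fu).
Qed.

Lemma near_forall_I2 (P : 'I_2 -> 'rV[R]_2 -> Prop) u :
  (forall i, \forall v \near u, P i v) -> \forall v \near u, forall i, P i v.
Proof.
move=> Pu; apply: filterS2 (Pu 0) (Pu 1) => v h0 h1.
exact: forall_I2.
Qed.

Lemma near_dist_lt u a (e : R) : `|u - a| < e -> \forall v \near u, `|v - a| < e.
Proof.
move=> ue; apply/near_rowP; exists (e - `|u - a|); first by rewrite subr_gt0.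
by move=> h he; rewrite addrAC; apply: le_lt_trans (ler_normD _ _) _; lra.
Qed.

Lemma psr_analytic t B (G : 'rV[R]_2 -> R) y : psr t B G -> `|y| < t -> analytic_at G y.
Proof.
move=> Gt yt; apply/analytic_atP; exists ((t - `|y|) / 2), B.
by apply: (psr_recenter Gt); lra.
Qed.

(** Composing [F - F a] with the inverse Jacobian gives the identity plus terms of order at least 2,
    the case already treated. The parameter [P] carries any property valid near [a] to the whole of
    [U], so that a chart built on [U] has it everywhere. *)
Lemma analytic_inverse (F : 'rV[R]_2 -> 'rV[R]_2) a (P : 'rV[R]_2 -> Prop)
    (J := fun i j => 'D_(delta_mx 0 j) (fun u => F u 0 i) a) :
  (forall i, analytic_at (fun u => F u 0 i) a) ->
  J 0 0 * J 1 1 - J 0 1 * J 1 0 != 0 ->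
  (\forall u \near a, P u) ->
  exists (G : 'rV[R]_2 -> 'rV[R]_2) (U V : set 'rV[R]_2),
  [/\ open U /\ open V, U a,
      forall u, U u -> [/\ V (F u), G (F u) = u & P u],
      forall v, V v -> U (G v) /\ F (G v) = v &
      analytic_on U F /\ analytic_on V G].
Proof.
move=> Fa det0 Pa; set D := _ - _ in det0.
(* The rows of the inverse Jacobian, by Cramer's rule. *)
pose L i (w : 'rV[R]_2) : R := if i == 0 :> 'I_2
  then D^-1 * (J 1 1 * w 0 0 - J 0 1 * w 0 1) else D^-1 * (J 0 0 * w 0 1 - J 1 0 * w 0 0).
have L_inj w w' : (forall i, L i w = L i w') -> w = w'.
  move=> h; have h0 := h 0; have h1 := h 1; rewrite /L /= in h0 h1.
  have D' : D^-1 != 0 by rewrite invr_eq0.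
  move/(mulfI D') : h0 => h0; move/(mulfI D') : h1 => h1.
  apply: row2P; apply: (mulfI det0); rewrite /D.
    transitivity (J 0 0 * (J 1 1 * w 0 0 - J 0 1 * w 0 1)
      + J 0 1 * (J 0 0 * w 0 1 - J 1 0 * w 0 0)); first by ring.
    by rewrite h0 h1; ring.
  transitivity (J 1 0 * (J 1 1 * w 0 0 - J 0 1 * w 0 1)
      + J 1 1 * (J 0 0 * w 0 1 - J 1 0 * w 0 0)); first by ring.
  by rewrite h0 h1; ring.
have L_an i (f : 'rV[R]_2 -> 'rV[R]_2) u :
    (forall j, analytic_at (fun v => f v 0 j) u) -> analytic_at (fun v => L i (f v)) u.
  move=> fu.
  have sc b j : analytic_at (fun v => b * f v 0 j) u.
    exact: analyticM (analytic_cst b u) (fu j).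
  by rewrite /L; case: (i == 0); apply: analyticM (analytic_cst _ u) (analyticB (sc _ _) (sc _ _)).
pose K i u := L i (F u - F a).
have subF_an u : (forall i, analytic_at (fun v => F v 0 i) u) ->
    forall i, analytic_at (fun v => (F v - F a) 0 i) u.
  move=> Fu i; apply: analytic_ext (analyticB (Fu i) (analytic_cst (F a 0 i) u)).
  by move=> v; rewrite !mxE.
have K_an u : (forall i, analytic_at (fun v => F v 0 i) u) -> forall i, analytic_at (K i) u.
  by move=> Fu i; apply: L_an; exact: subF_an.
have Ka i : K i a = 0 by rewrite /K /L subrr !mxE !mulr0 subrr mulr0 if_same.
have dF i j : derivable (fun u => F u 0 i) a (delta_mx 0 j).
  exact/diff_derivable/analytic_differentiable.
have dK i j : 'D_(delta_mx 0 j) (K i) a = (i == j)%:R.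
  have dFB l : is_derive a (delta_mx 0 j : 'rV[R]_2) (fun u => F u 0 l - F a 0 l) (J l j).
    by apply: is_derive_eq (is_deriveB (derivableP (dF l j)) (is_derive_cst _ _ _)) _; rewrite subr0.
  have key b b' l l' : is_derive a (delta_mx 0 j : 'rV[R]_2)
      (fun u => D^-1 * (b * (F u 0 l - F a 0 l) - b' * (F u 0 l' - F a 0 l')))
      (D^-1 * (b * J l j - b' * J l' j)).
    exact: (is_deriveZ D^-1 (is_deriveB (is_deriveZ b (dFB l)) (is_deriveZ b' (dFB l')))).
  have D'D : D^-1 * D = 1 by rewrite mulVf.
  have KE0 : K 0 = fun u => D^-1 * (J 1 1 * (F u 0 0 - F a 0 0) - J 0 1 * (F u 0 1 - F a 0 1)).
    by apply/funext => u; rewrite /K /L /= !mxE.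
  have KE1 : K 1 = fun u => D^-1 * (J 0 0 * (F u 0 1 - F a 0 1) - J 1 0 * (F u 0 0 - F a 0 0)).
    by apply/funext => u; rewrite /K /L /= !mxE.
  move: i j {dF} dFB key; apply: forall_I2; apply: forall_I2 => _ key;
    rewrite ?KE0 ?KE1 (derive_val (is_derive := key _ _ _ _)) /=.
  - by rewrite -D'D /D; ring.
  - by ring.
  - by ring.
  - by rewrite -D'D /D; ring.
pose N i h := K i (a + h) - h 0 i.
have N_an i : analytic_at (fun u => K i u - (u 0 i - a 0 i)) a.
  by apply: analyticB (K_an _ Fa i) (analyticB (analytic_coord i a) (analytic_cst _ a)).
have NE i h : K i (a + h) - ((a + h) 0 i - a 0 i) = N i h.
  by rewrite /N mxE [a 0 i + _]addrC addrK.
have dN i j : 'D_(delta_mx 0 j) (fun u => K i u - (u 0 i - a 0 i)) a = 0.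
  have dKi : derivable (K i) a (delta_mx 0 j).
    exact/diff_derivable/analytic_differentiable/K_an.
  have dco : is_derive a (delta_mx 0 j : 'rV[R]_2) (fun u => u 0 i - a 0 i) (i == j)%:R.
    have : derivable (fun u : 'rV[R]_2 => u) a (delta_mx 0 j) by exact: derivable_id.
    move=> did; have := derive_mx did; rewrite derive_id => /matrixP/(_ 0 i); rewrite !mxE.
    rewrite eqxx /= => E; move/derivable_mxP : did => /(_ 0 i) did.
    apply: is_derive_eq (is_deriveB (derivableP did) (is_derive_cst _ _ _)) _.
    by rewrite subr0 -E.
  have := is_deriveB (derivableP dKi) dco; rewrite dK subrr => h.
  exact: (derive_val (is_derive := h)).
have [t0 [B0 [B1 [t00 [c0 cN0] [c1 cN1]]]]] := analytic_common2 (N_an 0) (N_an 1).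
pose c (i : 'I_2) := if i == 0 then c0 else c1.
have cN' : forall i, pser t0 (B0 + B1) (c i)
    (fun h => (fun u => K i u - (u 0 i - a 0 i)) (a + h)).
  have B00 : 0 <= B0 by case: cN0 => _ /pnorm_ge0.
  have B10 : 0 <= B1 by case: cN1 => _ /pnorm_ge0.
  apply: forall_I2; first by apply: pser_mono cN0; rewrite lerDl.
  by apply: pser_mono cN1; rewrite lerDr.
have cN : forall i, pser t0 (B0 + B1) (c i) (N i).
  by move=> i; apply: pser_ext (cN' i) => h _; exact: NE.
have c2 i k l : (k + l < 2)%N -> c i k l = 0.
  have gr j : Dcoef j (c i) 0%N 0%N = 0.
    by have [B' h] := analytic_derive_pser (a := a)
      (f := fun u => K i u - (u 0 i - a 0 i)) j (cN' i); rewrite -(pser_at0 h) addr0 dN.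
  case: k => [|[|//]]; case: l => [|[|//]] //= _.
  - by rewrite -(pser_at0 (cN i)) /N addr0 Ka mxE subrr.
  - by have := gr 1; rewrite /Dcoef /= /D1 mul1r.
  - by have := gr 0; rewrite /Dcoef /= /D0 mul1r.
have /near_rowP[r r0 hr] : \forall u \near a,
    (forall i, analytic_at (fun v => F v 0 i) u) /\ P u.
  apply: filterS2 (near_forall_I2 (fun i => analytic_near (Fa i))) Pa => u h1 h2.
  by split.
have [e [t [G [[e0 es er t_gt0] Ge GN inj]]]] := perturbed_identity_inverse r0 cN c2.
have good u : `|u - a| < e -> (forall i, analytic_at (fun v => F v 0 i) u) /\ P u.
  move=> ue; have := hr (u - a); rewrite [a + _]addrC subrK; apply.
  exact: lt_trans ue er.
pose Lr v := row2 (L 0 (v - F a)) (L 1 (v - F a)).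
have LrE v i : Lr v 0 i = L i (v - F a).
  by move: i; apply: forall_I2; rewrite ?row2_0 ?row2_1.
pose Gr v := row2 (G 0 (Lr v)) (G 1 (Lr v)).
have GrE v i : Gr v 0 i = G i (Lr v).
  by move: i; apply: forall_I2; rewrite ?row2_0 ?row2_1.
have Lr_an v : forall i, analytic_at (fun v => Lr v 0 i) v.
  move=> i; apply: analytic_ext (L_an i (fun w => w - F a) v _) => [w|j].
    by rewrite LrE.
  apply: analytic_ext (analyticB (analytic_coord j v) (analytic_cst (F a 0 j) v)).
  by move=> w; rewrite !mxE.
have Lr_lt v : (forall i, `|L i (v - F a)| < t) -> `|Lr v| < t.
  by move=> h; apply: norm_row_lt => // i; rewrite LrE.
have Gr_an v : `|Lr v| < t -> forall i, analytic_at (fun v => Gr v 0 i) v.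
  move=> vt i; have := analytic_comp (Lr_an v) (psr_analytic (Ge i) vt).
  by apply: analytic_ext => w /=; rewrite GrE.
have Gr_le v : `|Lr v| < t -> `|Gr v| <= e.
  move=> vt; apply: norm_row_le (ltW e0) _ => i; rewrite GrE.
  exact: psr_le (Ge i) vt.
have KN u i : K i u = (u - a) 0 i + N i (u - a).
  by rewrite /N [a + _]addrC subrK addrC subrK.
(* Each set imposes the strict bound [t] on the image side and [e] on the source side. Strictness
   makes both open, and imposing both bounds on both sides makes [F] and its inverse exchange them
   exactly. *)
pose U := [set u | `|u - a| < e /\ forall i, `|K i u| < t].
pose V := [set v | (forall i, `|L i (v - F a)| < t) /\ `|Gr v| < e].
exists (fun v => a + Gr v), U, V; split.
- split; rewrite openE.
    move=> u [ue uK]; have [Fu _] := good _ ue; rewrite /interior /=.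
    apply: filterS2 (near_dist_lt ue) (near_forall_I2 (fun i =>
      analytic_norm_lt (K_an u Fu i) (uK i))) => v h1 h2.
    by split.
  move=> v [vL vG]; have vt := Lr_lt _ vL; rewrite /interior /=.
  have n1 : \forall w \near v, forall i, `|Lr w 0 i| < t.
    by apply: near_forall_I2 => i; apply: analytic_norm_lt => //; rewrite LrE.
  have n2 : \forall w \near v, forall i, `|Gr w 0 i| < e.
    apply: near_forall_I2 => i; apply: analytic_norm_lt; first exact: Gr_an.
    exact: le_lt_trans (norm_coord_le _ _) vG.
  apply: filterS2 n1 n2 => w h1 h2; split; last exact: norm_row_lt.
  by move=> i; rewrite -LrE.
- by split; [rewrite subrr normr0|move=> i; rewrite Ka normr0].
- move=> u [ue uK]; have [_ Pu] := good _ ue.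
  have ut : `|Lr (F u)| < t by apply: Lr_lt.
  have GE : Gr (F u) = u - a.
    apply: inj; [exact: Gr_le|exact: ltW|] => i.
    by rewrite -KN {1}GrE GN // LrE.
  split => //; last by rewrite GE addrC subrK.
  by split; [exact: uK|rewrite GE].
- move=> v [vL vG]; have vt := Lr_lt _ vL.
  have KE i : K i (a + Gr v) = L i (v - F a).
    by rewrite KN [a + _]addrC addrK {1}GrE GN // LrE.
  split; first by split; [rewrite [a + _]addrC addrK|move=> i; rewrite KE].
  have := L_inj _ _ KE; move=> /(congr1 (+%R^~ (F a))).
  by rewrite !subrK.
split=> [u [ue _]|v [vL vG] i]; first by have [] := good _ ue.
apply: analytic_ext (analyticD (analytic_cst (a 0 i) v) (Gr_an _ (Lr_lt _ vL) i)).
by move=> w; rewrite !mxE.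
Qed.

End AnalyticInverse.

(** * Algebra of the associative and coassociative forms *)

Section CrossProducts.
Variable R : realType.
Implicit Types u v w x y z : 'rV[R]_7.

(** Natural number indices let concrete coordinates compute, so that the forms unfold to polynomials
    that [ring] can compare. *)
Definition co x (k : nat) : R := x 0 (inord k : 'I_7).

Lemma rowP7 x y : (forall k, (k < 7)%N -> co x k = co y k) -> x = y.
Proof.
by move=> h; apply/rowP => i; have := h i (ltn_ord i); rewrite /co inord_val.
Qed.

Lemma coD x y k : co (x + y) k = co x k + co y k. Proof. by rewrite /co mxE. Qed.
Lemma coN x k : co (- x) k = - co x k. Proof. by rewrite /co mxE. Qed.
Lemma coZ a x k : co (a *: x) k = a * co x k. Proof. by rewrite /co mxE. Qed.
Lemma co0 k : co 0 k = 0. Proof. by rewrite /co mxE. Qed.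
Definition coE := (coD, coN, coZ, co0).

Lemma dotE x y : dot x y = co x 0 * co y 0 + co x 1 * co y 1 + co x 2 * co y 2
  + co x 3 * co y 3 + co x 4 * co y 4 + co x 5 * co y 5 + co x 6 * co y 6.
Proof.
have -> : dot x y = \sum_(i < 7) co x i * co y i.
  by apply: eq_bigr => i _; rewrite /co inord_val.
by rewrite !big_ord_recr big_ord0 /= add0r.
Qed.

Lemma det_nat_rec n (f : nat -> nat -> R) :
  \det (\matrix_(a < n.+1, b < n.+1) f a b) = \sum_(j < n.+1) (-1) ^+ j *
    (f 0%N j * \det (\matrix_(a < n, b < n) f a.+1 (bump j b))).
Proof.
rewrite (expand_det_row _ ord0); apply: eq_bigr => j _.
rewrite mxE /cofactor add0n mulrCA; congr (_ * (_ * \det _)).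
by apply/matrixP => a b; rewrite !mxE.
Qed.

Definition d2 x y i j : R := co x i * co y j - co x j * co y i.
Definition d3 x y z i j k : R :=
  co x i * d2 y z j k - co x j * d2 y z i k + co x k * d2 y z i j.

Lemma det_nat2 (f : nat -> nat -> R) : \det (\matrix_(a < 2, b < 2) f a b) =
  f 0%N 0%N * f 1%N 1%N - f 0%N 1%N * f 1%N 0%N.
Proof.
rewrite det_nat_rec !big_ord_recl big_ord0 /= !det_mx11 !mxE /= /bump /=.
by rewrite expr0 expr1; ring.
Qed.

Lemma det_nat3 (f : nat -> nat -> R) : \det (\matrix_(a < 3, b < 3) f a b) =
  f 0%N 0%N * (f 1%N 1%N * f 2%N 2%N - f 1%N 2%N * f 2%N 1%N)
  - f 0%N 1%N * (f 1%N 0%N * f 2%N 2%N - f 1%N 2%N * f 2%N 0%N)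
  + f 0%N 2%N * (f 1%N 0%N * f 2%N 1%N - f 1%N 1%N * f 2%N 0%N).
Proof.
rewrite det_nat_rec !big_ord_recl big_ord0 /=.
rewrite !(det_nat2 (fun a b => f a.+1 (bump _ b))) /bump /=.
by rewrite expr0 expr1 /=; ring.
Qed.

Lemma dx3E i j k x y z : dx [tuple i.+1; j.+1; k.+1]
  (\matrix_(a < 3) tnth [tuple x; y; z] a) = d3 x y z i j k.
Proof.
pose f a b := co (nth 0 [:: x; y; z] a) (nth 0%N [:: i; j; k] b).
rewrite /dx (_ : (\matrix_(a, b) _) = \matrix_(a < 3, b < 3) f a b); last first.
  apply/matrixP => a b; rewrite !mxE (tnth_nth 0%N) (tnth_nth 0) /f /co /=.
  by case: b => [[|[|[|//]]] hb].
by rewrite det_nat3 /f /=.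
Qed.

Lemma dx4E i j k l x y z w : dx [tuple i.+1; j.+1; k.+1; l.+1]
  (\matrix_(a < 4) tnth [tuple x; y; z; w] a) =
  co x i * d3 y z w j k l - co x j * d3 y z w i k l + co x k * d3 y z w i j l
  - co x l * d3 y z w i j k.
Proof.
pose f a b := co (nth 0 [:: x; y; z; w] a) (nth 0%N [:: i; j; k; l] b).
rewrite /dx (_ : (\matrix_(a, b) _) = \matrix_(a < 4, b < 4) f a b); last first.
  apply/matrixP => a b; rewrite !mxE (tnth_nth 0%N) (tnth_nth 0) /f /co /=.
  by case: b => [[|[|[|[|//]]]] hb].
rewrite det_nat_rec !big_ord_recl big_ord0 /=.
rewrite !(det_nat3 (fun a b => f a.+1 (bump _ b))) /bump /f /= /d3 /d2.
by rewrite expr0 expr1 /=; ring.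
Qed.

Lemma phiE x y z : phi x y z = d3 x y z 0 1 2 + d3 x y z 0 3 4 + d3 x y z 0 5 6
  + d3 x y z 1 3 5 - d3 x y z 1 4 6 - d3 x y z 2 3 6 - d3 x y z 2 4 5.
Proof. by rewrite /phi /phi_form !dx3E. Qed.

(** Entry [k] is the coefficient of [co w k] when the seven 4 by 4 minors of [starphi x y z w] are
    expanded along [w]. *)
Definition cross3_co x y z k : R := nth 0 [::
 - d3 x y z 2 4 6 + d3 x y z 2 3 5 + d3 x y z 1 4 5 + d3 x y z 1 3 6;
 - d3 x y z 2 5 6 - d3 x y z 2 3 4 - d3 x y z 0 4 5 - d3 x y z 0 3 6;
 d3 x y z 1 5 6 + d3 x y z 1 3 4 + d3 x y z 0 4 6 - d3 x y z 0 3 5;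
 - d3 x y z 4 5 6 - d3 x y z 1 2 4 + d3 x y z 0 2 5 + d3 x y z 0 1 6;
 d3 x y z 3 5 6 + d3 x y z 1 2 3 - d3 x y z 0 2 6 + d3 x y z 0 1 5;
 - d3 x y z 3 4 6 - d3 x y z 1 2 6 - d3 x y z 0 2 3 - d3 x y z 0 1 4;
 d3 x y z 3 4 5 + d3 x y z 1 2 5 + d3 x y z 0 2 4 - d3 x y z 0 1 3] k.

Lemma starphiE x y z w : starphi x y z w =
  cross3_co x y z 0 * co w 0 + cross3_co x y z 1 * co w 1 + cross3_co x y z 2 * co w 2
  + cross3_co x y z 3 * co w 3 + cross3_co x y z 4 * co w 4 + cross3_co x y z 5 * co w 5
  + cross3_co x y z 6 * co w 6.
Proof.
rewrite /starphi /starphi_form !dx4E /cross3_co /= /d3 /d2.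
by ring.
Qed.

Lemma cross3E x y z k : (k < 7)%N -> co (cross3 x y z) k = cross3_co x y z k.
Proof.
move=> k7.
suff -> : cross3 x y z = \row_i cross3_co x y z i by rewrite /co mxE inordK.
apply/esym/cross3_unique => w; rewrite starphiE dotE.
by rewrite /co !mxE !inordK.
Qed.

Definition cross2 x y : 'rV[R]_7 := \row_(i < 7) nth 0 [::
  d2 x y 1 2 + d2 x y 3 4 + d2 x y 5 6;
  - d2 x y 0 2 + d2 x y 3 5 - d2 x y 4 6;
  d2 x y 0 1 - d2 x y 3 6 - d2 x y 4 5;
  - d2 x y 0 4 - d2 x y 1 5 + d2 x y 2 6;
  d2 x y 0 3 + d2 x y 1 6 + d2 x y 2 5;
  - d2 x y 0 6 + d2 x y 1 3 - d2 x y 2 4;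
  d2 x y 0 5 - d2 x y 1 4 - d2 x y 2 3] i.

Lemma cross2P x y z : dot (cross2 x y) z = phi x y z.
Proof. by rewrite phiE dotE /co !mxE !inordK //= /d3 /d2 -!/(co _ _); ring. Qed.

Lemma phi_cross3 x y z : phi x y (cross3 x y z) = 0.
Proof.
rewrite phiE /d3 /d2 !cross3E // /cross3_co /= /d3 /d2.
move: (co x 0) (co x 1) (co x 2) (co x 3) (co x 4) (co x 5) (co x 6).
move: (co y 0) (co y 1) (co y 2) (co y 3) (co y 4) (co y 5) (co y 6).
move: (co z 0) (co z 1) (co z 2) (co z 3) (co z 4) (co z 5) (co z 6) => *.
by ring.
Qed.

(** For orthonormal [x], [y] this says that the square of [cross3 x y] is minus the identity,
    corrected along [x], [y] and [cross2 x y]; the complex structure comes from here. The identity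
    is polynomial in the coordinates and is checked entry by entry. *)
Lemma cross3_cross3 x y z : cross3 x y (cross3 x y z) =
  - (dot x x * dot y y - dot x y ^+ 2) *: z
  + (dot y y * dot x z - dot x y * dot y z) *: x
  + (dot x x * dot y z - dot x y * dot x z) *: y + phi x y z *: cross2 x y.
Proof.
apply: rowP7 => k k7; rewrite !coE cross3E // !dotE phiE [co (cross2 x y) k]mxE inordK //.
move: k k7.
do 7?[case=> [_|]; [
  rewrite /cross3_co /= /d3 /d2 !cross3E // /cross3_co /= /d3 /d2;
  move: (co x 0) (co x 1) (co x 2) (co x 3) (co x 4) (co x 5) (co x 6);
  move: (co y 0) (co y 1) (co y 2) (co y 3) (co y 4) (co y 5) (co y 6);
  move: (co z 0) (co z 1) (co z 2) (co z 3) (co z 4) (co z 5) (co z 6) => *;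
  ring | ]].
by [].
Qed.

End CrossProducts.

Section Multilinear.
Variable R : realType.
Implicit Types (a b : R) (u v w x y z : 'rV[R]_7).

Lemma dotC x y : dot x y = dot y x.
Proof. by apply: eq_bigr => i _; rewrite mulrC. Qed.

Lemma dotDl x y z : dot (x + y) z = dot x z + dot y z.
Proof. by rewrite /dot -big_split; apply: eq_bigr => i _; rewrite mxE mulrDl. Qed.

Lemma dotZl a x y : dot (a *: x) y = a * dot x y.
Proof. by rewrite /dot mulr_sumr; apply: eq_bigr => i _; rewrite mxE mulrA. Qed.

Lemma dotDr x y z : dot x (y + z) = dot x y + dot x z.
Proof. by rewrite dotC dotDl !(dotC x). Qed.

Lemma dotZr a x y : dot x (a *: y) = a * dot x y.
Proof. by rewrite dotC dotZl dotC. Qed.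

Lemma dotNl x y : dot (- x) y = - dot x y.
Proof. by rewrite -(scaleN1r x) dotZl mulN1r. Qed.

Lemma dotNr x y : dot x (- y) = - dot x y.
Proof. by rewrite dotC dotNl dotC. Qed.

Lemma dot0l x : dot 0 x = 0.
Proof. by rewrite -(scale0r 0) dotZl mul0r. Qed.

Lemma dot0r x : dot x 0 = 0. Proof. by rewrite dotC dot0l. Qed.

Definition dotL := (dotDl, dotDr, dotNl, dotNr, dotZl, dotZr, dot0l, dot0r).

Lemma dot_ge0 x : 0 <= dot x x.
Proof. by apply: sumr_ge0 => i _; rewrite -expr2 sqr_ge0. Qed.

Lemma dot_eq0 x : (dot x x == 0) = (x == 0).
Proof.
apply/idP/eqP => [|->]; last by rewrite dot0l.
rewrite psumr_eq0 => [/allP h|i _]; last by rewrite -expr2 sqr_ge0.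
apply/rowP => i; have := h i; rewrite mem_index_enum => /(_ isT).
by rewrite mulf_eq0 orbb mxE => /eqP.
Qed.

Lemma dot_gt0 x : (0 < dot x x) = (x != 0).
Proof. by rewrite lt_def dot_ge0 andbT dot_eq0. Qed.

Lemma d3_lin1 a x x' y z i j k :
  d3 (a *: x + x') y z i j k = a * d3 x y z i j k + d3 x' y z i j k.
Proof. by rewrite /d3 /d2 !coE; ring. Qed.

Lemma d3_swap12 x y z i j k : d3 y x z i j k = - d3 x y z i j k.
Proof. by rewrite /d3 /d2; ring. Qed.

Lemma d3_cycle x y z i j k : d3 y z x i j k = d3 x y z i j k.
Proof. by rewrite /d3 /d2; ring. Qed.

Lemma cross3_lin1 a x x' y z :
  cross3 (a *: x + x') y z = a *: cross3 x y z + cross3 x' y z.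
Proof.
apply: rowP7 => k k7; rewrite !coE !cross3E // /cross3_co.
by move: k k7; do 7?[case=> [_|]; [rewrite /= !d3_lin1; ring|]].
Qed.

Lemma cross3_swap12 x y z : cross3 y x z = - cross3 x y z.
Proof.
apply: rowP7 => k k7; rewrite !coE !cross3E // /cross3_co.
by move: k k7; do 7?[case=> [_|]; [rewrite /= !(d3_swap12 x y); ring|]].
Qed.

Lemma cross3_cycle x y z : cross3 y z x = cross3 x y z.
Proof.
apply: rowP7 => k k7; rewrite !cross3E // /cross3_co.
by move: k k7; do 7?[case=> [_|]; [rewrite /= !(d3_cycle x y z)|]].
Qed.

Lemma cross3_D1 x x' y z : cross3 (x + x') y z = cross3 x y z + cross3 x' y z.
Proof. by rewrite -[x]scale1r cross3_lin1 !scale1r. Qed.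

Lemma cross3_01 y z : cross3 0 y z = 0.
Proof. by have := cross3_lin1 (-1) 0 0 y z; rewrite scaler0 addr0 scaleN1r addNr. Qed.

Lemma cross3_Z1 a x y z : cross3 (a *: x) y z = a *: cross3 x y z.
Proof. by rewrite -[a *: x]addr0 cross3_lin1 cross3_01 addr0. Qed.

Lemma cross3_D2 x y y' z : cross3 x (y + y') z = cross3 x y z + cross3 x y' z.
Proof. by rewrite -!(cross3_cycle x) cross3_D1. Qed.

Lemma cross3_Z2 a x y z : cross3 x (a *: y) z = a *: cross3 x y z.
Proof. by rewrite -!(cross3_cycle x) cross3_Z1. Qed.

Lemma cross3_D3 x y z z' : cross3 x y (z + z') = cross3 x y z + cross3 x y z'.
Proof. by rewrite (cross3_cycle (z + z') x y) cross3_D1 -!(cross3_cycle _ x y). Qed.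

Lemma cross3_Z3 a x y z : cross3 x y (a *: z) = a *: cross3 x y z.
Proof. by rewrite (cross3_cycle (a *: z) x y) cross3_Z1 -(cross3_cycle _ x y). Qed.

Lemma cross3_03 x y : cross3 x y 0 = 0.
Proof. by rewrite cross3_cycle cross3_01. Qed.

Lemma cross3_N3 x y z : cross3 x y (- z) = - cross3 x y z.
Proof. by rewrite -(scaleN1r z) cross3_Z3 scaleN1r. Qed.

Lemma eq_oppr0 (V : lmodType R) (v : V) : v = - v -> v = 0.
Proof.
move=> /eqP; rewrite -subr_eq0 opprK -mulr2n -scaler_nat scaler_eq0 pnatr_eq0 /=.
by move/eqP.
Qed.

Lemma cross3_xxz x z : cross3 x x z = 0.
Proof. by apply: eq_oppr0; rewrite {1}cross3_swap12. Qed.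

Lemma cross3_xyy x y : cross3 x y y = 0.
Proof. by rewrite -(cross3_cycle x) cross3_xxz. Qed.

Lemma cross3_xyx x y : cross3 x y x = 0.
Proof. by rewrite (cross3_cycle x x y) cross3_xxz. Qed.

Definition cross3L := (cross3_D1, cross3_Z1, cross3_D2, cross3_Z2, cross3_D3, cross3_Z3,
  cross3_N3, cross3_xxz, cross3_xyy, cross3_xyx).

Lemma phi_D1 x x' y z : phi (x + x') y z = phi x y z + phi x' y z.
Proof. by rewrite -[X in phi (X + _)]scale1r !phiE !d3_lin1; ring. Qed.

Lemma phi_Z1 a x y z : phi (a *: x) y z = a * phi x y z.
Proof.
rewrite !phiE -[a *: x]addr0 !d3_lin1.
have d0 i j k : d3 (0 : 'rV[R]_7) y z i j k = 0 by rewrite /d3 !coE; ring.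
by rewrite !d0; ring.
Qed.

Lemma phi_cycle x y z : phi y z x = phi x y z.
Proof. by rewrite !phiE !(d3_cycle x y z). Qed.

Lemma phi_swap12 x y z : phi y x z = - phi x y z.
Proof. by rewrite !phiE !(d3_swap12 x y); ring. Qed.

Lemma phi_D2 x y y' z : phi x (y + y') z = phi x y z + phi x y' z.
Proof. by rewrite -!(phi_cycle x) phi_D1. Qed.

Lemma phi_Z2 a x y z : phi x (a *: y) z = a * phi x y z.
Proof. by rewrite -!(phi_cycle x) phi_Z1. Qed.

Lemma phi_D3 x y z z' : phi x y (z + z') = phi x y z + phi x y z'.
Proof. by rewrite (phi_cycle (z + z') x y) phi_D1 -!(phi_cycle _ x y). Qed.

Lemma phi_Z3 a x y z : phi x y (a *: z) = a * phi x y z.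
Proof. by rewrite (phi_cycle (a *: z) x y) phi_Z1 -(phi_cycle _ x y). Qed.

Lemma phi_N3 x y z : phi x y (- z) = - phi x y z.
Proof. by rewrite -(scaleN1r z) phi_Z3 mulN1r. Qed.

Lemma phi_xxz x z : phi x x z = 0.
Proof. by have := phi_swap12 x x z; lra. Qed.

Lemma phi_xyy x y : phi x y y = 0.
Proof. by rewrite -(phi_cycle x) phi_xxz. Qed.

Lemma phi_xyx x y : phi x y x = 0.
Proof. by rewrite (phi_cycle x x y) phi_xxz. Qed.

Definition phiL := (phi_D1, phi_Z1, phi_D2, phi_Z2, phi_D3, phi_Z3,
  phi_N3, phi_xxz, phi_xyy, phi_xyx).

Lemma starphi_swap34 x y z w : starphi x y w z = - starphi x y z w.
Proof. by rewrite !starphiE /cross3_co /= /d3 /d2; ring. Qed.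

Lemma dot_cross3_skew x y z w : dot (cross3 x y z) w = - dot z (cross3 x y w).
Proof. by rewrite (dotC z) !cross3P starphi_swap34. Qed.

Lemma dot_cross3_1 x y z : dot (cross3 x y z) x = 0.
Proof. by rewrite dot_cross3_skew cross3_xyx dot0r oppr0. Qed.

Lemma dot_cross3_2 x y z : dot (cross3 x y z) y = 0.
Proof. by rewrite dot_cross3_skew cross3_xyy dot0r oppr0. Qed.

(** Selecting columns commutes with multiplication by [P] on the left, so every minor [dx I] picks
    up the factor [\det P]. *)
Lemma starphi_form_mul (P : 'M[R]_4) (V : 'M[R]_(4, 7)) :
  starphi_form (P *m V) = \det P * starphi_form V.
Proof.
have dxM (I : 4.-tuple nat) : dx I (P *m V) = \det P * dx I V.
  rewrite /dx -det_mulmx; congr (\det _); apply/matrixP => i j; rewrite !mxE.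
  by apply: eq_bigr => k _; rewrite !mxE.
by rewrite /starphi_form !dxM; ring.
Qed.

(** [P = V *m pinvmx V] satisfies [P *m V = V]; a nonzero value of the form then forces
    [\det P = 1], so [P], and with it [V], has rank 4. *)
Lemma starphi_form_row_free (V : 'M[R]_(4, 7)) : starphi_form V != 0 -> row_free V.
Proof.
move=> V0; have E : (V *m pinvmx V) *m V = V by rewrite mulmxKpV.
have := starphi_form_mul (V *m pinvmx V) V; rewrite E => /esym/eqP.
rewrite -subr_eq0 -[X in _ - X]mul1r -mulrBl mulf_eq0 (negPf V0) orbF subr_eq0 => /eqP d1.
have : (V *m pinvmx V) \in unitmx by rewrite unitmxE d1 unitr1.
rewrite -row_free_unit -!row_leq_rank => /leq_trans; apply.
exact: mulmx_max_rank || exact: mxrankM_maxl.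
Qed.

End Multilinear.

(** * The complex structure defined by an orthonormal pair *)

Section OrthonormalPair.
Variable R : realType.
Variables (e1 e2 : 'rV[R]_7).
Hypotheses (u1 : dot e1 e1 = 1) (u2 : dot e2 e2 = 1) (o12 : dot e1 e2 = 0).
Implicit Types (z w : 'rV[R]_7) (a b : R).

Lemma cross3_sqr z : cross3 e1 e2 (cross3 e1 e2 z) =
  - z + dot e1 z *: e1 + dot e2 z *: e2 + phi e1 e2 z *: cross2 e1 e2.
Proof.
rewrite cross3_cross3 u1 u2 o12 expr0n /= !mul1r !mul0r !subr0.
by rewrite scaleN1r.
Qed.

Lemma dot_cross3_cross3 z w : dot (cross3 e1 e2 z) (cross3 e1 e2 w) =
  dot z w - dot e1 z * dot e1 w - dot e2 z * dot e2 w - phi e1 e2 z * phi e1 e2 w.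
Proof.
rewrite dot_cross3_skew cross3_sqr !dotL (dotC z (cross2 _ _)) cross2P.
by rewrite !(dotC z); ring.
Qed.

(* The orthogonal complement of e1, e2 and e1 x e2, on which J = cross3 e1 e2
   is a complex structure. *)
Definition inW z := [/\ dot e1 z = 0, dot e2 z = 0 & phi e1 e2 z = 0].

Lemma inW_lin a z w : inW z -> inW w -> inW (a *: z + w).
Proof.
by move=> [h1 h2 h3] [k1 k2 k3]; split; rewrite ?dotL ?phiL ?h1 ?h2 ?h3 ?k1 ?k2 ?k3 mulr0 addr0.
Qed.

Lemma inW0 : inW 0.
Proof. by split; rewrite ?dot0r // -(scale0r 0) phi_Z3 mul0r. Qed.

Lemma inWD z w : inW z -> inW w -> inW (z + w).
Proof. by move=> hz hw; rewrite -[z]scale1r; exact: inW_lin. Qed.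

Lemma inWZ a z : inW z -> inW (a *: z).
Proof. by move=> hz; rewrite -[_ *: z]addr0; exact: inW_lin inW0. Qed.

Lemma inWN z : inW z -> inW (- z).
Proof. by rewrite -(scaleN1r z); exact: inWZ. Qed.

Lemma inWB z w : inW z -> inW w -> inW (z - w).
Proof. by move=> hz hw; apply: inWD => //; exact: inWN. Qed.

Lemma inWJ z : inW (cross3 e1 e2 z).
Proof. by split; rewrite ?phi_cross3 // dotC ?dot_cross3_1 ?dot_cross3_2. Qed.

Lemma cross3K z : inW z -> cross3 e1 e2 (cross3 e1 e2 z) = - z.
Proof. by move=> [h1 h2 h3]; rewrite cross3_sqr h1 h2 h3 !scale0r !addr0. Qed.

Definition bar z := z - dot e1 z *: e1 - dot e2 z *: e2.

Lemma barE z : z = bar z + dot e1 z *: e1 + dot e2 z *: e2.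
Proof. by rewrite /bar; apply/rowP => i; rewrite !mxE; ring. Qed.

Lemma bar_lin a z w : bar (a *: z + w) = a *: bar z + bar w.
Proof.
rewrite /bar !dotL !scalerDl !scalerBr !scalerA !opprD.
by apply/rowP => i; rewrite !mxE; ring.
Qed.

Lemma barD z w : bar (z + w) = bar z + bar w.
Proof. by rewrite -[z]scale1r bar_lin !scale1r. Qed.

Lemma barZ a z : bar (a *: z) = a *: bar z.
Proof. by rewrite /bar !dotL scalerBr scalerBr !scalerA. Qed.

Lemma bar_e1 : bar e1 = 0.
Proof. by rewrite /bar u1 dotC o12 scale1r scale0r subrr subr0. Qed.

Lemma bar_e2 : bar e2 = 0.
Proof. by rewrite /bar u2 o12 scale1r scale0r subr0 subrr. Qed.

Lemma dot_e1_bar z : dot e1 (bar z) = 0.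
Proof. by rewrite /bar !dotL u1 o12; ring. Qed.

Lemma dot_e2_bar z : dot e2 (bar z) = 0.
Proof. by rewrite /bar !dotL u2 (dotC e2 e1) o12; ring. Qed.

Lemma phi_bar z : phi e1 e2 (bar z) = phi e1 e2 z.
Proof. by rewrite /bar !phiL; ring. Qed.

Lemma cross3_bar z : cross3 e1 e2 (bar z) = cross3 e1 e2 z.
Proof. by rewrite /bar !cross3L !scaler0 !subr0. Qed.

Lemma inW_bar z : phi e1 e2 z = 0 -> inW (bar z).
Proof. by move=> h; split; rewrite ?dot_e1_bar ?dot_e2_bar ?phi_bar. Qed.

Lemma bar_W z : inW z -> bar z = z.
Proof. by move=> [h1 h2 _]; rewrite /bar h1 h2 !scale0r !subr0. Qed.

Lemma bar_J z : bar (cross3 e1 e2 z) = cross3 e1 e2 z.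
Proof. exact/bar_W/inWJ. Qed.

(* Equality case of Cauchy-Schwarz for e4 and the vector J e3, whose squared
   norm is 1 - phi(e1, e2, e3)^2. *)
Lemma calibrated_orthonormal e3 e4 : dot e1 e3 = 0 -> dot e2 e3 = 0 ->
  dot e3 e3 = 1 -> dot e4 e4 = 1 -> starphi e1 e2 e3 e4 ^+ 2 = 1 ->
  phi e1 e2 e3 = 0 /\ e4 = starphi e1 e2 e3 e4 *: cross3 e1 e2 e3.
Proof.
move=> o13 o23 u3 u4 s1; set s := starphi _ _ _ _ in s1 *.
have E : dot (e4 - s *: cross3 e1 e2 e3) (e4 - s *: cross3 e1 e2 e3) =
    - (phi e1 e2 e3 ^+ 2).
  rewrite !dotL dot_cross3_cross3 u4 u3 o13 o23 (dotC e4) cross3P -/s.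
  transitivity (1 - s ^+ 2 - s ^+ 2 + s ^+ 2 * (1 - phi e1 e2 e3 ^+ 2)); first by ring.
  by rewrite s1; ring.
have := dot_ge0 (e4 - s *: cross3 e1 e2 e3); have p0 := sqr_ge0 (phi e1 e2 e3).
rewrite E oppr_ge0 => p0'.
have /eqP : phi e1 e2 e3 ^+ 2 = 0 by apply/eqP; rewrite eq_le p0 p0'.
rewrite sqrf_eq0 => /eqP ph0; split => //.
by apply/eqP; rewrite -subr_eq0 -dot_eq0 E ph0 expr0n oppr0.
Qed.

End OrthonormalPair.

(* Compares the coefficients of h in an identity of degree 1 in h, from its
   values at h = 1 and h = -1. *)
Lemma affine_coefficients (R : realType) k (m m' n n' : 'rV[R]_k) (V a1 a2 b1 b2 c1 c2 : R) :
  (V + 1 * a1) *: (1 *: m) + (1 * a2) *: (1 *: m') =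
    (c1 + 1 * b1) *: (1 *: n) + (c2 + 1 * b2) *: (1 *: n') ->
  (V + -1 * a1) *: (-1 *: m) + (-1 * a2) *: (-1 *: m') =
    (c1 + -1 * b1) *: (-1 *: n) + (c2 + -1 * b2) *: (-1 *: n') ->
  V *: m = c1 *: n + c2 *: n' /\ a1 *: m + a2 *: m' = b1 *: n + b2 *: n'.
Proof.
move=> k1 k2; split; apply/rowP => i; have := congr1 (fun z : 'rV[R]_k => z 0 i) k1;
  have := congr1 (fun z : 'rV[R]_k => z 0 i) k2; rewrite !mxE;
  move: (m 0 i) (n 0 i) (m' 0 i) (n' 0 i) => *; lra.
Qed.

(** * Complex lines and pencils of complex lines *)

Section ComplexLine.
Variable R : realType.
Variables (e1 e2 : 'rV[R]_7).
Hypotheses (u1 : dot e1 e1 = 1) (u2 : dot e2 e2 = 1) (o12 : dot e1 e2 = 0).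
Implicit Types (z w n m A B : 'rV[R]_7) (a b c d : R).

(* Multiplication by a + i b for the complex structure J. *)
Definition cx a b z := a *: z + b *: cross3 e1 e2 z.

Lemma cxD a b z w : cx a b (z + w) = cx a b z + cx a b w.
Proof. by rewrite /cx cross3_D3 !scalerDr addrACA. Qed.

Lemma cxZ a b c z : cx a b (c *: z) = c *: cx a b z.
Proof. by rewrite /cx cross3_Z3 scalerDr !scalerA !(mulrC c). Qed.

Lemma cxDl a b c d z : cx (a + c) (b + d) z = cx a b z + cx c d z.
Proof. by rewrite /cx !scalerDl addrACA. Qed.

Lemma cx1 z : cx 1 0 z = z.
Proof. by rewrite /cx scale1r scale0r addr0. Qed.

Lemma cx00 z : cx 0 0 z = 0.
Proof. by rewrite /cx !scale0r addr0. Qed.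

Lemma cx0r a b : cx a b 0 = 0.
Proof. by have := cxZ a b 0 0; rewrite !scale0r. Qed.

Lemma inW_cx a b z : inW e1 e2 z -> inW e1 e2 (cx a b z).
Proof. by move=> hz; apply: inW_lin hz _; apply: inWZ; exact: inWJ. Qed.

Lemma cxM a b c d z : inW e1 e2 z -> cx a b (cx c d z) = cx (a * c - b * d) (a * d + b * c) z.
Proof.
move=> hz; rewrite /cx !cross3L (cross3K u1 u2 o12 hz) !scalerDr scalerN !scalerA.
by rewrite !scalerDl !scaleNr; apply/rowP => i; rewrite !mxE; ring.
Qed.

(** Multiplication by the conjugate [a - i b] gives [(a ^+ 2 + b ^+ 2) *: z = 0]. *)
Lemma cx_eq0 a b z : inW e1 e2 z -> cx a b z = 0 -> z != 0 -> a = 0 /\ b = 0.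
Proof.
move=> hz h z0.
have : cx (a * a - - b * b) (a * b + - b * a) z = 0.
  by rewrite -(cxM _ _ _ _ hz) h cx0r.
rewrite /cx (_ : a * b + - b * a = 0); last by ring.
rewrite scale0r addr0 => /eqP; rewrite scaler_eq0 (negPf z0) orbF.
rewrite mulNr opprK -!expr2 => /eqP ab.
have ha := sqr_ge0 a; have hb := sqr_ge0 b.
by split; apply/eqP; rewrite -sqrf_eq0 eq_le; apply/andP; split => //; lra.
Qed.

Lemma dot_J_J z w : inW e1 e2 z -> dot (cross3 e1 e2 z) (cross3 e1 e2 w) = dot z w.
Proof.
move=> [h1 h2 h3]; rewrite (dot_cross3_cross3 u1 u2 o12) h1 h2 h3 !mul0r.
by rewrite !subr0.
Qed.

Lemma dot_J_self z : dot (cross3 e1 e2 z) z = 0.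
Proof.
by have := dot_cross3_skew e1 e2 z z; rewrite (dotC z); lra.
Qed.

(** The hypothesis is membership of [B] in the span of [A] and [J A], cleared of the denominator
    [dot A A]. In that form it is polynomial in [A] and [B], hence stable under limits; only here is
    it divided out. *)
Lemma calibrated_complex_line A B : inW e1 e2 A -> inW e1 e2 B -> A != 0 ->
  dot A A *: B = dot A B *: A + dot (cross3 e1 e2 A) B *: cross3 e1 e2 A ->
  B = cx (dot A B / dot A A) (dot (cross3 e1 e2 A) B / dot A A) A.
Proof.
move=> hA hB A0 h; have d0 : dot A A != 0 by rewrite dot_eq0.
rewrite /cx ![_ / dot A A]mulrC -!scalerA -scalerDr -h scalerA mulVf //.
by rewrite scale1r.
Qed.

Section Line.
Variable v : 'rV[R]_7.
Hypotheses (hv : inW e1 e2 v) (v0 : v != 0).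

(* The projection off span(e1, e2, v, J v). *)
Definition normal z := bar e1 e2 z - (dot v v)^-1 *:
  (dot v z *: v + dot (cross3 e1 e2 v) z *: cross3 e1 e2 v).

Let dvv : dot v v != 0. Proof. by rewrite dot_eq0. Qed.
Let v1 : dot e1 v = 0. Proof. by case: hv. Qed.
Let v2 : dot e2 v = 0. Proof. by case: hv. Qed.
Let w1 : dot e1 (cross3 e1 e2 v) = 0. Proof. by rewrite dotC dot_cross3_1. Qed.
Let w2 : dot e2 (cross3 e1 e2 v) = 0. Proof. by rewrite dotC dot_cross3_2. Qed.
Let vw : dot v (cross3 e1 e2 v) = 0. Proof. by rewrite dotC dot_J_self. Qed.

Lemma normal_lin a z w : normal (a *: z + w) = a *: normal z + normal w.
Proof.
rewrite /normal bar_lin !dotL; apply/rowP => i; rewrite !mxE.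
by ring.
Qed.

Lemma normalD z w : normal (z + w) = normal z + normal w.
Proof. by rewrite -[z]scale1r normal_lin !scale1r. Qed.

Lemma normal0 : normal 0 = 0.
Proof. by have := normal_lin (-1) 0 0; rewrite scaler0 addr0 scaleN1r addNr. Qed.

Lemma normalZ a z : normal (a *: z) = a *: normal z.
Proof. by rewrite -[a *: z]addr0 normal_lin normal0 addr0. Qed.

Lemma normal_e1 : normal e1 = 0.
Proof.
rewrite /normal (bar_e1 u1 o12) (dotC v) v1 (dotC _ e1) w1.
by rewrite !scale0r addr0 scaler0 subr0.
Qed.

Lemma normal_e2 : normal e2 = 0.
Proof.
rewrite /normal (bar_e2 u2 o12) (dotC v) v2 (dotC _ e2) w2.
by rewrite !scale0r addr0 scaler0 subr0.
Qed.

Lemma normal_v : normal v = 0.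
Proof.
rewrite /normal (bar_W hv) dot_J_self scale0r addr0 scalerA mulVf // scale1r.
by rewrite subrr.
Qed.

Lemma normal_Jv : normal (cross3 e1 e2 v) = 0.
Proof.
rewrite /normal (bar_J e1 e2 v) vw (dot_J_J _ hv) scale0r add0r scalerA mulVf // scale1r.
by rewrite subrr.
Qed.

Lemma normal_bar z : normal (bar e1 e2 z) = normal z.
Proof.
rewrite [in RHS](barE e1 e2 z) !normalD !normalZ normal_e1 normal_e2 !scaler0.
by rewrite !addr0.
Qed.

Lemma dot_e1_normal z : dot e1 (normal z) = 0.
Proof. by rewrite /normal /bar !dotL u1 o12 v1 w1; ring. Qed.

Lemma dot_e2_normal z : dot e2 (normal z) = 0.
Proof. by rewrite /normal /bar !dotL u2 (dotC e2 e1) o12 v2 w2; ring. Qed.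

Lemma dot_v_bar z : dot v (bar e1 e2 z) = dot v z.
Proof. by rewrite /bar !dotL (dotC v e1) v1 (dotC v e2) v2; ring. Qed.

Lemma dot_Jv_bar z : dot (cross3 e1 e2 v) (bar e1 e2 z) = dot (cross3 e1 e2 v) z.
Proof. by rewrite /bar !dotL (dotC _ e1) w1 (dotC _ e2) w2; ring. Qed.

Lemma normalC z w : dot (normal z) w = dot z (normal w).
Proof.
rewrite /normal /bar !dotL (dotC z e1) (dotC z e2) (dotC z v) (dotC z (cross3 _ _ _)).
by ring.
Qed.

Lemma phi_normal z : phi e1 e2 (normal z) = phi e1 e2 z.
Proof.
have [_ _ pv] := hv.
by rewrite /normal /bar !phiL pv phi_cross3; ring.
Qed.

Lemma inW_normal z : phi e1 e2 z = 0 -> inW e1 e2 (normal z).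
Proof. by move=> h; split; rewrite ?dot_e1_normal ?dot_e2_normal ?phi_normal. Qed.

Lemma normal_J z : normal (cross3 e1 e2 z) = cross3 e1 e2 (normal z).
Proof.
have -> : cross3 e1 e2 (normal z) = cross3 e1 e2 z - (dot v v)^-1 *:
    (dot v z *: cross3 e1 e2 v - dot (cross3 e1 e2 v) z *: v).
  by rewrite /normal cross3_D3 cross3_bar cross3_N3 cross3_Z3 cross3_D3 !cross3_Z3
      (cross3K u1 u2 o12 hv) scalerN.
rewrite /normal (bar_J e1 e2) (dot_J_J _ hv).
have -> : dot v (cross3 e1 e2 z) = - dot (cross3 e1 e2 v) z.
  by rewrite dot_cross3_skew opprK.
by rewrite scaleNr [- _ + _]addrC.
Qed.

Lemma normal_cx a b z : normal (cx a b z) = cx a b (normal z).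
Proof. by rewrite /cx normal_lin normalZ normal_J. Qed.

Lemma normal_eq0 z : normal z = 0 ->
  bar e1 e2 z = cx (dot v z / dot v v) (dot (cross3 e1 e2 v) z / dot v v) v.
Proof.
move=> /eqP; rewrite /normal subr_eq0 => /eqP ->.
by rewrite /cx scalerDr !scalerA ![_^-1 * _]mulrC.
Qed.

Lemma span_normal_eq0 z : normal z = 0 -> z = dot e1 z *: e1 + dot e2 z *: e2
  + (dot v z / dot v v) *: v + (dot (cross3 e1 e2 v) z / dot v v) *: cross3 e1 e2 v.
Proof.
move=> h; rewrite {1}(barE e1 e2 z) (normal_eq0 h) /cx.
by apply/rowP => i; rewrite !mxE; ring.
Qed.

(** If [B] is a complex multiple of [A], then the components along [v] and the normal parts have
    that same ratio; cross-multiplication eliminates the ratio and removes the need for [A != 0]. *)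
Lemma normal_proportional A B : inW e1 e2 A -> inW e1 e2 B ->
  dot A A *: B = dot A B *: A + dot (cross3 e1 e2 A) B *: cross3 e1 e2 A ->
  cx (dot v A) (dot (cross3 e1 e2 v) A) (normal B) =
  cx (dot v B) (dot (cross3 e1 e2 v) B) (normal A).
Proof.
move=> hA hB h; have [->|A0] := eqVneq A 0.
  by rewrite !dotL normal0 cx0r cx00.
have hl := calibrated_complex_line hA hB A0 h.
set p := _ / _ in hl; set q := _ / _ in hl.
have nA : inW e1 e2 (normal A) by apply: inW_normal; case: hA.
rewrite {1}hl normal_cx (cxM _ _ _ _ nA).
have -> : dot v B = p * dot v A - q * dot (cross3 e1 e2 v) A.
  by rewrite {1}hl /cx !dotL (dotC v (cross3 _ _ _)) dot_cross3_skew (dotC A); ring.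
have -> : dot (cross3 e1 e2 v) B = p * dot (cross3 e1 e2 v) A + q * dot v A.
  by rewrite {1}hl /cx !dotL (dot_J_J _ hv).
by congr cx; ring.
Qed.

(** [normal_proportional] along the pencil is [h] times an identity of degree 1 in [h]. Its constant
    term gives the ratio of the normal parts of [a] and [b]. Its linear term compares their
    components along [v], once a nonzero [normal a] is cancelled. *)
Lemma direction_dichotomy (m1 m2 : R) (a b : 'rV[R]_7) : inW e1 e2 a -> inW e1 e2 b ->
  (forall h : R, let A := v + h *: a in let B := cx m1 m2 v + h *: b in
    dot A A *: B = dot A B *: A + dot (cross3 e1 e2 A) B *: cross3 e1 e2 A) ->
  normal b = cx m1 m2 (normal a) /\ (normal a = 0 \/ b = cx m1 m2 a).
Proof.
move=> ha hb hI.
have key h : cx (dot v v + h * dot v a) (h * dot (cross3 e1 e2 v) a) (h *: normal b) =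
    cx (m1 * dot v v + h * dot v b) (m2 * dot v v + h * dot (cross3 e1 e2 v) b) (h *: normal a).
  have := normal_proportional _ _ (hI h).
  rewrite !normalD !normalZ normal_v normal_Jv !scaler0 !add0r !dotL.
  rewrite (dot_J_J _ hv) dot_J_self vw ?mulr0 ?add0r ?addr0; apply.
    by apply: inWD hv (inWZ _ ha).
  by apply: inWD (inW_cx _ _ hv) (inWZ _ hb).
have k1 := key 1; have k2 := key (-1); rewrite /cx !cross3_Z3 in k1 k2.
set n := normal a in k1 k2 *; set m := normal b in k1 k2 *.
have hn : inW e1 e2 n by apply: inW_normal; case: ha.
have [E1' E2] := affine_coefficients k1 k2.
have E1 : m = cx m1 m2 n.
  by apply: (scalerI dvv); rewrite E1' /cx (scalerDr _ (m1 *: n)) !(scalerA (dot v v)) !(mulrC (dot v v)).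
have E3 : cx (dot v a) (dot (cross3 e1 e2 v) a) m = cx (dot v b) (dot (cross3 e1 e2 v) b) n.
  exact: E2.
split; first exact: E1.
have [n0|n0] := eqVneq n 0; [left; exact: n0|right].
rewrite E1 (cxM _ _ _ _ hn) in E3.
set a1 := dot v a in E3; set a2 := dot (cross3 e1 e2 v) a in E3.
set b1 := dot v b in E3; set b2 := dot (cross3 e1 e2 v) b in E3.
have [c1 c2] : a1 * m1 - a2 * m2 - b1 = 0 /\ a1 * m2 + a2 * m1 - b2 = 0.
  apply: (cx_eq0 hn _ n0); rewrite cxDl E3 /cx !scaleNr -opprD.
  exact: subrr.
have decomp z : inW e1 e2 z -> z = normal z + (dot v v)^-1 *: cx (dot v z) (dot (cross3 e1 e2 v) z) v.
  by move=> hz; rewrite /normal (bar_W hz) subrK.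
rewrite (decomp b hb) -/m E1 [in RHS](decomp a ha) -/n cxD cxZ (cxM _ _ _ _ hv) -/a1 -/a2 -/b1 -/b2.
by congr (_ + _ *: cx _ _ _); lra.
Qed.

End Line.

(** The two directions separately leave a mixed case, in which only one of [a], [a'] has zero normal
    part. The third direction [a + a'] then has nonzero normal part, so its pair has the ratio
    [m1 + i m2], and subtraction gives it to the remaining pair. *)
Lemma pencil_dichotomy (m1 m2 : R) (v a a' b b' : 'rV[R]_7) : inW e1 e2 v -> v != 0 ->
  inW e1 e2 a -> inW e1 e2 a' -> inW e1 e2 b -> inW e1 e2 b' ->
  (forall h h' : R, let A := v + (h *: a + h' *: a') in
    let B := cx m1 m2 v + (h *: b + h' *: b') in
    dot A A *: B = dot A B *: A + dot (cross3 e1 e2 A) B *: cross3 e1 e2 A) ->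
  (b = cx m1 m2 a /\ b' = cx m1 m2 a') \/
  [/\ normal v a = 0, normal v a' = 0, normal v b = 0 & normal v b' = 0].
Proof.
move=> hv v0 ha ha' hb hb' hI.
have D1 : normal v b = cx m1 m2 (normal v a) /\ (normal v a = 0 \/ b = cx m1 m2 a).
  apply: direction_dichotomy => // h; have := hI h 0.
  by rewrite /= !scale0r !addr0.
have D2 : normal v b' = cx m1 m2 (normal v a') /\ (normal v a' = 0 \/ b' = cx m1 m2 a').
  apply: direction_dichotomy => // h; have := hI 0 h.
  by rewrite /= !scale0r !add0r.
have D3 : normal v (a + a') = 0 \/ b + b' = cx m1 m2 (a + a').
  apply: (direction_dichotomy hv v0 (inWD ha ha') (inWD hb hb') _).2 => h.
  by have := hI h h; rewrite /= !scalerDr.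
have [nb hA] := D1; have [nb' hA'] := D2.
have [na|na] := eqVneq (normal v a) 0; have [na'|na'] := eqVneq (normal v a') 0.
- by right; split => //; rewrite ?nb ?nb' ?na ?na' cx0r.
- left; case: hA' => [/eqP|hA']; first by rewrite (negPf na').
  case: D3 => [/eqP|]; first by rewrite normalD na add0r (negPf na').
  by rewrite cxD hA' => /addIr.
- left; case: hA => [/eqP|hA]; first by rewrite (negPf na).
  case: D3 => [/eqP|]; first by rewrite normalD na' addr0 (negPf na).
  by rewrite cxD hA => /addrI.
- left; case: hA => [/eqP|hA]; first by rewrite (negPf na).
  by case: hA' => [/eqP|hA' //]; rewrite (negPf na').
Qed.

End ComplexLine.

(** * Frames of 4-planes and the calibration condition *)

Section Frames.
Variable R : realType.
Implicit Types (a b c d x y z w : 'rV[R]_7).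

Definition rows4 a b c d : 'M[R]_(4, 7) := \matrix_(k < 4) tnth [tuple a; b; c; d] k.

Lemma forall_I4 (P : 'I_4 -> Prop) :
  P (inord 0) -> P (inord 1) -> P (inord 2) -> P (inord 3) -> forall i, P i.
Proof.
by move=> P0 P1 P2 P3 [[|[|[|[|//]]]] i];
  [move: P0|move: P1|move: P2|move: P3]; congr P; apply/val_inj; rewrite /= inordK.
Qed.

Lemma row_rows4 a b c d (k : 'I_4) : row k (rows4 a b c d) = nth 0 [:: a; b; c; d] k.
Proof. by rewrite rowK (tnth_nth 0). Qed.

Lemma rows4_sub a b c d m (M : 'M[R]_(m, 7)) :
  (rows4 a b c d <= M)%MS = [&& (a <= M)%MS, (b <= M)%MS, (c <= M)%MS & (d <= M)%MS].
Proof.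
apply/row_subP/and4P => [h|[ha hb hc hd]].
  by have := (h (inord 0), h (inord 1), h (inord 2), h (inord 3));
    rewrite !row_rows4 !inordK //= => -[[[]]].
by apply: forall_I4; rewrite row_rows4 inordK.
Qed.

Lemma sub_rows4 a b c d : [/\ (a <= rows4 a b c d)%MS, (b <= rows4 a b c d)%MS,
  (c <= rows4 a b c d)%MS & (d <= rows4 a b c d)%MS].
Proof. by have := submx_refl (rows4 a b c d); rewrite {1}rows4_sub => /and4P. Qed.

Lemma rows4_comb_sub a b c d (k1 k2 k3 k4 : R) :
  ((k1 *: a + k2 *: b + k3 *: c + k4 *: d)%R <= rows4 a b c d)%MS.
Proof. by have [? ? ? ?] := sub_rows4 a b c d; do ![apply: addmx_sub]; apply: scalemx_sub. Qed.

Lemma rows4_free a b c d (k1 k2 k3 k4 : R) : row_free (rows4 a b c d) ->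
  k1 *: a + k2 *: b + k3 *: c + k4 *: d = 0 -> [/\ k1 = 0, k2 = 0, k3 = 0 & k4 = 0].
Proof.
move=> fr h; pose v : 'rV[R]_4 := \row_j nth 0 [:: k1; k2; k3; k4] j.
have vM : v *m rows4 a b c d = 0.
  rewrite mulmx_sum_row !big_ord_recr big_ord0 /= add0r !row_rows4 /= !mxE /=.
  exact: h.
have v0 : v = 0 by apply: (row_free_inj fr); rewrite vM mul0mx.
have vk k : (k < 4)%N -> nth 0 [:: k1; k2; k3; k4] k = 0.
  by move=> k4'; have := congr1 (fun z : 'rV[R]_4 => z 0 (inord k)) v0; rewrite !mxE inordK.
by split; [exact: (vk 0%N)|exact: (vk 1%N)|exact: (vk 2%N)|exact: (vk 3%N)].
Qed.

Lemma gram_rows4 a b c d (i j : 'I_4) : (rows4 a b c d *m (rows4 a b c d)^T) i j =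
  dot (nth 0 [:: a; b; c; d] i) (nth 0 [:: a; b; c; d] j).
Proof.
rewrite !mxE; apply: eq_bigr => k _; rewrite !mxE !(tnth_nth 0) //.
Qed.

Lemma orthonormal_rows4 a b c d :
  dot a a = 1 -> dot b b = 1 -> dot c c = 1 -> dot d d = 1 ->
  dot a b = 0 -> dot a c = 0 -> dot a d = 0 -> dot b c = 0 -> dot b d = 0 ->
  dot c d = 0 -> rows4 a b c d *m (rows4 a b c d)^T = 1%:M.
Proof.
move=> aa bb cc dd ab ac ad bc bd cd; apply/matrixP => i j.
rewrite gram_rows4 mxE -val_eqE; move: i j.
by apply: forall_I4; apply: forall_I4; rewrite /= !inordK //= ?aa ?bb ?cc ?dd
  ?(dotC b a) ?(dotC c a) ?(dotC d a) ?(dotC c b) ?(dotC d b) ?(dotC d c)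
  ?ab ?ac ?ad ?bc ?bd ?cd.
Qed.

Lemma starphi_form_rows4 a b c d : starphi_form (rows4 a b c d) = starphi a b c d.
Proof. by []. Qed.

Section Pair.
Variables (e1 e2 : 'rV[R]_7).
Hypotheses (u1 : dot e1 e1 = 1) (u2 : dot e2 e2 = 1) (o12 : dot e1 e2 = 0).

Lemma rows4_bar_neq0 A B : row_free (rows4 e1 e2 A B) -> bar e1 e2 A != 0.
Proof.
move=> fr; apply/eqP => A0.
have := @rows4_free e1 e2 A B (- dot e1 A) (- dot e2 A) 1 0 fr.
rewrite scale1r scale0r addr0 !scaleNr {3}(barE e1 e2 A) A0 add0r.
rewrite addrACA !addNr addr0 => /(_ erefl)[_ _ /eqP].
by rewrite oner_eq0.
Qed.

(* Gram-Schmidt applied to e1, e2, A, B. *)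
Lemma calibrated_frame A B : row_free (rows4 e1 e2 A B) ->
  (forall E : 'M[R]_(4, 7), (E == rows4 e1 e2 A B)%MS -> E *m E^T = 1%:M ->
    starphi_form E ^+ 2 = 1) ->
  let A' := bar e1 e2 A in let B' := bar e1 e2 B in
  [/\ phi e1 e2 A = 0, phi e1 e2 B = 0, starphi e1 e2 A B != 0 &
    dot A' A' *: B' = dot A' B' *: A' + dot (cross3 e1 e2 A') B' *: cross3 e1 e2 A'].
Proof.
move=> fr cal /=; set A' := bar e1 e2 A; set B' := bar e1 e2 B.
have A'0 : A' != 0 by exact: rows4_bar_neq0 fr.
have dA : 0 < dot A' A' by rewrite dot_gt0.
pose p := dot A' B' / dot A' A'; pose C := B' - p *: A'.
have AE : A = A' + dot e1 A *: e1 + dot e2 A *: e2 by exact: barE.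
have BE : B = B' + dot e1 B *: e1 + dot e2 B *: e2 by exact: barE.
have A'E : A' = A - dot e1 A *: e1 - dot e2 A *: e2 by [].
have B'E : B' = B - dot e1 B *: e1 - dot e2 B *: e2 by [].
have C0 : C != 0.
  apply/eqP => C0.
  have := @rows4_free e1 e2 A B (- dot e1 B + p * dot e1 A) (- dot e2 B + p * dot e2 A) (- p) 1 fr.
  case=> [|_ _ _ /eqP]; last by rewrite oner_eq0.
  by rewrite -C0 /C A'E B'E; apply/rowP => i; rewrite !mxE; ring.
have dC : 0 < dot C C by rewrite dot_gt0.
pose a := Num.sqrt (dot A' A'); pose c := Num.sqrt (dot C C).
have a0 : 0 < a by rewrite sqrtr_gt0.
have c0 : 0 < c by rewrite sqrtr_gt0.
have a2 : a ^+ 2 = dot A' A' by rewrite sqr_sqrtr // ltW.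
have c2 : c ^+ 2 = dot C C by rewrite sqr_sqrtr // ltW.
have anz : a != 0 by rewrite gt_eqF.
have cnz : c != 0 by rewrite gt_eqF.
pose e3 := a^-1 *: A'; pose e4 := c^-1 *: C.
have A'e1 : dot e1 A' = 0 by exact: dot_e1_bar.
have A'e2 : dot e2 A' = 0 by exact: dot_e2_bar.
have B'e1 : dot e1 B' = 0 by exact: dot_e1_bar.
have B'e2 : dot e2 B' = 0 by exact: dot_e2_bar.
have AC : dot A' C = 0.
  rewrite /C dotDr dotNr dotZr /p divfK ?subrr //.
  by rewrite gt_eqF.
have Ce1 : dot e1 C = 0 by rewrite /C dotDr dotNr dotZr A'e1 B'e1; ring.
have Ce2 : dot e2 C = 0 by rewrite /C dotDr dotNr dotZr A'e2 B'e2; ring.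
have o13 : dot e1 e3 = 0 by rewrite dotZr A'e1 mulr0.
have o23 : dot e2 e3 = 0 by rewrite dotZr A'e2 mulr0.
have u3 : dot e3 e3 = 1 by rewrite dotZl dotZr -a2; field.
have u4 : dot e4 e4 = 1 by rewrite dotZl dotZr -c2; field.
have o34 : dot e3 e4 = 0 by rewrite dotZl dotZr AC !mulr0.
have o14 : dot e1 e4 = 0 by rewrite dotZr Ce1 mulr0.
have o24 : dot e2 e4 = 0 by rewrite dotZr Ce2 mulr0.
have [s1 s2 sA sB] := sub_rows4 e1 e2 A B.
have sA' : (A' <= rows4 e1 e2 A B)%MS.
  by rewrite A'E; do ![apply: addmx_sub]; rewrite ?eqmx_opp //; apply: scalemx_sub.
have sB' : (B' <= rows4 e1 e2 A B)%MS.
  by rewrite B'E; do ![apply: addmx_sub]; rewrite ?eqmx_opp //; apply: scalemx_sub.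
have [t1 t2 t3 t4] := sub_rows4 e1 e2 e3 e4.
have A'3 : A' = a *: e3 by rewrite scalerA divff // scale1r.
have C4 : C = c *: e4 by rewrite scalerA divff // scale1r.
have B'34 : B' = c *: e4 + (p * a) *: e3 by rewrite -C4 -scalerA -A'3 /C subrK.
have EM : (rows4 e1 e2 e3 e4 == rows4 e1 e2 A B)%MS.
  apply/andP; split; rewrite rows4_sub.
    rewrite s1 s2 /e3 /e4 /C !scalemx_sub //=; apply: addmx_sub => //.
    by rewrite eqmx_opp scalemx_sub.
  rewrite t1 t2 AE BE A'3 B'34 /=.
  by apply/andP; split; do ![apply: addmx_sub]; apply: scalemx_sub.
have sph := cal _ EM (orthonormal_rows4 u1 u2 u3 u4 o12 o13 o14 o23 o24 o34).
have [p3 e4E] := calibrated_orthonormal u1 u2 o12 o13 o23 u3 u4 sph.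
set s := starphi e1 e2 e3 e4 in e4E.
have {}sph : s ^+ 2 = 1 by [].
have p4 : phi e1 e2 e4 = 0 by rewrite e4E phi_Z3 phi_cross3 mulr0.
have pA' : phi e1 e2 A' = 0 by rewrite A'3 (phi_Z3 a e1 e2 e3) p3 mulr0.
have pB' : phi e1 e2 B' = 0 by rewrite B'34 phi_D3 (phi_Z3 c e1 e2 e4) (phi_Z3 _ e1 e2 e3) p3 p4; ring.
have JA : cross3 e1 e2 A' = a *: cross3 e1 e2 e3 by rewrite {1}A'3 (cross3_Z3 a e1 e2 e3).
have JB : dot (cross3 e1 e2 e3) e4 = s by rewrite cross3P.
have J3 : dot (cross3 e1 e2 e3) e3 = 0 by exact: dot_J_self.
have Je3 : cross3 e1 e2 e3 = s *: e4.
  by rewrite e4E scalerA -expr2 sph scale1r.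
split.
- by rewrite -(phi_bar e1 e2 A).
- by rewrite -(phi_bar e1 e2 B).
- rewrite -cross3P -cross3_bar -/A' BE (dotDr _ (B' + _)) (dotDr _ B') (dotZr _ _ e1).
  rewrite (dotZr _ _ e2) dot_cross3_1 dot_cross3_2 !mulr0 !addr0 JA dotZl B'34.
  rewrite (dotDr _ (c *: e4)) (dotZr c) (dotZr _ _ e3) JB J3.
  rewrite mulr0 addr0 !mulf_neq0 //.
  by apply/eqP => s0; move: sph; rewrite s0 expr0n => /eqP; rewrite eq_sym oner_eq0.
- have -> : dot A' B' = p * dot A' A' by rewrite /p divfK // gt_eqF.
  rewrite JA -a2 (dotZl a) {2}B'34 (dotDr _ (c *: e4)) (dotZr c) (dotZr _ _ e3).
  rewrite JB J3 mulr0 addr0 Je3 {1}B'34 A'3.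
  rewrite scalerDr !scalerA.
  have -> : a * (c * s) * a * s = a ^+ 2 * c * (s ^+ 2) by ring.
  by rewrite sph mulr1 addrC; congr (_ *: _ + _ *: _); ring.
Qed.

(** Write [E = Q *m F] with [F] the orthogonal frame [e1, e2, A', J A']. Its Gram determinant is
    [k ^+ 2] and the form takes the value [k] on it, where [k = dot A' A'], so the square of the
    form on [E] equals [\det (E *m E^T) = 1]. *)
Lemma calibrated_plane_form A B (E : 'M[R]_(4, 7)) : phi e1 e2 A = 0 ->
  bar e1 e2 B = cross3 e1 e2 A -> row_free (rows4 e1 e2 A B) ->
  (E == rows4 e1 e2 A B)%MS -> E *m E^T = 1%:M -> starphi_form E ^+ 2 = 1.
Proof.
move=> pA BJ fr /andP[EM _] EE.
pose A' := bar e1 e2 A; have A'0 : A' != 0 by exact: rows4_bar_neq0 fr.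
have hA : inW e1 e2 A' by exact: inW_bar.
pose F := rows4 e1 e2 A' (cross3 e1 e2 A').
have [f1 f2 f3 f4] := sub_rows4 e1 e2 A' (cross3 e1 e2 A').
have MF : (rows4 e1 e2 A B <= F)%MS.
  rewrite rows4_sub f1 f2 /=; apply/andP; split.
    rewrite (barE e1 e2 A).
    exact: addmx_sub (addmx_sub f3 (scalemx_sub _ f1)) (scalemx_sub _ f2).
  rewrite (barE e1 e2 B) BJ -(cross3_bar e1 e2 A).
  exact: addmx_sub (addmx_sub f4 (scalemx_sub _ f1)) (scalemx_sub _ f2).
have /submxP[Q QE] := submx_trans EM MF.
have [h1 h2 _] := hA.
set k := dot A' A'.
have FF : F *m F^T = diag_mx (\row_j nth 0 [:: 1; 1; k; k] j).
  apply/matrixP => i j; rewrite gram_rows4 !mxE -val_eqE; move: i j.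
  have c1 := dot_cross3_1 e1 e2 A'; have c2 := dot_cross3_2 e1 e2 A'.
  have c3 := dot_J_self e1 e2 A'.
  have c4 : dot (cross3 e1 e2 A') (cross3 e1 e2 A') = k by rewrite dot_J_J.
  by apply: forall_I4; apply: forall_I4; rewrite /= !inordK //= ?mulr1n ?mulr0n ?u1 ?u2
    ?(dotC e2 e1) ?o12 ?(dotC A' e1) ?(dotC A' e2) ?h1 ?h2 ?(dotC e1 (cross3 _ _ _))
    ?(dotC e2 (cross3 _ _ _)) ?(dotC A' (cross3 _ _ _)) ?c1 ?c2 ?c3 ?c4.
have detF : \det (F *m F^T) = k ^+ 2.
  by rewrite FF det_diag !big_ord_recr big_ord0 /= !mxE /= !mul1r.
have sF : starphi_form F = k.
  by rewrite starphi_form_rows4 -cross3P dot_J_J.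
rewrite QE starphi_form_mul sF exprMn -detF.
have := congr1 determinant EE; rewrite QE trmx_mul det1 => <-.
by rewrite !mulmxA -(mulmxA Q F F^T) det_mulmx (det_mulmx Q) det_tr; ring.
Qed.

End Pair.
End Frames.

(** * Degenerate pencils *)

Section VectorCalculus.
Variable R : realType.
Implicit Types (u v a : 'rV[R]_2) (f g : 'rV[R]_2 -> R).

Definition vanalytic n (F : 'rV[R]_2 -> 'rV[R]_n) a : Prop :=
  forall i, analytic_at (fun u => F u 0 i) a.

Lemma is_derive_rowP n (F : 'rV[R]_2 -> 'rV[R]_n) u v (dF : 'rV[R]_n) :
  is_derive u v F dF <-> forall i, is_derive u v (fun x => F x 0 i) (dF 0 i).
Proof.
split=> [[dF' <-] i|h].
  have /derivable_mxP dm := dF'.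
  by rewrite (derive_mx dF') mxE; exact: derivableP.
have dF' : derivable F u v by apply/derivable_mxP => i j; rewrite ord1; case: (h j).
split => //; rewrite (derive_mx dF'); apply/rowP => i; rewrite mxE.
by case: (h i).
Qed.

Lemma is_derive_add f g u v (df dg : R) : is_derive u v f df -> is_derive u v g dg ->
  is_derive u v (fun x => f x + g x) (df + dg).
Proof. by move=> hf hg; exact: (is_deriveD hf hg). Qed.

Lemma is_derive_mul f g u v (df dg : R) : is_derive u v f df -> is_derive u v g dg ->
  is_derive u v (fun x => f x * g x) (df * g u + f u * dg).
Proof.
move=> hf hg; apply: is_derive_eq (is_deriveM hf hg) _.
by rewrite /GRing.scale /=; ring.
Qed.

Lemma is_derive_opp f u v (df : R) : is_derive u v f df ->
  is_derive u v (fun x => - f x) (- df).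
Proof. by move=> hf; exact: (is_deriveN hf). Qed.

Lemma is_derive_inv f u v (df : R) : f u != 0 -> is_derive u v f df ->
  is_derive u v (fun x => (f x)^-1) (- (f u) ^- 2 * df).
Proof.
move=> f0 [hf <-]; have h := derivableV f0 hf; have e := deriveV f0 hf.
by split; [exact: h|rewrite e].
Qed.

Lemma is_derive_coord n (F : 'rV[R]_2 -> 'rV[R]_n) u v (dF : 'rV[R]_n) i :
  is_derive u v F dF -> is_derive u v (fun x => F x 0 i) (dF 0 i).
Proof. by move=> /is_derive_rowP. Qed.

Lemma is_derive_scale n f (F : 'rV[R]_2 -> 'rV[R]_n) u v (df : R) (dF : 'rV[R]_n) :
  is_derive u v f df -> is_derive u v F dF ->
  is_derive u v (fun x => f x *: F x) (df *: F u + f u *: dF).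
Proof.
move=> hf hF; apply/is_derive_rowP => i; rewrite !mxE.
under eq_fun do rewrite mxE.
exact: is_derive_mul hf (is_derive_coord i hF).
Qed.

Lemma is_derive_vadd n (F G : 'rV[R]_2 -> 'rV[R]_n) u v (dF dG : 'rV[R]_n) :
  is_derive u v F dF -> is_derive u v G dG ->
  is_derive u v (fun x => F x + G x) (dF + dG).
Proof. by move=> hf hg; exact: (is_deriveD hf hg). Qed.

Lemma is_derive_add4 f1 f2 f3 f4 u v (c1 c2 c3 c4 : R) :
  is_derive u v f1 c1 -> is_derive u v f2 c2 -> is_derive u v f3 c3 -> is_derive u v f4 c4 ->
  is_derive u v (fun x => f1 x + f2 x + f3 x + f4 x) (c1 + c2 + c3 + c4).
Proof.
by move=> h1 h2 h3 h4; exact: is_derive_add (is_derive_add (is_derive_add h1 h2) h3) h4.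
Qed.

Section Seven.
Implicit Types (F G H : 'rV[R]_2 -> 'rV[R]_7) (dF dG dH : 'rV[R]_7).

Lemma is_derive_dot F G u v dF dG : is_derive u v F dF -> is_derive u v G dG ->
  is_derive u v (fun x => dot (F x) (G x)) (dot dF (G u) + dot (F u) dG).
Proof.
move=> hF hG; rewrite /dot -big_split /=.
have := @is_derive_sum _ _ _ 7 (fun i x => F x 0 i * G x 0 i) u v
  (fun i => dF 0 i * G u 0 i + F u 0 i * dG 0 i).
rewrite (_ : \sum_(i < 7) (fun x => F x 0 i * G x 0 i) = fun x => \sum_(i < 7) F x 0 i * G x 0 i).
  by apply=> i; exact: is_derive_mul (is_derive_coord i hF) (is_derive_coord i hG).
by apply/funext => x; rewrite fct_sumE.
Qed.

Lemma is_derive_co F u v dF k : is_derive u v F dF ->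
  is_derive u v (fun x => co (F x) k) (co dF k).
Proof. exact: is_derive_coord. Qed.

Lemma is_derive_d2 F G u v dF dG i j : is_derive u v F dF -> is_derive u v G dG ->
  is_derive u v (fun x => d2 (F x) (G x) i j) (d2 dF (G u) i j + d2 (F u) dG i j).
Proof.
move=> /is_derive_co hF /is_derive_co hG; apply: is_derive_eq (is_derive_add
  (is_derive_mul (hF i) (hG j)) (is_derive_opp (is_derive_mul (hF j) (hG i)))) _.
by rewrite /d2; ring.
Qed.

Lemma is_derive_d3 F G H u v dF dG dH i j k :
  is_derive u v F dF -> is_derive u v G dG -> is_derive u v H dH ->
  is_derive u v (fun x => d3 (F x) (G x) (H x) i j k)
    (d3 dF (G u) (H u) i j k + d3 (F u) dG (H u) i j k + d3 (F u) (G u) dH i j k).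
Proof.
move=> /is_derive_co hF hG hH; have h i' j' := is_derive_d2 i' j' hG hH.
apply: is_derive_eq (is_derive_add (is_derive_add (is_derive_mul (hF i) (h j k))
  (is_derive_opp (is_derive_mul (hF j) (h i k)))) (is_derive_mul (hF k) (h i j))) _.
by rewrite /d3; ring.
Qed.

Lemma is_derive_phi F G H u v dF dG dH :
  is_derive u v F dF -> is_derive u v G dG -> is_derive u v H dH ->
  is_derive u v (fun x => phi (F x) (G x) (H x))
    (phi dF (G u) (H u) + phi (F u) dG (H u) + phi (F u) (G u) dH).
Proof.
move=> hF hG hH; have h i j k := is_derive_d3 i j k hF hG hH.
under eq_fun do rewrite phiE.
apply: is_derive_eq (is_derive_add (is_derive_add (is_derive_add (is_derive_add
  (is_derive_add (is_derive_add (h _ _ _) (h _ _ _)) (h _ _ _)) (h _ _ _))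
  (is_derive_opp (h _ _ _))) (is_derive_opp (h _ _ _))) (is_derive_opp (h _ _ _))) _.
by rewrite !phiE; ring.
Qed.

Lemma is_derive_cross3 F G H u v dF dG dH :
  is_derive u v F dF -> is_derive u v G dG -> is_derive u v H dH ->
  is_derive u v (fun x => cross3 (F x) (G x) (H x))
    (cross3 dF (G u) (H u) + cross3 (F u) dG (H u) + cross3 (F u) (G u) dH).
Proof.
move=> hF hG hH; have h i j k := is_derive_d3 i j k hF hG hH.
have hN i j k := is_derive_opp (h i j k).
suff hk k : (k < 7)%N -> is_derive u v (fun x => co (cross3 (F x) (G x) (H x)) k)
    (co (cross3 dF (G u) (H u) + cross3 (F u) dG (H u) + cross3 (F u) (G u) dH) k).
  apply/is_derive_rowP => i; have := hk i (ltn_ord i); rewrite /co inord_val.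
  exact.
move=> k7; rewrite !coE !cross3E //; under eq_fun do rewrite cross3E //.
rewrite /cross3_co; move: k k7.
case=> [_|]; first by apply: is_derive_eq (is_derive_add4 (hN _ _ _) (h _ _ _) (h _ _ _) (h _ _ _)) _ => /=; ring.
case=> [_|]; first by apply: is_derive_eq (is_derive_add4 (hN _ _ _) (hN _ _ _) (hN _ _ _) (hN _ _ _)) _ => /=; ring.
case=> [_|]; first by apply: is_derive_eq (is_derive_add4 (h _ _ _) (h _ _ _) (h _ _ _) (hN _ _ _)) _ => /=; ring.
case=> [_|]; first by apply: is_derive_eq (is_derive_add4 (hN _ _ _) (hN _ _ _) (h _ _ _) (h _ _ _)) _ => /=; ring.
case=> [_|]; first by apply: is_derive_eq (is_derive_add4 (h _ _ _) (h _ _ _) (hN _ _ _) (h _ _ _)) _ => /=; ring.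
case=> [_|]; first by apply: is_derive_eq (is_derive_add4 (hN _ _ _) (hN _ _ _) (hN _ _ _) (hN _ _ _)) _ => /=; ring.
case=> [_|]; first by apply: is_derive_eq (is_derive_add4 (h _ _ _) (h _ _ _) (h _ _ _) (hN _ _ _)) _ => /=; ring.
by [].
Qed.

End Seven.

Lemma analytic_is_derive f a v : analytic_at f a -> is_derive a v f ('D_v f a).
Proof.
move=> /analytic_differentiable df.
by have d : derivable f a v by [exact: diff_derivable]; exact: derivableP.
Qed.

Lemma vanalytic_is_derive n (F : 'rV[R]_2 -> 'rV[R]_n) a v :
  vanalytic F a -> is_derive a v F ('D_v F a).
Proof.
move=> Fa; suff d : derivable F a v by exact: derivableP.
apply/derivable_mxP => i j; rewrite ord1.
exact/diff_derivable/analytic_differentiable/Fa.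
Qed.

Lemma vanalytic_deriveE n (F : 'rV[R]_2 -> 'rV[R]_n) a v i :
  vanalytic F a -> ('D_v F a) 0 i = 'D_v (fun u => F u 0 i) a.
Proof.
by move=> /vanalytic_is_derive-/(_ v)/is_derive_coord-/(_ i)[_ ->].
Qed.

Lemma near_forall_ord n (P : 'I_n -> 'rV[R]_2 -> Prop) u :
  (forall i, \forall v \near u, P i v) -> \forall v \near u, forall i, P i v.
Proof. by move=> h; exact: (@filter_forall _ _ P (nbhs u) _ h). Qed.

Lemma vanalytic_near n (F : 'rV[R]_2 -> 'rV[R]_n) a :
  vanalytic F a -> \forall u \near a, vanalytic F u.
Proof. by move=> Fa; apply: near_forall_ord => i; exact: analytic_near. Qed.

Lemma vanalytic_derive n (F : 'rV[R]_2 -> 'rV[R]_n) a k :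
  vanalytic F a -> vanalytic (fun u => 'D_(delta_mx 0 k) F u) a.
Proof.
move=> Fa i; apply: analytic_near_eq (analytic_derive k (Fa i)).
by apply: filterS (vanalytic_near Fa) => u Fu; rewrite vanalytic_deriveE.
Qed.

Lemma vanalytic_schwarz n (F : 'rV[R]_2 -> 'rV[R]_n) a : vanalytic F a ->
  'D_(delta_mx 0 0) (fun u => 'D_(delta_mx 0 1) F u) a =
  'D_(delta_mx 0 1) (fun u => 'D_(delta_mx 0 0) F u) a.
Proof.
move=> Fa; apply/rowP => i.
have E0 := vanalytic_deriveE (delta_mx 0 0) i (vanalytic_derive 1 Fa).
have E1 := vanalytic_deriveE (delta_mx 0 1) i (vanalytic_derive 0 Fa).
have N k : \forall u \near a, ('D_(delta_mx 0 k) F u) 0 i = 'D_(delta_mx 0 k) (fun x => F x 0 i) u.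
  by apply: filterS (vanalytic_near Fa) => u Fu; exact: vanalytic_deriveE.
apply: (etrans E0); apply: (etrans _ (esym E1)).
apply: (etrans (near_eq_derive _ (N 1))); apply: (etrans _ (esym (near_eq_derive _ (N 0)))).
exact: (analytic_schwarz (Fa i)).
Qed.

Lemma vanalytic_differentiable n (F : 'rV[R]_2 -> 'rV[R]_n) a :
  vanalytic F a -> differentiable F a.
Proof.
move=> Fa; rewrite (_ : F = \sum_(i < n) (fun u => F u 0 i *: delta_mx 0 i)).
  apply: differentiable_sum => i; apply: differentiableZl.
  exact/analytic_differentiable/Fa.
by apply/funext => u; rewrite fct_sumE -row_sum_delta.
Qed.

Lemma vanalyticD n (F G : 'rV[R]_2 -> 'rV[R]_n) a :
  vanalytic F a -> vanalytic G a -> vanalytic (fun u => F u + G u) a.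
Proof.
move=> Fa Ga i; apply: analytic_ext (analyticD (Fa i) (Ga i)) => u.
by rewrite mxE.
Qed.

Lemma vanalyticZ n f (F : 'rV[R]_2 -> 'rV[R]_n) a :
  analytic_at f a -> vanalytic F a -> vanalytic (fun u => f u *: F u) a.
Proof.
move=> fa Fa i; apply: analytic_ext (analyticM fa (Fa i)) => u.
by rewrite mxE.
Qed.

Lemma vanalyticN n (F : 'rV[R]_2 -> 'rV[R]_n) a :
  vanalytic F a -> vanalytic (fun u => - F u) a.
Proof.
by move=> Fa i; apply: analytic_ext (analyticN (Fa i)) => u; rewrite mxE.
Qed.

Lemma vanalyticB n (F G : 'rV[R]_2 -> 'rV[R]_n) a :
  vanalytic F a -> vanalytic G a -> vanalytic (fun u => F u - G u) a.
Proof. by move=> Fa Ga; apply: vanalyticD Fa (vanalyticN Ga). Qed.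

Lemma vanalytic_cst n (x : 'rV[R]_n) a : vanalytic (fun _ => x) a.
Proof. by move=> i; exact: analytic_cst. Qed.

Lemma vanalytic_comp n (F : 'rV[R]_2 -> 'rV[R]_n) (h : 'rV[R]_2 -> 'rV[R]_2) a :
  vanalytic h a -> vanalytic F (h a) -> vanalytic (F \o h) a.
Proof. by move=> ha Fa i; exact: (analytic_comp ha (Fa i)). Qed.

Lemma analytic_dot (F G : 'rV[R]_2 -> 'rV[R]_7) a :
  vanalytic F a -> vanalytic G a -> analytic_at (fun u => dot (F u) (G u)) a.
Proof. by move=> Fa Ga; apply: analytic_sum => i; exact: analyticM. Qed.

Lemma vanalytic_cross3 (F G H : 'rV[R]_2 -> 'rV[R]_7) a :
  vanalytic F a -> vanalytic G a -> vanalytic H a ->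
  vanalytic (fun u => cross3 (F u) (G u) (H u)) a.
Proof.
move=> Fa Ga Ha.
have h2 i j : analytic_at (fun u => d2 (G u) (H u) i j) a.
  exact: analyticB (analyticM (Ga _) (Ha _)) (analyticM (Ga _) (Ha _)).
have h3 i j k : analytic_at (fun u => d3 (F u) (G u) (H u) i j k) a.
  exact: analyticD (analyticB (analyticM (Fa _) (h2 _ _)) (analyticM (Fa _) (h2 _ _)))
    (analyticM (Fa _) (h2 _ _)).
have h3N i j k : analytic_at (fun u => - d3 (F u) (G u) (H u) i j k) a.
  exact: analyticN.
suff hk k : (k < 7)%N -> analytic_at (fun u => co (cross3 (F u) (G u) (H u)) k) a.
  by move=> i; have := hk i (ltn_ord i); rewrite /co inord_val.
move=> k7; under eq_fun do rewrite cross3E //.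
have add4 f1 f2 f3 f4 : analytic_at f1 a -> analytic_at f2 a -> analytic_at f3 a ->
    analytic_at f4 a -> analytic_at (fun u => f1 u + f2 u + f3 u + f4 u) a.
  by move=> a1 a2 a3 a4; exact: analyticD (analyticD (analyticD a1 a2) a3) a4.
rewrite /cross3_co; move: k k7.
case=> [_|]; first exact: add4 (h3N _ _ _) (h3 _ _ _) (h3 _ _ _) (h3 _ _ _).
case=> [_|]; first exact: add4 (h3N _ _ _) (h3N _ _ _) (h3N _ _ _) (h3N _ _ _).
case=> [_|]; first exact: add4 (h3 _ _ _) (h3 _ _ _) (h3 _ _ _) (h3N _ _ _).
case=> [_|]; first exact: add4 (h3N _ _ _) (h3N _ _ _) (h3 _ _ _) (h3 _ _ _).
case=> [_|]; first exact: add4 (h3 _ _ _) (h3 _ _ _) (h3N _ _ _) (h3 _ _ _).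
case=> [_|]; first exact: add4 (h3N _ _ _) (h3N _ _ _) (h3N _ _ _) (h3N _ _ _).
case=> [_|]; first exact: add4 (h3 _ _ _) (h3 _ _ _) (h3 _ _ _) (h3N _ _ _).
by [].
Qed.

Lemma is_derive_near_cst f u v (x df : R) : (\forall w \near u, f w = x) ->
  is_derive u v f df -> df = 0.
Proof.
move=> h [_ <-]; rewrite (@near_eq_derive _ _ _ f (cst x) u v h).
exact: derive_cst.
Qed.

Lemma chain_rule n (F : 'rV[R]_2 -> 'rV[R]_n) (h : 'rV[R]_2 -> 'rV[R]_2) a k :
  vanalytic h a -> differentiable F (h a) ->
  'D_(delta_mx 0 k) (F \o h) a =
    'D_(delta_mx 0 k) (fun u => h u 0 0) a *: 'D_(delta_mx 0 0) F (h a) +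
    'D_(delta_mx 0 k) (fun u => h u 0 1) a *: 'D_(delta_mx 0 1) F (h a).
Proof.
move=> ha dF; have dh := vanalytic_differentiable ha.
rewrite deriveE; last exact: differentiable_comp.
rewrite diff_comp //= -(deriveE _ dh).
set w := 'D_(delta_mx 0 k) h a.
have -> : w = w 0 0 *: delta_mx 0 0 + w 0 1 *: delta_mx 0 1.
  by apply: row2P; rewrite !mxE /= ?mulr1 ?mulr0 ?addr0 ?add0r.
by rewrite linearD !linearZ /= -!(deriveE _ dF) /w !vanalytic_deriveE.
Qed.

End VectorCalculus.

(** * The 4-plane spanned by e1, e2, v and J v *)

Section CalibratedSpan.
Variable R : realType.
Implicit Types x y z : 'rV[R]_7.

Lemma phi_cross3_1 x y z : phi (cross3 x y z) y z = 0.
Proof. by rewrite -phi_cycle -(cross3_cycle x) phi_cross3. Qed.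

Lemma phi_cross3_2 x y z : phi x (cross3 x y z) z = 0.
Proof. by rewrite phi_cycle (cross3_cycle z x y) phi_cross3. Qed.

Variables (e1 e2 v : 'rV[R]_7).
Hypotheses (u1 : dot e1 e1 = 1) (u2 : dot e2 e2 = 1) (o12 : dot e1 e2 = 0).
Hypotheses (hv : inW e1 e2 v) (v0 : v != 0).

Let w := cross3 e1 e2 v.
Let v1 : dot e1 v = 0. Proof. by case: hv. Qed.
Let v2 : dot e2 v = 0. Proof. by case: hv. Qed.
Let pv : phi e1 e2 v = 0. Proof. by case: hv. Qed.

(** [phi] vanishes on this 4-plane. Applied to a derivative of [e1] that stays in the plane, it
    removes a term of the Leibniz rule. *)
Lemma phi_span_1 z : normal e1 e2 v z = 0 -> phi z e2 v = 0.
Proof.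
move=> /span_normal_eq0 ->; rewrite !phi_D1 !phi_Z1 pv !phi_xxz phi_xyx phi_cross3_1.
by ring.
Qed.

Lemma phi_span_2 z : normal e1 e2 v z = 0 -> phi e1 z v = 0.
Proof.
move=> /span_normal_eq0 ->; rewrite !phi_D2 !phi_Z2 pv !phi_xxz phi_xyy phi_cross3_2.
by ring.
Qed.

(** The 4-plane is closed under the triple product; the one product that has to be computed is
    [J v x e2 x v], a multiple of [e1]. *)
Lemma cross3_span_1 z : normal e1 e2 v z = 0 -> normal e1 e2 v (cross3 z e2 v) = 0.
Proof.
move=> /span_normal_eq0 ->; rewrite !cross3_D1 !cross3_Z1 cross3_xxz cross3_xyx.
have -> : cross3 (cross3 e1 e2 v) e2 v = - dot v v *: e1.
  rewrite -(cross3_cycle (cross3 e1 e2 v)) -(cross3_cycle e1 e2 v) cross3_cross3.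
  rewrite (dotC v e1) v1 (dotC e2 e1) o12 v2 u2 (phi_cycle e1) pv.
  by rewrite scale0r addr0; apply/rowP => i; rewrite !mxE; ring.
rewrite !scaler0 !addr0 normalD !normalZ (normal_Jv u1 u2 o12 hv v0) (normal_e1 u1 o12 hv).
by rewrite !scaler0 addr0.
Qed.

Lemma cross3_span_2 z : normal e1 e2 v z = 0 -> normal e1 e2 v (cross3 e1 z v) = 0.
Proof.
move=> /span_normal_eq0 ->; rewrite !cross3_D2 !cross3_Z2 cross3_xxz cross3_xyy.
have -> : cross3 e1 (cross3 e1 e2 v) v = - dot v v *: e2.
  rewrite (cross3_cycle v e1) (cross3_cycle v e1 e2) cross3_cross3.
  rewrite (dotC v e1) v1 (dotC v e2) v2 u1 o12 -(phi_cycle v) pv.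
  by rewrite scale0r addr0; apply/rowP => i; rewrite !mxE; ring.
rewrite !scaler0 add0r addr0 normalD !normalZ (normal_Jv u1 u2 o12 hv v0) (normal_e2 u2 o12 hv).
by rewrite !scaler0 addr0.
Qed.

Lemma dot_v_normal z : dot v (normal e1 e2 v z) = 0.
Proof. by rewrite -normalC (normal_v hv v0) dot0l. Qed.

Lemma dot_Jv_normal z : dot (cross3 e1 e2 v) (normal e1 e2 v z) = 0.
Proof. by rewrite -normalC (normal_Jv u1 u2 o12 hv v0) dot0l. Qed.

(* b0 and b1 are the normal parts of the derivatives of v; the two hypotheses on
   them are the equality of mixed derivatives of the parametrization at two points
   of a fibre, read modulo span(e1, e2, v, J v). *)
Lemma codazzi_kernel (A0 A1 p q b0 b1 : 'rV[R]_7) (c := dot v v) :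
  bar e1 e2 A0 = v -> inW e1 e2 b0 -> normal e1 e2 v p = 0 -> normal e1 e2 v q = 0 ->
  cx e1 e2 (dot v A0 / c) (dot w A0 / c) b1 = cx e1 e2 (dot v A1 / c) (dot w A1 / c) b0 ->
  cx e1 e2 (dot v (A0 + p) / c) (dot w (A0 + p) / c) b1 =
    cx e1 e2 (dot v (A1 + q) / c) (dot w (A1 + q) / c) b0 ->
  bar e1 e2 q <> cx e1 e2 (dot v A1 / c) (dot w A1 / c) (bar e1 e2 p) ->
  b0 = 0 /\ b1 = 0.
Proof.
move=> A0v hb0 hp hq cod cod' nprop.
have c0 : c != 0 by rewrite /c dot_eq0.
have vd : dot v A0 = c by rewrite -(dot_v_bar hv) A0v.
have wd : dot w A0 = 0 by rewrite -(dot_Jv_bar e1 e2 v) A0v dot_J_self.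
(* The two hypotheses differ by the displacement along the fibre, so only [p] and [q] remain. *)
have B2 : cx e1 e2 (dot v p / c) (dot w p / c) b1 = cx e1 e2 (dot v q / c) (dot w q / c) b0.
  by move: cod'; rewrite !dotDr !mulrDl !cxDl cod => /addrI.
(* [A0] projects to [v], hence has complex coefficient 1 along [v]. *)
have B1 : b1 = cx e1 e2 (dot v A1 / c) (dot w A1 / c) b0.
  by move: cod; rewrite vd wd divff // mul0r cx1.
suff b00 : b0 = 0 by rewrite B1 b00 cx0r.
(* A nonzero [b0] could be cancelled, which would give [q] and [p] the ratio of [A1] to [A0]; since
   both lie in the 4-plane, this contradicts [nprop]. *)
have [//|nb0] := eqVneq b0 0; exfalso; apply: nprop.
rewrite (normal_eq0 hp) (normal_eq0 hq) (cxM u1 u2 o12 _ _ _ _ hv).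
rewrite B1 (cxM u1 u2 o12 _ _ _ _ hb0) in B2; rewrite -/c -/w.
move: B2; set a1 := dot v p / c; set a2 := dot w p / c.
set l1 := dot v q / c; set l2 := dot w q / c.
set m1 := dot v A1 / c; set m2 := dot w A1 / c => B2.
have [c1 c2] : a1 * m1 - a2 * m2 - l1 = 0 /\ a1 * m2 + a2 * m1 - l2 = 0.
  apply: (cx_eq0 u1 u2 o12 hb0 _ nb0); rewrite cxDl B2 /cx !scaleNr -opprD.
  exact: subrr.
by congr cx; lra.
Qed.

Lemma dot_span z n : normal e1 e2 v z = 0 -> dot z n = dot e1 z * dot e1 n
  + dot e2 z * dot e2 n + dot v z / dot v v * dot v n + dot w z / dot v v * dot w n.
Proof. by move=> /span_normal_eq0 {1}->; rewrite !dotDl !dotZl. Qed.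

Lemma normal_comb3 (a b : R) x y z : normal e1 e2 v x = 0 -> normal e1 e2 v y = 0 ->
  normal e1 e2 v z = 0 -> normal e1 e2 v (a *: x + b *: y + z) = 0.
Proof. by move=> hx hy hz; rewrite !normalD !normalZ hx hy hz !scaler0 !addr0. Qed.

Lemma normal_frame_comb (k1 k2 k3 k4 y1 y2 y3 y4 : R) (p q s t : 'rV[R]_7) :
  normal e1 e2 v p = 0 -> normal e1 e2 v q = 0 ->
  normal e1 e2 v (k1 *: e1 + y1 *: p + (k2 *: e2 + y2 *: q) + (k3 *: v + y3 *: s)
    + (k4 *: cross3 e1 e2 v + y4 *: t)) =
  y3 *: normal e1 e2 v s + y4 *: normal e1 e2 v t.
Proof.
move=> hp hq; rewrite !normalD !normalZ hp hq (normal_e1 u1 o12 hv) (normal_e2 u2 o12 hv).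
by rewrite (normal_v hv v0) (normal_Jv u1 u2 o12 hv v0) !scaler0 !addr0 !add0r.
Qed.

End CalibratedSpan.

(* When the derivatives of an orthogonal frame stay in its span, the squared norm
   of the projection of a fixed vector n onto that span is constant. *)
Lemma energy_gradient (R : realType) (E1 E2 V W : 'rV[R]_2 -> 'rV[R]_7)
    (d1 d2 d3 d4 n : 'rV[R]_7) (u dir : 'rV[R]_2) :
  dot (V u) (V u) != 0 ->
  is_derive u dir E1 d1 -> is_derive u dir E2 d2 ->
  is_derive u dir V d3 -> is_derive u dir W d4 ->
  (\forall x \near u,
    [/\ [/\ dot (E1 x) (E1 x) = 1, dot (E2 x) (E2 x) = 1 & dot (E1 x) (E2 x) = 0],
        dot (E1 x) (V x) = 0 /\ dot (E2 x) (V x) = 0 &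
        [/\ dot (E1 x) (W x) = 0, dot (E2 x) (W x) = 0, dot (V x) (W x) = 0 &
            dot (W x) (W x) = dot (V x) (V x)]]) ->
  let span z := dot z n = dot (E1 u) z * dot (E1 u) n + dot (E2 u) z * dot (E2 u) n
    + dot (V u) z / dot (V u) (V u) * dot (V u) n
    + dot (W u) z / dot (V u) (V u) * dot (W u) n in
  [/\ span d1, span d2, span d3 & span d4] ->
  'D_dir (fun x => dot (E1 x) n ^+ 2 + dot (E2 x) n ^+ 2
     + (dot (V x) n ^+ 2 + dot (W x) n ^+ 2) / dot (V x) (V x)) u = 0.
Proof.
move=> c0 D1 D2 D3 D4 nr /= [s1 s2 s3 s4].
have dn F dF : is_derive u dir F dF -> is_derive u dir (fun x => dot (F x) n) (dot dF n).
  move=> hF; apply: is_derive_eq (is_derive_dot hF (is_derive_cst n _ _)) _.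
  by rewrite dot0r addr0.
have dn2 F dF : is_derive u dir F dF ->
    is_derive u dir (fun x => dot (F x) n ^+ 2) (2 * dot (F u) n * dot dF n).
  move=> hF; have := is_derive_mul (dn F dF hF) (dn F dF hF).
  under eq_fun do rewrite -expr2.
  by move=> h; apply: is_derive_eq h _; ring.
have rel F dF G dG (x : R) : is_derive u dir F dF -> is_derive u dir G dG ->
    (\forall y \near u, dot (F y) (G y) = x) -> dot (G u) dF = - dot (F u) dG.
  move=> hF hG /is_derive_near_cst/(_ (is_derive_dot hF hG)).
  by rewrite (dotC dF) => /eqP; rewrite addr_eq0 => /eqP.
have r11 : dot (E1 u) d1 = - dot (E1 u) d1.
  by apply: (rel _ _ _ _ 1 D1 D1); apply: filterS nr => x [[]].
have r22 : dot (E2 u) d2 = - dot (E2 u) d2.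
  by apply: (rel _ _ _ _ 1 D2 D2); apply: filterS nr => x [[]].
have r12 : dot (E2 u) d1 = - dot (E1 u) d2.
  by apply: (rel _ _ _ _ 0 D1 D2); apply: filterS nr => x [[]].
have r13 : dot (V u) d1 = - dot (E1 u) d3.
  by apply: (rel _ _ _ _ 0 D1 D3); apply: filterS nr => x [_ []].
have r23 : dot (V u) d2 = - dot (E2 u) d3.
  by apply: (rel _ _ _ _ 0 D2 D3); apply: filterS nr => x [_ []].
have r14 : dot (W u) d1 = - dot (E1 u) d4.
  by apply: (rel _ _ _ _ 0 D1 D4); apply: filterS nr => x [_ _ []].
have r24 : dot (W u) d2 = - dot (E2 u) d4.
  by apply: (rel _ _ _ _ 0 D2 D4); apply: filterS nr => x [_ _ []].
have r34 : dot (W u) d3 = - dot (V u) d4.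
  by apply: (rel _ _ _ _ 0 D3 D4); apply: filterS nr => x [_ _ []].
have r44 : dot (W u) d4 = dot (V u) d3.
  have : \forall x \near u, dot (W x) (W x) - dot (V x) (V x) = 0.
    by apply: filterS nr => x [_ _ [_ _ _ ->]]; rewrite subrr.
  move=> /is_derive_near_cst/(_ (is_derive_add (is_derive_dot D4 D4)
    (is_derive_opp (is_derive_dot D3 D3)))).
  by rewrite (dotC d4) (dotC d3); lra.
have g11 : dot (E1 u) d1 = 0 by move: r11; lra.
have g22 : dot (E2 u) d2 = 0 by move: r22; lra.
have [_ E] := is_derive_add (is_derive_add (dn2 _ _ D1) (dn2 _ _ D2))
  (is_derive_mul (is_derive_add (dn2 _ _ D3) (dn2 _ _ D4))
    (is_derive_inv c0 (is_derive_dot D3 D3))).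
apply: (etrans E); rewrite s1 s2 s3 s4 (dotC d3) g11 g22 r12 r13 r14 r23 r24 r34 r44.
by field.
Qed.

(* Unification otherwise unfolds derivatives of distinct functions. *)
#[local] Opaque derive.

(** * Constancy of the 4-plane in the degenerate case *)

Section DegeneratePencil.
Variable R : realType.
Variables (e1 e2 psi : 'rV[R]_2 -> 'rV[R]_7) (r0 : 'rV[R]_2).
Implicit Types (u x a : 'rV[R]_2) (k : 'I_2) (F : 'rV[R]_2 -> 'rV[R]_7).

Definition velocity (r : 'rV[R]_2) k u : 'rV[R]_7 :=
  r 0 0 *: 'D_(delta_mx 0 k) e1 u + r 0 1 *: 'D_(delta_mx 0 k) e2 u
  + 'D_(delta_mx 0 k) psi u.

Definition base_vector u := bar (e1 u) (e2 u) (velocity r0 0 u).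

Definition base_Jvector u := cross3 (e1 u) (e2 u) (base_vector u).

Local Notation v := base_vector.
Local Notation w := base_Jvector.
Local Notation N u := (normal (e1 u) (e2 u) (base_vector u)).

Definition analytic_frame u : Prop :=
  [/\ vanalytic e1 u, vanalytic e2 u, vanalytic psi u &
      [/\ dot (e1 u) (e1 u) = 1, dot (e2 u) (e2 u) = 1 & dot (e1 u) (e2 u) = 0]].

Definition degenerate_at u : Prop :=
  [/\ analytic_frame u, v u != 0,
      forall r k, phi (e1 u) (e2 u) (velocity r k u) = 0 &
      forall k, [/\ N u ('D_(delta_mx 0 k) e1 u) = 0, N u ('D_(delta_mx 0 k) e2 u) = 0
        & N u ('D_(delta_mx 0 k) psi u) = 0]].

Lemma vanalytic_velocity r k u : analytic_frame u -> vanalytic (velocity r k) u.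
Proof.
move=> [h1 h2 h3 _]; apply: vanalyticD; first apply: vanalyticD.
- by apply: vanalyticZ; [exact: analytic_cst|exact: vanalytic_derive].
- by apply: vanalyticZ; [exact: analytic_cst|exact: vanalytic_derive].
- exact: vanalytic_derive.
Qed.

Lemma vanalytic_base_vector u : analytic_frame u -> vanalytic v u.
Proof.
move=> hu; have hA := vanalytic_velocity r0 0 hu; have [h1 h2 _ _] := hu.
by apply: vanalyticB; [apply: vanalyticB => //|]; apply: vanalyticZ => //; exact: analytic_dot.
Qed.

Lemma vanalytic_base_Jvector u : analytic_frame u -> vanalytic w u.
Proof.
move=> hu; have [h1 h2 _ _] := hu.
exact: vanalytic_cross3 (vanalytic_base_vector hu).
Qed.

Lemma velocity_schwarz r u : analytic_frame u ->
  'D_(delta_mx 0 1) (velocity r 0) u = 'D_(delta_mx 0 0) (velocity r 1) u.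
Proof.
move=> [h1 h2 h3 _].
pose X F := 'D_(delta_mx 0 1) (fun x => 'D_(delta_mx 0 0) F x) u.
have D01 F : vanalytic F u -> is_derive u (delta_mx 0 1 : 'rV[R]_2)
    (fun x => 'D_(delta_mx 0 0) F x) (X F).
  by move=> hF; apply: vanalytic_is_derive; exact: vanalytic_derive.
have D10 F : vanalytic F u -> is_derive u (delta_mx 0 0 : 'rV[R]_2)
    (fun x => 'D_(delta_mx 0 1) F x) (X F).
  move=> hF; apply: is_derive_eq (vanalytic_schwarz hF).
  by apply: vanalytic_is_derive; exact: vanalytic_derive.
have V k l : (forall F, vanalytic F u -> is_derive u (delta_mx 0 l : 'rV[R]_2)
      (fun x => 'D_(delta_mx 0 k) F x) (X F)) ->
    is_derive u (delta_mx 0 l : 'rV[R]_2) (velocity r k)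
    (r 0 0 *: X e1 + r 0 1 *: X e2 + X psi).
  move=> D; apply: is_derive_vadd (D _ h3).
  exact: (is_derive_vadd (is_deriveZ (r 0 0) (D _ h1)) (is_deriveZ (r 0 1) (D _ h2))).
have [_ E01] := V 0 1 D01; have [_ E10] := V 1 0 D10.
exact: (etrans E01 (esym E10)).
Qed.

Section Point.
Variable u : 'rV[R]_2.
Hypothesis deg : \forall x \near u, degenerate_at x.

Let degu : degenerate_at u. Proof. exact: nbhs_singleton deg. Qed.
Let fr : analytic_frame u. Proof. by case: degu. Qed.
Let u1 : dot (e1 u) (e1 u) = 1. Proof. by case: fr => _ _ _ []. Qed.
Let u2 : dot (e2 u) (e2 u) = 1. Proof. by case: fr => _ _ _ []. Qed.
Let o12 : dot (e1 u) (e2 u) = 0. Proof. by case: fr => _ _ _ []. Qed.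
Let v0 : v u != 0. Proof. by case: degu. Qed.

Lemma inW_base_vector x : degenerate_at x -> inW (e1 x) (e2 x) (v x).
Proof. by move=> [[_ _ _ [h1 h2 h3]] _ hp _]; exact: inW_bar. Qed.

Let hv : inW (e1 u) (e2 u) (v u). Proof. exact: inW_base_vector. Qed.

Let D k F := 'D_(delta_mx 0 k) F u.
Let isD F k : vanalytic F u -> is_derive u (delta_mx 0 k : 'rV[R]_2) F (D k F).
Proof. exact: vanalytic_is_derive. Qed.
Let D1 k : is_derive u (delta_mx 0 k : 'rV[R]_2) e1 (D k e1).
Proof. by apply: isD; case: fr. Qed.
Let D2 k : is_derive u (delta_mx 0 k : 'rV[R]_2) e2 (D k e2).
Proof. by apply: isD; case: fr. Qed.
Let Dv k : is_derive u (delta_mx 0 k : 'rV[R]_2) v (D k v).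
Proof. by apply: isD; exact: vanalytic_base_vector. Qed.
Let Dw k : is_derive u (delta_mx 0 k : 'rV[R]_2) w (D k w).
Proof. by apply: isD; exact: vanalytic_base_Jvector. Qed.
Let N1 k : N u (D k e1) = 0. Proof. by have [_ _ _ /(_ k)[h _ _]] := degu; exact: h. Qed.
Let N2 k : N u (D k e2) = 0. Proof. by have [_ _ _ /(_ k)[_ h _]] := degu; exact: h. Qed.

Lemma phi_derive_base_vector k : phi (e1 u) (e2 u) (D k v) = 0.
Proof.
have h := is_derive_phi (D1 k) (D2 k) (Dv k).
have : \forall x \near u, phi (e1 x) (e2 x) (v x) = 0.
  by apply: filterS deg => x /inW_base_vector[].
move=> /is_derive_near_cst/(_ h).
by rewrite (phi_span_1 hv (N1 k)) (phi_span_2 hv (N2 k)) !add0r.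
Qed.

(** In the Leibniz rule the terms with derivatives of [e1] and [e2] stay in the 4-plane, which is
    closed under the triple product; only the derivative of [v] contributes. *)
Lemma normal_derive_Jvector k :
  N u (D k w) = cross3 (e1 u) (e2 u) (N u (D k v)).
Proof.
have [_ E] := is_derive_cross3 (D1 k) (D2 k) (Dv k).
have -> : D k w = cross3 (D k e1) (e2 u) (v u) + cross3 (e1 u) (D k e2) (v u)
    + cross3 (e1 u) (e2 u) (D k v) by exact: E.
rewrite !normalD (cross3_span_1 u1 u2 o12 hv v0 (N1 k)).
by rewrite (cross3_span_2 u1 u2 o12 hv v0 (N2 k)) !add0r normal_J.
Qed.

(** Expand [F] in the frame [e1], [e2], [v], [w]. The derivatives of [e1] and [e2] have no normal
    part and that of [w] is [J] of that of [v], so the normal derivative of a section is complex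
    linear in its coefficient along [v]. *)
Lemma normal_derive_section F k : vanalytic F u ->
  (\forall x \near u, N x (F x) = 0) ->
  N u (D k F) = cx (e1 u) (e2 u) (dot (v u) (F u) / dot (v u) (v u))
    (dot (w u) (F u) / dot (v u) (v u)) (N u (D k v)).
Proof.
move=> hF NF; have [h1 h2 _ _] := fr.
have hvan := vanalytic_base_vector fr; have hwan := vanalytic_base_Jvector fr.
have dvv : dot (v u) (v u) != 0 by rewrite dot_eq0.
have cV : analytic_at (fun x => (dot (v x) (v x))^-1) u.
  by apply: analyticV => //; exact: analytic_dot.
pose y1 x := dot (e1 x) (F x); pose y2 x := dot (e2 x) (F x).
pose y3 x := dot (v x) (F x) / dot (v x) (v x).
pose y4 x := dot (w x) (F x) / dot (v x) (v x).
have a1 : analytic_at y1 u by exact: analytic_dot.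
have a2 : analytic_at y2 u by exact: analytic_dot.
have a3 : analytic_at y3 u by apply: analyticM cV; exact: analytic_dot.
have a4 : analytic_at y4 u by apply: analyticM cV; exact: analytic_dot.
pose dy (y : 'rV[R]_2 -> R) := 'D_(delta_mx 0 k) y u.
have isd y : analytic_at y u -> is_derive u (delta_mx 0 k : 'rV[R]_2) y (dy y).
  exact: analytic_is_derive.
have E := is_derive_vadd (is_derive_vadd (is_derive_vadd
  (is_derive_scale (isd _ a1) (D1 k)) (is_derive_scale (isd _ a2) (D2 k)))
  (is_derive_scale (isd _ a3) (Dv k))) (is_derive_scale (isd _ a4) (Dw k)).
have FE : \forall x \near u, F x =
    y1 x *: e1 x + y2 x *: e2 x + y3 x *: v x + y4 x *: w x.
  by apply: filterS NF => x; exact: span_normal_eq0.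
have -> : D k F = dy y1 *: e1 u + y1 u *: D k e1 + (dy y2 *: e2 u + y2 u *: D k e2)
    + (dy y3 *: v u + y3 u *: D k v) + (dy y4 *: w u + y4 u *: D k w).
  by rewrite /D (near_eq_derive _ FE); case: E.
apply: (etrans (normal_frame_comb u1 u2 o12 hv v0 _ _ _ _ _ _ _ _ _ _ (N1 k) (N2 k))).
by rewrite normal_derive_Jvector.
Qed.

Lemma normal_velocity r k : \forall x \near u, N x (velocity r k x) = 0.
Proof.
apply: filterS deg => x [_ _ _ /(_ k)[h1 h2 h3]].
exact: normal_comb3.
Qed.

(** Both velocities are sections of the plane field and their mixed derivatives agree; comparing the
    normal parts gives a Codazzi equation for each point [r] of the fibre. *)
Lemma codazzi r :
  cx (e1 u) (e2 u) (dot (v u) (velocity r 0 u) / dot (v u) (v u))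
    (dot (w u) (velocity r 0 u) / dot (v u) (v u)) (N u (D 1 v)) =
  cx (e1 u) (e2 u) (dot (v u) (velocity r 1 u) / dot (v u) (v u))
    (dot (w u) (velocity r 1 u) / dot (v u) (v u)) (N u (D 0 v)).
Proof.
have h k l := normal_derive_section l (vanalytic_velocity r k fr) (normal_velocity r k).
apply: (etrans (esym (h 0 1))); apply: (etrans _ (h 1 0)).
exact: (congr1 (N u) (velocity_schwarz r fr)).
Qed.

(** Moving from [r0] in the fibre direction of [ed] adds the derivatives of [ed] to the velocities.
    Where these do not have the complex ratio of the velocities at [r0], the Codazzi equations at
    the two points admit only the zero solution. *)
Lemma base_vector_parallel (ed : 'rV[R]_2 -> 'rV[R]_7) :
  (ed = e1 \/ ed = e2) ->
  bar (e1 u) (e2 u) (D 1 ed) <>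
    cx (e1 u) (e2 u) (dot (v u) (velocity r0 1 u) / dot (v u) (v u))
      (dot (w u) (velocity r0 1 u) / dot (v u) (v u)) (bar (e1 u) (e2 u) (D 0 ed)) ->
  forall k, N u (D k v) = 0 /\ N u (D k w) = 0.
Proof.
move=> hed nprop.
have [d dE] : exists d, forall k, velocity (r0 + d) k u = velocity r0 k u + D k ed.
  have gen (d : 'rV[R]_2) k : velocity (r0 + d) k u = velocity r0 k u +
      (d 0 0 *: D k e1 + d 0 1 *: D k e2).
    rewrite /velocity /D !mxE; move: ('D__ e1 _) ('D__ e2 _) ('D__ psi _) => p q s.
    by apply/rowP => i; rewrite !mxE; ring.
  case: hed => ->; [exists (delta_mx 0 0)|exists (delta_mx 0 1)] => k; rewrite gen !mxE /=.
    by rewrite scale1r scale0r addr0.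
  by rewrite scale1r scale0r add0r.
have hb0 : inW (e1 u) (e2 u) (N u (D 0 v)).
  by apply: (inW_normal u1 u2 o12 hv); exact: phi_derive_base_vector.
have ned k : N u (D k ed) = 0 by case: hed => ->; [exact: N1|exact: N2].
have cod := codazzi (r0 + d); rewrite (dE 0) (dE 1) in cod.
have [b0 b1] := codazzi_kernel u1 u2 o12 hv v0 (erefl _) hb0 (ned 0) (ned 1)
  (codazzi r0) cod nprop.
have hb : forall k, N u (D k v) = 0 by apply: forall_I2; [exact: b0|exact: b1].
move=> k; split; first exact: hb.
rewrite normal_derive_Jvector (hb k).
exact: cross3_03.
Qed.

Lemma normal_energy_gradient (n : 'rV[R]_7) k :
  (forall l, N u (D l v) = 0 /\ N u (D l w) = 0) ->
  'D_(delta_mx 0 k) (fun x => dot (e1 x) n ^+ 2 + dot (e2 x) n ^+ 2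
     + (dot (v x) n ^+ 2 + dot (w x) n ^+ 2) / dot (v x) (v x)) u = 0.
Proof.
move=> /(_ k)[Nv Nw].
apply: (energy_gradient _ (D1 k) (D2 k) (Dv k) (Dw k)).
- by rewrite dot_eq0.
- apply: filterS deg => x hx; have [[_ _ _ [k1 k2 k3]] _ _ _] := hx.
  have hvx := inW_base_vector hx; have [k4 k5 _] := hvx.
  split; [by split|by split|].
  split; [by rewrite dotC; exact: dot_cross3_1|by rewrite dotC; exact: dot_cross3_2|
    by rewrite dotC; exact: dot_J_self|exact: (dot_J_J k1 k2 k3 _ hvx)].
- by split; [exact: (dot_span n (N1 k))|exact: (dot_span n (N2 k))|
    exact: (dot_span n Nv)|exact: (dot_span n Nw)].
Qed.

End Point.

(** For a vector [n] normal to the plane at [a], [q] is the squared norm of its projection to the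
    moving plane. It vanishes at [a] and has zero gradient, so [n] stays normal; the derivatives of
    [psi] lie in the plane, hence [dot (psi u) n] is constant too. *)
Lemma degenerate_planar a (ed : 'rV[R]_2 -> 'rV[R]_7) : (ed = e1 \/ ed = e2) ->
  (\forall u \near a, degenerate_at u) ->
  (\forall u \near a, bar (e1 u) (e2 u) ('D_(delta_mx 0 1) ed u) <>
    cx (e1 u) (e2 u) (dot (v u) (velocity r0 1 u) / dot (v u) (v u))
      (dot (w u) (velocity r0 1 u) / dot (v u) (v u))
      (bar (e1 u) (e2 u) ('D_(delta_mx 0 0) ed u))) ->
  \forall u \near a, forall i : 'I_7, [/\ dot (e1 u) (N a (delta_mx 0 i)) = 0,
    dot (e2 u) (N a (delta_mx 0 i)) = 0 & dot (psi u - psi a) (N a (delta_mx 0 i)) = 0].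
Proof.
move=> hed deg nprop; apply: near_forall_ord => i; set n := N a _.
have dega : degenerate_at a by exact: nbhs_singleton deg.
have [fra va0 _ _] := dega; have [h1 h2 h3 [k1 k2 k3]] := fra.
have hva := inW_base_vector dega.
have van := vanalytic_base_vector fra; have wan := vanalytic_base_Jvector fra.
have nan := vanalytic_cst n a.
pose q x := dot (e1 x) n ^+ 2 + dot (e2 x) n ^+ 2
  + (dot (v x) n ^+ 2 + dot (w x) n ^+ 2) / dot (v x) (v x).
have sq F : vanalytic F a -> analytic_at (fun x => dot (F x) n ^+ 2) a.
  move=> hF; apply: analytic_ext (analyticM (analytic_dot hF nan) (analytic_dot hF nan)).
  by move=> x; rewrite expr2.
have qan : analytic_at q a.
  apply: analyticD (analyticD (sq _ h1) (sq _ h2)) (analyticM (analyticD (sq _ van) (sq _ wan)) _).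
  by apply: analyticV (analytic_dot van van); rewrite dot_eq0.
have par : \forall u \near a, (\forall x \near u, degenerate_at x) /\
    forall k, N u ('D_(delta_mx 0 k) v u) = 0 /\ N u ('D_(delta_mx 0 k) w u) = 0.
  have deg' : \forall u \near a, \forall x \near u, degenerate_at x by exact: nbhs_interior.
  apply: filterS2 deg' nprop => u du np; split; first exact: du.
  exact: (base_vector_parallel du hed np).
have qgrad k : \forall u \near a, 'D_(delta_mx 0 k) q u = 0.
  by apply: filterS par => u [du hu]; exact: (normal_energy_gradient du n k hu).
have qa : q a = 0.
  have e1n : dot (e1 a) n = 0 by exact: dot_e1_normal.
  have e2n : dot (e2 a) n = 0 by exact: dot_e2_normal.
  have vn : dot (v a) n = 0 by exact: dot_v_normal.
  have wn : dot (w a) n = 0 by exact: dot_Jv_normal.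
  by rewrite /q e1n e2n vn wn !expr0n /= !addr0 mul0r addr0.
have q0 : \forall u \near a, [/\ dot (e1 u) n = 0, dot (e2 u) n = 0, dot (v u) n = 0 &
    dot (w u) n = 0].
  apply: filterS2 deg (analytic_gradient0 qan qgrad) => u du; rewrite qa /q.
  have c0 : 0 < dot (v u) (v u) by case: du => _ vu0 _ _; rewrite dot_gt0.
  move: c0; move: (dot (e1 u) n) (dot (e2 u) n) (dot (v u) n) (dot (w u) n)
    (dot (v u) (v u)) => x y z t c c0.
  have p1 := sqr_ge0 x; have p2 := sqr_ge0 y; have p3 := sqr_ge0 z; have p4 := sqr_ge0 t.
  have p5 : 0 <= (z ^+ 2 + t ^+ 2) / c by rewrite divr_ge0 ?addr_ge0 // ltW.
  move=> E; have /eqP : (z ^+ 2 + t ^+ 2) / c = 0 by lra.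
  rewrite mulf_eq0 invr_eq0 (gt_eqF c0) orbF => /eqP zt.
  by split; apply/eqP; rewrite -sqrf_eq0; apply/eqP; lra.
have psi_an : analytic_at (fun x => dot (psi x) n) a by exact: analytic_dot.
have psi_grad k : \forall u \near a, 'D_(delta_mx 0 k) (fun x => dot (psi x) n) u = 0.
  apply: filterS2 deg q0 => u du [x1 x2 x3 x4].
  have [[_ _ hpsi _] _ _ /(_ k)[_ _ Npsi]] := du.
  have [_ E] := is_derive_dot (vanalytic_is_derive (delta_mx 0 k) hpsi) (is_derive_cst n _ _).
  apply: (etrans E); rewrite dot0r addr0 (dot_span n Npsi) x1 x2 x3 -/(w u) x4.
  by rewrite !mulr0 !addr0.
apply: filterS2 q0 (analytic_gradient0 psi_an psi_grad) => u [x1 x2 _ _] x3.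
by split; rewrite // dotDl dotNl x3 subrr.
Qed.

End DegeneratePencil.

(** * Charts and ruled frames *)

Section Charts.
Variables (R : realType) (S : topologicalType).
Implicit Types (x y z : chart R S) (p q : S).

Lemma coord_paramK x a : topological_chart x -> codom_chart x a ->
  dom x (param x a) /\ coord x (param x a) = a.
Proof. by move=> [_ _ pK _ _] [p xp <-]; rewrite pK. Qed.

Lemma chart_coord_continuous x p : topological_chart x -> dom x p -> coord x @ p --> coord x p.
Proof.
move=> [od _ _ cc _] xp; rewrite (continuous_open_subspace _ od) in cc.
by apply: cc; rewrite inE.
Qed.

Lemma chart_param_continuous x a : topological_chart x -> codom_chart x a ->
  param x @ a --> param x a.
Proof.
move=> [_ oc _ _ pc] xa; rewrite (continuous_open_subspace _ oc) in pc.
by apply: pc; rewrite inE.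
Qed.

Lemma codom_chartP x p : dom x p -> codom_chart x (coord x p).
Proof. by move=> xp; exists p. Qed.

Lemma near_dom x p : topological_chart x -> dom x p -> \forall q \near p, dom x q.
Proof. by move=> [od _ _ _ _] xp; exact: open_nbhs_nbhs. Qed.

Lemma near_codom x a : topological_chart x -> codom_chart x a ->
  \forall b \near a, codom_chart x b.
Proof. by move=> [_ oc _ _ _] xa; exact: open_nbhs_nbhs. Qed.

Lemma near_param x p (P : S -> Prop) : topological_chart x -> dom x p ->
  (\forall q \near p, P q) -> \forall a \near coord x p, P (param x a).
Proof.
move=> tx xp Pp; have [_ _ pK _ _] := tx.
by apply: (chart_param_continuous tx (codom_chartP xp)); rewrite pK.
Qed.

Lemma near_coord x p (P : 'rV[R]_2 -> Prop) : topological_chart x -> dom x p ->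
  (\forall a \near coord x p, P a) -> \forall q \near p, P (coord x q).
Proof. by move=> tx xp; exact: chart_coord_continuous. Qed.

Lemma near_transition x y n (F : S -> 'rV[R]_n) p : topological_chart x ->
  topological_chart y -> dom x p -> dom y p ->
  \forall a \near coord x p, (F \o param x) a = ((F \o param y) \o (coord y \o param x)) a.
Proof.
move=> tx ty xp yp; have [_ _ pK _ _] := ty.
apply: filterS (near_param tx xp (near_dom ty yp)) => a ya /=.
by rewrite pK.
Qed.

Lemma vanalytic_near_eq n (F G : 'rV[R]_2 -> 'rV[R]_n) a :
  (\forall u \near a, F u = G u) -> vanalytic F a -> vanalytic G a.
Proof.
by move=> FG Fa i; apply: analytic_near_eq (Fa i); apply: filterS FG => u ->.
Qed.

Lemma analytic_transitionP x y p : analytic_transition x y -> dom x p -> dom y p ->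
  vanalytic (coord y \o param x) (coord x p).
Proof. by move=> xy xp yp i; apply: xy; exists p. Qed.

Lemma vanalytic_change x y n (F : S -> 'rV[R]_n) p : topological_chart x ->
  topological_chart y -> analytic_transition y x -> dom x p -> dom y p ->
  vanalytic (F \o param x) (coord x p) -> vanalytic (F \o param y) (coord y p).
Proof.
move=> tx ty yx xp yp Fx; have [_ _ pK _ _] := ty.
apply: (vanalytic_near_eq (F := (F \o param x) \o (coord x \o param y))).
  by apply: filterS (near_transition F ty tx yp xp) => a ->.
by apply: vanalytic_comp; [exact: analytic_transitionP|rewrite /= pK].
Qed.

(** [M] is the Jacobian of the transition map. It is quantified before [F] because the same matrix
    must serve [phi1], [phi2] and [psi] at once. *)
Lemma pder_change x y p : topological_chart x -> topological_chart y ->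
  analytic_transition x y -> dom x p -> dom y p ->
  exists M : 'I_2 -> 'I_2 -> R, forall n (F : S -> 'rV[R]_n) k,
    vanalytic (F \o param y) (coord y p) ->
    pder x k F p = M k 0 *: pder y 0 F p + M k 1 *: pder y 1 F p.
Proof.
move=> tx ty xy xp yp; have [_ _ pK _ _] := tx.
exists (fun k j => 'D_(delta_mx 0 k) (fun u => (coord y \o param x) u 0 j) (coord x p)).
move=> n F k Fy; rewrite /pder.
have hE : (coord y \o param x) (coord x p) = coord y p by rewrite /= pK.
have hF : differentiable (F \o param y) ((coord y \o param x) (coord x p)).
  by rewrite hE; exact: vanalytic_differentiable.
have C := chain_rule k (analytic_transitionP xy xp yp) hF.
apply: (etrans (near_eq_derive _ (near_transition F tx ty xp yp))).
by rewrite hE in C; exact: C.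
Qed.

End Charts.

Section RuledFrames.
Variables (R : realType) (S : topologicalType).
Variables (phi1 phi2 psi : S -> 'rV[R]_7).
Implicit Types (x y : chart R S) (p q : S) (r : 'rV[R]_2).

Definition analytic_in x p : Prop := [/\ vanalytic (phi1 \o param x) (coord x p),
  vanalytic (phi2 \o param x) (coord x p) & vanalytic (psi \o param x) (coord x p)].

Definition chart_velocity x r k p : 'rV[R]_7 :=
  r 0 0 *: pder x k phi1 p + r 0 1 *: pder x k phi2 p + pder x k psi p.

Lemma pder_ruled x r k p : analytic_in x p ->
  pder x k (ruled phi1 phi2 psi r) p = chart_velocity x r k p.
Proof.
move=> [h1 h2 h3].
have d F := @vanalytic_is_derive R 7 F (coord x p) (delta_mx 0 k).
have [_ E] := is_derive_vadd (is_derive_vadd (is_deriveZ (r 0 0) (d _ h1))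
  (is_deriveZ (r 0 1) (d _ h2))) (d _ h3).
exact: E.
Qed.

Lemma derive_ruled_r r p (v : 'rV[R]_2) :
  'D_v (ruled phi1 phi2 psi ^~ p) r = v 0 0 *: phi1 p + v 0 1 *: phi2 p.
Proof.
have dc i : is_derive r v (fun s : 'rV[R]_2 => s 0 i) (v 0 i).
  by apply: is_derive_coord; exact: is_derive_id.
have dl i (w : 'rV[R]_7) : is_derive r v (fun s : 'rV[R]_2 => s 0 i *: w) (v 0 i *: w).
  apply: is_derive_eq (is_derive_scale (dc i) (is_derive_cst w _ _)) _.
  by rewrite scaler0 addr0.
have [_ E] := is_derive_vadd (is_derive_vadd (dl 0 (phi1 p)) (dl 1 (phi2 p)))
  (is_derive_cst (psi p) _ _).
by apply: (etrans E); rewrite addr0.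
Qed.

Lemma coordinate_frameE x r p : analytic_in x p ->
  coordinate_frame (ruled phi1 phi2 psi) x r p =
  rows4 (phi1 p) (phi2 p) (chart_velocity x r 0 p) (chart_velocity x r 1 p).
Proof.
move=> hx; rewrite /coordinate_frame !(pder_ruled _ _ hx) !derive_ruled_r.
by rewrite !mxE /= !scale1r !scale0r addr0 add0r.
Qed.

Lemma frame_change_sub x y r p : topological_chart x -> topological_chart y ->
  analytic_transition x y -> dom x p -> dom y p -> analytic_in x p -> analytic_in y p ->
  (coordinate_frame (ruled phi1 phi2 psi) x r p <=
   coordinate_frame (ruled phi1 phi2 psi) y r p)%MS.
Proof.
move=> tx ty xy xp yp hx hy; have [M hM] := pder_change tx ty xy xp yp.
have hv k : chart_velocity x r k p = M k 0 *: chart_velocity y r 0 p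
    + M k 1 *: chart_velocity y r 1 p.
  have [h1 h2 h3] := hy.
  rewrite /chart_velocity (hM _ _ k h1) (hM _ _ k h2) (hM _ _ k h3).
  move: (pder y 0 phi1 p) (pder y 1 phi1 p) (pder y 0 phi2 p) (pder y 1 phi2 p)
    (pder y 0 psi p) (pder y 1 psi p) => a b c d e f.
  by apply/rowP => i; rewrite !mxE; ring.
rewrite (coordinate_frameE r hx) (coordinate_frameE r hy) rows4_sub (hv 0) (hv 1).
have [s1 s2 s3 s4] := sub_rows4 (phi1 p) (phi2 p) (chart_velocity y r 0 p) (chart_velocity y r 1 p).
rewrite s1 s2 /=; apply/andP.
by split; apply: addmx_sub; apply: scalemx_sub.
Qed.

End RuledFrames.

Section RowFree.
Variable R : realType.

Lemma row_free_sub m n (F G : 'M[R]_(m, n)) : row_free F -> (F <= G)%MS -> row_free G.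
Proof.
by rewrite -!row_leq_rank => fF /mxrankS; exact: leq_trans.
Qed.

Lemma starphi_form_eqmx (B M : 'M[R]_(4, 7)) : row_free M -> (B == M)%MS ->
  starphi_form M != 0 -> starphi_form B != 0.
Proof.
move=> fM /andP[BM MB] M0; have fB := row_free_sub fM MB.
have /submxP[Q QE] := BM; rewrite QE starphi_form_mul mulf_neq0 //.
have fQ : row_free Q.
  rewrite -row_leq_rank; move: fB; rewrite -row_leq_rank QE => /leq_trans; apply.
  exact: mxrankM_maxl.
by move: fQ; rewrite row_free_unit unitmxE unitfE.
Qed.

(** The terms with [f], [g1], [g2] are multiples of [e1] and [e2], which [bar] removes; what is left
    of the system is linear and reads d_t = J d_s at every point of the fibre. *)
Lemma bar_system (e1 e2 a1 a2 a3 : 'rV[R]_7) (r1 r2 f g1 g2 : R) :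
  dot e1 e1 = 1 -> dot e2 e2 = 1 -> dot e1 e2 = 0 ->
  bar e1 e2 (r1 *: (cross3 e1 e2 a1 + f *: e2) + r2 *: (cross3 e1 e2 a2 - f *: e1)
    + (cross3 e1 e2 a3 + g1 *: e1 + g2 *: e2)) =
  cross3 e1 e2 (r1 *: a1 + r2 *: a2 + a3).
Proof.
move=> u1 u2 o12; rewrite -[- (f *: e1)]scaleNr !barD !barZ !barD !barZ.
rewrite (bar_e1 u1 o12) (bar_e2 u2 o12) !scaler0 !addr0 !bar_J.
by rewrite !cross3_D3 !cross3_Z3.
Qed.

Lemma starphi_bar_J (e1 e2 A B : 'rV[R]_7) : dot e1 e1 = 1 -> dot e2 e2 = 1 ->
  dot e1 e2 = 0 -> phi e1 e2 A = 0 -> bar e1 e2 B = cross3 e1 e2 A ->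
  starphi e1 e2 A B = dot (bar e1 e2 A) (bar e1 e2 A).
Proof.
move=> u1 u2 o12 pA BJ; rewrite -cross3P (barE e1 e2 B) BJ.
rewrite (dotDr _ (_ + _)) (dotDr _ (cross3 _ _ _)) (dotZr _ _ e1) (dotZr _ _ e2).
rewrite dot_cross3_1 dot_cross3_2 !mulr0 !addr0 -(cross3_bar e1 e2 A).
by apply: (dot_J_J u1 u2 o12); exact: inW_bar.
Qed.

Lemma phi_comb3 (e1 e2 a1 a2 a3 : 'rV[R]_7) (r1 r2 : R) :
  phi e1 e2 a1 = 0 -> phi e1 e2 a2 = 0 -> phi e1 e2 a3 = 0 ->
  phi e1 e2 (r1 *: a1 + r2 *: a2 + a3) = 0.
Proof. by move=> h1 h2 h3; rewrite !phi_D3 !phi_Z3 h1 h2 h3 !mulr0 !addr0. Qed.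

Lemma starphi_comb (e1 e2 a1 a2 a3 b1 b2 b3 : 'rV[R]_7) (r1 r2 : R) :
  starphi e1 e2 (r1 *: a1 + r2 *: a2 + a3) (r1 *: b1 + r2 *: b2 + b3) =
  r1 * (r1 * starphi e1 e2 a1 b1 + r2 * starphi e1 e2 a1 b2 + starphi e1 e2 a1 b3)
  + r2 * (r1 * starphi e1 e2 a2 b1 + r2 * starphi e1 e2 a2 b2 + starphi e1 e2 a2 b3)
  + (r1 * starphi e1 e2 a3 b1 + r2 * starphi e1 e2 a3 b2 + starphi e1 e2 a3 b3).
Proof. by rewrite -!cross3P !cross3_D3 !cross3_Z3 !dotDl !dotDr !dotZl !dotZr; ring. Qed.

End RowFree.

(** * Tangent frames in the atlas and sufficiency of the system *)

Section AtlasFrames.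
Variables (R : realType) (S : topologicalType) (A : set (chart R S)).
Variables (phi1 phi2 psi : S -> 'rV[R]_7).
Hypothesis hA : analytic_atlas A.
Hypotheses (han1 : analytic_map A phi1) (han2 : analytic_map A phi2).
Hypothesis hanpsi : analytic_map A psi.
Implicit Types (x y : chart R S) (p q : S) (r : 'rV[R]_2).

Local Notation iota := (ruled phi1 phi2 psi).

Lemma analytic_in_atlas x p : A x -> dom x p -> analytic_in phi1 phi2 psi x p.
Proof.
by move=> Ax xp; split=> i; [exact: (han1 Ax (codom_chartP xp))|
  exact: (han2 Ax (codom_chartP xp))|exact: (hanpsi Ax (codom_chartP xp))].
Qed.

Lemma atlas_local x : A x -> local_coordinates A x.
Proof.
have [tA _ trA] := hA; move=> Ax; split; first exact: tA.
by move=> y Ay; split; exact: trA.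
Qed.

Lemma analytic_in_local y p : local_coordinates A y -> dom y p ->
  analytic_in phi1 phi2 psi y p.
Proof.
move=> [ty trY] yp; have [tA cov _] := hA; have [x Ax xp] := cov p.
have [yx xy] := trY _ Ax; have tx := tA _ Ax.
have [h1 h2 h3] := analytic_in_atlas Ax xp.
by split; exact: (vanalytic_change tx ty yx xp yp).
Qed.

Lemma frame_sub_local x y r p : A x -> local_coordinates A y -> dom x p -> dom y p ->
  (coordinate_frame iota x r p == coordinate_frame iota y r p)%MS.
Proof.
move=> Ax hy xp yp; have [ty trY] := hy; have [yx xy] := trY _ Ax.
have [tA _ _] := hA; have tx := tA _ Ax.
have ix := analytic_in_atlas Ax xp; have iy := analytic_in_local hy yp.
by apply/andP; split; exact: frame_change_sub.
Qed.

Lemma immersion_row_free y r p : local_coordinates A y -> dom y p ->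
  immersion_at A iota r p -> row_free (coordinate_frame iota y r p).
Proof.
move=> hy yp [x [Ax xp fr]]; apply: (row_free_sub fr).
by have /andP[] := frame_sub_local r Ax hy xp yp.
Qed.

Lemma tangent_basis_local y r p B : local_coordinates A y -> dom y p ->
  tangent_basis A iota r p B ->
  row_free (coordinate_frame iota y r p) /\ (B == coordinate_frame iota y r p)%MS.
Proof.
move=> hy yp [x [Ax xp fr /andP[Bx xB]]].
have /andP[xy yx] := frame_sub_local r Ax hy xp yp.
split; first exact: row_free_sub fr xy.
by apply/andP; split; [exact: submx_trans Bx xy|exact: submx_trans yx xB].
Qed.

Lemma tangent_basis_mul r p B (P : 'M[R]_4) : tangent_basis A iota r p B ->
  \det P != 0 -> tangent_basis A iota r p (P *m B).
Proof.
move=> [x [Ax xp fr /andP[Bx xB]]] dP; exists x; split => //.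
have fP : row_full P by rewrite row_full_unit unitmxE unitfE.
by have := eqmxMfull B fP => h; apply/andP; split; rewrite h.
Qed.

(** Both velocities are affine in [r], so the value is quadratic in [r] with coefficients continuous
    on the surface. This yields the joint continuity in [r] and [p] that an orientation requires. *)
Lemma starphi_frame_cvg x r p : A x -> dom x p ->
  (fun q : 'rV[R]_2 * S => starphi_form (coordinate_frame iota x q.1 q.2)) @ (r, p) -->
  starphi_form (coordinate_frame iota x r p).
Proof.
move=> Ax xp; have [tA _ _] := hA; have tx := tA _ Ax; have [_ _ pK _ _] := tx.
have [h1 h2 h3] := analytic_in_atlas Ax xp.
pose s (F G : S -> 'rV[R]_7) q := starphi (phi1 q) (phi2 q) (pder x 0 F q) (pder x 1 G q).
have sc F G : vanalytic (F \o param x) (coord x p) -> vanalytic (G \o param x) (coord x p) ->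
    (fun q : 'rV[R]_2 * S => s F G q.2) @ (r, p) --> s F G p.
  move=> hF hG.
  pose t u := dot (cross3 (phi1 (param x u)) (phi2 (param x u))
    ('D_(delta_mx 0 0) (F \o param x) u)) ('D_(delta_mx 0 1) (G \o param x) u).
  have tc : t @ coord x p --> t (coord x p).
    apply: analytic_continuous; apply: analytic_dot (vanalytic_derive 1 hG).
    exact: vanalytic_cross3 h1 h2 (vanalytic_derive 0 hF).
  have st q : dom x q -> s F G q = t (coord x q).
    by move=> xq; rewrite /t /s pK // cross3P.
  have scp : s F G @ p --> s F G p.
    rewrite (st _ xp); apply: cvg_trans (cvg_comp _ _ (chart_coord_continuous tx xp) tc).
    apply: near_eq_cvg; apply: filterS (near_dom tx xp) => q xq.
    by rewrite /= (st _ xq).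
  exact: (cvg_comp _ _ (@cvg_snd _ _ (nbhs r) (nbhs p) _) scp).
have rc i : (fun q : 'rV[R]_2 * S => q.1 0 i) @ (r, p) --> r 0 i.
  exact: (cvg_comp _ _ (@cvg_fst _ _ (nbhs r) (nbhs p) _) (@coord_continuous R 1 2 0 i r)).
pose g (q : 'rV[R]_2 * S) :=
  q.1 0 0 * (q.1 0 0 * s phi1 phi1 q.2 + q.1 0 1 * s phi1 phi2 q.2 + s phi1 psi q.2)
  + q.1 0 1 * (q.1 0 0 * s phi2 phi1 q.2 + q.1 0 1 * s phi2 phi2 q.2 + s phi2 psi q.2)
  + (q.1 0 0 * s psi phi1 q.2 + q.1 0 1 * s psi phi2 q.2 + s psi psi q.2).
have gE (q : 'rV[R]_2 * S) : dom x q.2 -> starphi_form (coordinate_frame iota x q.1 q.2) = g q.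
  move=> xq; rewrite (coordinate_frameE _ (analytic_in_atlas Ax xq)).
  exact: starphi_comb.
have gc : g @ (r, p) --> g (r, p).
  have lin F (hF : vanalytic (F \o param x) (coord x p)) :
     (fun q : 'rV[R]_2 * S => q.1 0 0 * s F phi1 q.2 + q.1 0 1 * s F phi2 q.2 + s F psi q.2)
     @ (r, p) --> r 0 0 * s F phi1 p + r 0 1 * s F phi2 p + s F psi p.
    exact: cvgD (cvgD (cvgM (rc 0) (sc _ _ hF h1)) (cvgM (rc 1) (sc _ _ hF h2))) (sc _ _ hF h3).
  exact: cvgD (cvgD (cvgM (rc 0) (lin _ h1)) (cvgM (rc 1) (lin _ h2))) (lin _ h3).
refine (@eq_ind_r _ (g (r, p)) (fun l => _ --> l) _ _ (gE (r, p) xp)).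
refine (cvg_trans _ gc).
apply: near_eq_cvg.
have : \forall q \near (r, p), dom x q.2.
  exact: (@cvg_snd _ _ (nbhs r) (nbhs p) _ _ (near_dom tx xp)).
by apply: filterS => q /gE ->.
Qed.

Hypotheses (hunit1 : forall p, dot (phi1 p) (phi1 p) = 1).
Hypotheses (hunit2 : forall p, dot (phi2 p) (phi2 p) = 1).
Hypotheses (horth : forall p, dot (phi1 p) (phi2 p) = 0).

Lemma system_velocity y r p : ruled_coassociative_system phi1 phi2 psi y -> dom y p ->
  phi (phi1 p) (phi2 p) (chart_velocity phi1 phi2 psi y r 0 p) = 0 /\
  bar (phi1 p) (phi2 p) (chart_velocity phi1 phi2 psi y r 1 p) =
    cross3 (phi1 p) (phi2 p) (chart_velocity phi1 phi2 psi y r 0 p).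
Proof.
move=> [f [g1 [g2 [_ _ _ sys]]]] yp; have [[p1 p2] p3 s1 s2 s3] := sys _ yp.
rewrite /chart_velocity s1 s2 s3; split; last exact: bar_system.
exact: phi_comb3.
Qed.

Lemma system_coassociative :
  (forall p, exists y, [/\ local_coordinates A y, dom y p &
     ruled_coassociative_system phi1 phi2 psi y]) ->
  coassociative A iota.
Proof.
move=> hsys.
have tb r p B : tangent_basis A iota r p B -> starphi_form B != 0 /\
    (B *m B^T = 1%:M -> starphi_form B ^+ 2 = 1).
  move=> hB; have [y [hy yp sys]] := hsys p.
  have [fr BM] := tangent_basis_local hy yp hB.
  have [pA BJ] := system_velocity r sys yp.
  rewrite (coordinate_frameE r (analytic_in_local hy yp)) in fr BM.
  split; last exact: (calibrated_plane_form (hunit1 p) (hunit2 p) (horth p) pA BJ fr BM).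
  apply: (starphi_form_eqmx fr BM); rewrite starphi_form_rows4.
  rewrite (starphi_bar_J (hunit1 p) (hunit2 p) (horth p) pA BJ) dot_eq0.
  exact: rows4_bar_neq0 fr.
(* The orientation consists of the tangent bases on which the form is positive. By [tb] the form
   never vanishes on a tangent basis, so its sign separates the two classes and is locally
   constant. *)
exists (fun r p B => tangent_basis A iota r p B /\ 0 < starphi_form B); last first.
  move=> r p E [hE E0] EE P; have [_ /(_ EE)] := tb _ _ _ hE.
  move=> /eqP; rewrite sqrf_eq1 => /orP[]/eqP E1; rewrite starphi_form_mul E1 ?mulr1 //.
  by move: E0; rewrite E1 oppr_gt0 ltr10.
split.
- by move=> r p B [].
- move=> r p B P hB dP; rewrite starphi_form_mul pmulr_rgt0 //.
  have hPB : tangent_basis A iota r p (P *m B).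
    by apply: tangent_basis_mul hB _; rewrite gt_eqF.
  by split=> -[].
- move=> r p B P hB dP; rewrite starphi_form_mul nmulr_rgt0 //.
  have hPB : tangent_basis A iota r p (P *m B).
    by apply: tangent_basis_mul hB _; rewrite lt_eqF.
  have [B0 _] := tb _ _ _ hB.
  split=> [[_ Bn] [_ Bp]|nB]; first by move: (lt_trans Bn Bp); rewrite ltxx.
  split=> //; rewrite lt_neqAle B0 /= leNgt; apply/negP => Bp.
  by apply: nB.
- move=> x r p Ax xp imm; have fr := immersion_row_free (atlas_local Ax) xp imm.
  have tbp : tangent_basis A iota r p (coordinate_frame iota x r p).
    exists x; split; [exact: Ax|exact: xp|exact: fr|].
    by apply/andP; split; exact: submx_refl.
  have [s0 _] := tb _ _ _ tbp; have sc := starphi_frame_cvg (r := r) Ax xp.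
  have [tA _ _] := hA; have tx := tA _ Ax.
  have xd : \forall q \near (r, p), dom x q.2.
    exact: (@cvg_snd _ _ (nbhs r) (nbhs p) _ _ (near_dom tx xp)).
  have tbq (q : 'rV[R]_2 * S) : dom x q.2 -> starphi_form (coordinate_frame iota x q.1 q.2) != 0 ->
      tangent_basis A iota q.1 q.2 (coordinate_frame iota x q.1 q.2).
    move=> xq q0; exists x; split; [exact: Ax|exact: xq|exact: starphi_form_row_free q0|].
    by apply/andP; split; exact: submx_refl.
  have := s0; rewrite neq_lt => /orP[sn|sp]; last first.
  + have near_pos : \forall q \near (r, p), 0 < starphi_form (coordinate_frame iota x q.1 q.2).
      exact: (cvgr_gt _ sc _ sp).
    apply: filterS2 xd near_pos => q xq qp.
    split=> _; first by split; [exact: tbp|exact: sp].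
    split; last exact: qp.
    by apply: tbq; [exact: xq|rewrite gt_eqF].
  + have near_neg : \forall q \near (r, p), starphi_form (coordinate_frame iota x q.1 q.2) < 0.
      exact: (cvgr_lt _ sc _ sn).
    apply: filterS2 xd near_neg => q xq qn.
    by split=> -[_ h]; exfalso; [move: (lt_trans h qn)|move: (lt_trans h sn)]; rewrite ltxx.
Qed.

End AtlasFrames.

(** * Calibrated pencils *)

Section CalibratedPencil.
Variable R : realType.
Variables (e1 e2 : 'rV[R]_7).
Hypotheses (u1 : dot e1 e1 = 1) (u2 : dot e2 e2 = 1) (o12 : dot e1 e2 = 0).

Definition calibrated_pair (A B : 'rV[R]_7) (A' := bar e1 e2 A) (B' := bar e1 e2 B) : Prop :=
  [/\ phi e1 e2 A = 0, phi e1 e2 B = 0 &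
      dot A' A' *: B' = dot A' B' *: A' + dot (cross3 e1 e2 A') B' *: cross3 e1 e2 A'].

Definition pencil (a1 a2 a3 : 'rV[R]_7) (r : 'rV[R]_2) : 'rV[R]_7 :=
  r 0 0 *: a1 + r 0 1 *: a2 + a3.

(** A nonzero value persists on a neighbourhood, which would then lie inside [D]. *)
Lemma nowhere_dense_eq0 (D : set 'rV[R]_2) (f : 'rV[R]_2 -> R) : nowhere_dense D ->
  (forall r, {for r, continuous f}) -> (forall r, ~ D r -> f r = 0) -> forall r, f r = 0.
Proof.
move=> nD fc f0 r; apply/eqP/negPn/negP => fr.
have : \forall s \near r, D s.
  apply: filterS (cvgr_neq0 _ (fc r) fr) => s fs.
  by apply: contrapT => /f0 fs0; rewrite fs0 eqxx in fs.
move=> Dr; suff : interior (closure D) r by rewrite nD.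
by apply: filterS Dr; exact: subset_closure.
Qed.

Lemma vanalytic_pencil a1 a2 a3 r : vanalytic (pencil a1 a2 a3) r.
Proof.
apply: vanalyticD (vanalytic_cst a3 r); apply: vanalyticD.
  by apply: vanalyticZ; [exact: analytic_coord|exact: vanalytic_cst].
by apply: vanalyticZ; [exact: analytic_coord|exact: vanalytic_cst].
Qed.

Lemma vanalytic_bar (F : 'rV[R]_2 -> 'rV[R]_7) r : vanalytic F r ->
  vanalytic (fun s => bar e1 e2 (F s)) r.
Proof.
move=> hF; have c1 := vanalytic_cst e1 r; have c2 := vanalytic_cst e2 r.
by apply: vanalyticB; [apply: vanalyticB => //|]; apply: vanalyticZ => //; exact: analytic_dot.
Qed.

(** The three conditions are equations between continuous functions of [r] that involve no division,
    so they extend from the complement of [D] to the singular points of the fibre. *)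
Lemma calibrated_pencil (D : set 'rV[R]_2) a1 a2 a3 b1 b2 b3 : nowhere_dense D ->
  (forall r, ~ D r -> calibrated_pair (pencil a1 a2 a3 r) (pencil b1 b2 b3 r)) ->
  forall r, calibrated_pair (pencil a1 a2 a3 r) (pencil b1 b2 b3 r).
Proof.
move=> nD h.
pose A r := pencil a1 a2 a3 r; pose B r := pencil b1 b2 b3 r.
have p0 c1 c2 c3 : (forall r, ~ D r -> phi e1 e2 (pencil c1 c2 c3 r) = 0) ->
    forall r, phi e1 e2 (pencil c1 c2 c3 r) = 0.
  apply: nowhere_dense_eq0 => // r; apply: analytic_continuous.
  apply: analytic_ext (analytic_dot (vanalytic_cst (cross2 e1 e2) r)
    (vanalytic_pencil c1 c2 c3 r)) => s.
  exact: cross2P.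
move=> r; split; first by apply: p0 => s /h[].
  by apply: p0 => s /h[].
have Ab s : vanalytic (fun t => bar e1 e2 (A t)) s.
  exact: vanalytic_bar (vanalytic_pencil _ _ _ _).
have Bb s : vanalytic (fun t => bar e1 e2 (B t)) s.
  exact: vanalytic_bar (vanalytic_pencil _ _ _ _).
have JA s : vanalytic (fun t => cross3 e1 e2 (bar e1 e2 (A t))) s.
  exact: vanalytic_cross3 (vanalytic_cst _ _) (vanalytic_cst _ _) (Ab s).
pose I s := dot (bar e1 e2 (A s)) (bar e1 e2 (A s)) *: bar e1 e2 (B s)
  - (dot (bar e1 e2 (A s)) (bar e1 e2 (B s)) *: bar e1 e2 (A s)
  + dot (cross3 e1 e2 (bar e1 e2 (A s))) (bar e1 e2 (B s)) *: cross3 e1 e2 (bar e1 e2 (A s))).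
have Ian s : vanalytic I s.
  apply: vanalyticB; first by apply: vanalyticZ => //; exact: analytic_dot.
  by apply: vanalyticD; apply: vanalyticZ => //; exact: analytic_dot.
have I0 i : forall s, I s 0 i = 0.
  apply: (nowhere_dense_eq0 nD) => [s|s /h[_ _ E]]; first by apply: analytic_continuous; exact: Ian.
  suff -> : I s = 0 by rewrite mxE.
  by apply/eqP; rewrite subr_eq0; apply/eqP; exact: E.
apply/eqP; rewrite -subr_eq0; apply/eqP; apply/rowP => i; rewrite [RHS]mxE; exact: I0.
Qed.

Lemma phi_pencil_eq0 a1 a2 a3 : (forall r, phi e1 e2 (pencil a1 a2 a3 r) = 0) ->
  [/\ phi e1 e2 a1 = 0, phi e1 e2 a2 = 0 & phi e1 e2 a3 = 0].
Proof.
move=> hp; have := hp (row2 0 0); have := hp (row2 1 0); have := hp (row2 0 1).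
rewrite /pencil !row2_0 !row2_1 !phi_D3 !phi_Z3 !mul0r !mul1r !add0r !addr0 => k1 k2 k3.
by move: k1 k2; rewrite k3 !addr0.
Qed.

(** [m1 + i m2] is the complex ratio of the two velocities at [r0], and [m2 != 0] is the
    nonvanishing of [starphi]. The velocities at [r0] combine all three pairs and already have this
    ratio, so in either alternative the third pair follows from the first two. *)
Lemma pencil_alternative (r0 : 'rV[R]_2) a1 a2 a3 b1 b2 b3 (v := bar e1 e2 (pencil a1 a2 a3 r0))
    (B := pencil b1 b2 b3 r0) (m1 := dot v B / dot v v) (m2 := dot (cross3 e1 e2 v) B / dot v v)
    (prop := fun a b => bar e1 e2 b = cx e1 e2 m1 m2 (bar e1 e2 a)) :
  (forall r, calibrated_pair (pencil a1 a2 a3 r) (pencil b1 b2 b3 r)) ->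
  starphi e1 e2 (pencil a1 a2 a3 r0) B != 0 ->
  [/\ v != 0, m2 != 0, (prop a1 b1 -> prop a2 b2 -> prop a3 b3) &
    (prop a1 b1 /\ prop a2 b2) \/
    [/\ normal e1 e2 v a1 = 0, normal e1 e2 v a2 = 0 & normal e1 e2 v a3 = 0] /\
    [/\ normal e1 e2 v b1 = 0, normal e1 e2 v b2 = 0 & normal e1 e2 v b3 = 0]].
Proof.
move=> cal sp.
have JA : cross3 e1 e2 v = cross3 e1 e2 (pencil a1 a2 a3 r0) by exact: cross3_bar.
have wB : dot (cross3 e1 e2 v) B != 0 by rewrite JA cross3P.
have v0 : v != 0 by apply: contra_neq wB => ->; rewrite cross3_03 dot0l.
have vv : dot v v != 0 by rewrite dot_eq0.
have [pa1 pa2 pa3] := phi_pencil_eq0 (fun r => let: And3 h _ _ := cal r in h).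
have [pb1 pb2 pb3] := phi_pencil_eq0 (fun r => let: And3 _ h _ := cal r in h).
have W z : phi e1 e2 z = 0 -> inW e1 e2 (bar e1 e2 z) by exact: inW_bar.
have hv : inW e1 e2 v by apply: W; case: (cal r0).
have hB : inW e1 e2 (bar e1 e2 B) by apply: W; case: (cal r0).
have BE : bar e1 e2 B = cx e1 e2 m1 m2 v.
  have [_ _ E] := cal r0; have := calibrated_complex_line hv hB v0 E.
  by rewrite (dot_v_bar hv) (dot_Jv_bar e1 e2 v).
have vE : v = r0 0 0 *: bar e1 e2 a1 + r0 0 1 *: bar e1 e2 a2 + bar e1 e2 a3.
  by rewrite /v /pencil !barD !barZ.
have BbE : bar e1 e2 B = r0 0 0 *: bar e1 e2 b1 + r0 0 1 *: bar e1 e2 b2 + bar e1 e2 b3.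
  by rewrite /B /pencil !barD !barZ.
have p3 : prop a1 b1 -> prop a2 b2 -> prop a3 b3.
  have lin (x1 x2 x3 y1 y2 y3 : 'rV[R]_7) s t : y1 = cx e1 e2 m1 m2 x1 ->
      y2 = cx e1 e2 m1 m2 x2 ->
      s *: y1 + t *: y2 + y3 = cx e1 e2 m1 m2 (s *: x1 + t *: x2 + x3) ->
      y3 = cx e1 e2 m1 m2 x3.
    by move=> -> ->; rewrite !cxD !cxZ; exact: addrI.
  have E := etrans (esym BbE) (etrans BE (congr1 (cx e1 e2 m1 m2) vE)).
  move=> h1 h2; exact: (lin _ _ _ _ _ _ _ _ h1 h2 E).
split=> //; first by rewrite mulf_neq0 // invr_eq0.
have hI h h' (A' := v + (h *: bar e1 e2 a1 + h' *: bar e1 e2 a2))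
    (B' := cx e1 e2 m1 m2 v + (h *: bar e1 e2 b1 + h' *: bar e1 e2 b2)) :
    dot A' A' *: B' = dot A' B' *: A' + dot (cross3 e1 e2 A') B' *: cross3 e1 e2 A'.
  have [_ _] := cal (r0 + row2 h h').
  have split_r (c1 c2 c3 x : 'rV[R]_7) : bar e1 e2 (pencil c1 c2 c3 r0) = x ->
      bar e1 e2 (pencil c1 c2 c3 (r0 + row2 h h')) =
      x + (h *: bar e1 e2 c1 + h' *: bar e1 e2 c2).
    move=> <-; rewrite /pencil !mxE /= !barD !barZ.
    by move: (bar e1 e2 c1) (bar e1 e2 c2) (bar e1 e2 c3) => x1 x2 x3;
      apply/rowP => i; rewrite !mxE; ring.
  by rewrite (split_r _ _ _ _ BE) (split_r a1 a2 a3 v (erefl _)).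
have [[h1 h2]|[n1 n2 n3 n4]] := pencil_dichotomy u1 u2 o12 hv v0
  (W _ pa1) (W _ pa2) (W _ pb1) (W _ pb2) hI.
  by left; exact: (conj h1 h2).
right.
have nb z : normal e1 e2 v (bar e1 e2 z) = 0 -> normal e1 e2 v z = 0.
  by rewrite (normal_bar u1 u2 o12 hv).
have na3 : normal e1 e2 v a3 = 0.
  apply: nb; have := normal_v hv v0; rewrite {2}vE !normalD !normalZ n1 n2 !scaler0 !add0r.
  by [].
have nb3 : normal e1 e2 v b3 = 0.
  apply: nb; have : normal e1 e2 v (bar e1 e2 B) = 0.
    by rewrite BE (normal_cx u1 u2 o12 hv) (normal_v hv v0) cx0r.
  by rewrite BbE !normalD !normalZ n3 n4 !scaler0 !add0r.
split; split; [exact: nb n1|exact: nb n2|exact: na3|exact: nb n3|exact: nb n4|exact: nb3].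
Qed.

End CalibratedPencil.

Section CalibratedFamily.
Variable R : realType.
Variables (e1 e2 psi : 'rV[R]_2 -> 'rV[R]_7) (r0 : 'rV[R]_2).
Implicit Types (u a : 'rV[R]_2) (ed : 'rV[R]_2 -> 'rV[R]_7).

Local Notation vel := (velocity e1 e2 psi).
Local Notation v := (base_vector e1 e2 psi r0).
Local Notation w := (base_Jvector e1 e2 psi r0).

Definition calibrated_family u : Prop :=
  [/\ analytic_frame e1 e2 psi u,
      forall r, calibrated_pair (e1 u) (e2 u) (vel r 0 u) (vel r 1 u) &
      starphi (e1 u) (e2 u) (vel r0 0 u) (vel r0 1 u) != 0].

Definition beltrami1 u : R := dot (v u) (vel r0 1 u) / dot (v u) (v u).
Definition beltrami2 u : R := dot (w u) (vel r0 1 u) / dot (v u) (v u).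

Definition conformal ed u : Prop := bar (e1 u) (e2 u) ('D_(delta_mx 0 1) ed u) =
  cx (e1 u) (e2 u) (beltrami1 u) (beltrami2 u) (bar (e1 u) (e2 u) ('D_(delta_mx 0 0) ed u)).

(** The vectors [n] are the projections of the standard basis off the 4-plane at [a], so
    orthogonality to all of them means lying in that plane. These are scalar analytic equations, to
    which the identity theorem applies. *)
Definition degenerate_normals a u : Prop :=
  forall i (n := normal (e1 a) (e2 a) (v a) (delta_mx 0 i)),
  [/\ dot (e1 u) n = 0, dot (e2 u) n = 0 & dot (psi u - psi a) n = 0].

Lemma family_alternative u : calibrated_family u ->
  [/\ v u != 0, beltrami2 u != 0, conformal e1 u -> conformal e2 u -> conformal psi u &
    (conformal e1 u /\ conformal e2 u) \/ degenerate_at e1 e2 psi r0 u].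
Proof.
move=> [fr cal sp]; have [_ _ _ [k1 k2 k3]] := fr.
have [v0 m0 p3 alt] := pencil_alternative k1 k2 k3 cal sp.
split; [exact: v0|exact: m0|exact: p3|].
case: alt => [h|h]; [left; exact: h|right].
split; [exact: fr|exact: v0| |].
  by move=> r; have [c0 c1 _] := cal r; apply: forall_I2; [exact: c0|exact: c1].
by have [n0 n1] := h; apply: forall_I2; [exact: n0|exact: n1].
Qed.

Lemma vanalytic_near_neq0 n (F : 'rV[R]_2 -> 'rV[R]_n) u : vanalytic F u -> F u != 0 ->
  \forall x \near u, F x != 0.
Proof.
move=> Fu /eqP F0; have [i Fi] : exists i, F u 0 i != 0.
  apply: contrapT => h; apply: F0; apply/rowP => i; rewrite mxE.
  by apply/eqP/negPn/negP => Fi; apply: h; exists i.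
apply: filterS (cvgr_neq0 _ (analytic_continuous (Fu i)) Fi) => x; apply: contra_neq => ->.
by rewrite mxE.
Qed.

Lemma analytic_beltrami u : calibrated_family u ->
  analytic_at beltrami1 u /\ analytic_at beltrami2 u.
Proof.
move=> hu; have [fr _ _] := hu; have [v0 _ _ _] := family_alternative hu.
have hv := vanalytic_base_vector r0 fr; have hw := vanalytic_base_Jvector r0 fr.
have hB := vanalytic_velocity r0 1 fr.
have dV : analytic_at (fun x => (dot (v x) (v x))^-1) u.
  by apply: analyticV; [rewrite dot_eq0|exact: analytic_dot].
by split; apply: analyticM dV; exact: analytic_dot.
Qed.

(** Openness of the failure turns the degenerate alternative at one point into one on a
    neighbourhood, where it can be differentiated. *)
Lemma near_not_conformal ed u : calibrated_family u -> vanalytic ed u -> ~ conformal ed u ->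
  \forall x \near u, ~ conformal ed x.
Proof.
move=> hu hed nc; have [m1 m2] := analytic_beltrami hu; have [[h1 h2 _ _] _ _] := hu.
have hb F : vanalytic F u -> vanalytic (fun x => bar (e1 x) (e2 x) (F x)) u.
  move=> hF; apply: vanalyticB; first apply: vanalyticB => //.
    by apply: vanalyticZ => //; exact: analytic_dot.
  by apply: vanalyticZ => //; exact: analytic_dot.
have b0 := hb _ (vanalytic_derive 0 hed); have b1 := hb _ (vanalytic_derive 1 hed).
have Fu := vanalyticB b1 (vanalyticD (vanalyticZ m1 b0)
  (vanalyticZ m2 (vanalytic_cross3 h1 h2 b0))).
have F0 : (bar (e1 u) (e2 u) ('D_(delta_mx 0 1) ed u) -
  cx (e1 u) (e2 u) (beltrami1 u) (beltrami2 u) (bar (e1 u) (e2 u) ('D_(delta_mx 0 0) ed u))) != 0.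
  by rewrite subr_eq0; apply/eqP.
have /= := vanalytic_near_neq0 Fu F0.
apply: filterS => x /negP nx c; apply: nx.
by rewrite subr_eq0; apply/eqP; exact: c.
Qed.

Lemma conformal_or_degenerate u : (\forall x \near u, calibrated_family x) ->
  (conformal e1 u /\ conformal e2 u) \/ (\forall x \near u, degenerate_normals u x).
Proof.
move=> hn; have hu := nbhs_singleton hn; have [[h1 h2 _ _] _ _] := hu.
have [c1|c1] := pselect (conformal e1 u); last first.
  right; have n1 := near_not_conformal hu h1 c1.
  have deg : \forall x \near u, degenerate_at e1 e2 psi r0 x.
    apply: filterS2 hn n1 => x hx nx.
    by have [_ _ _ [[x1 x2]|//]] := family_alternative hx; case: nx.
  exact: (degenerate_planar (or_introl (erefl e1)) deg n1).
have [c2|c2] := pselect (conformal e2 u); last first.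
  right; have n2 := near_not_conformal hu h2 c2.
  have deg : \forall x \near u, degenerate_at e1 e2 psi r0 x.
    apply: filterS2 hn n2 => x hx nx.
    by have [_ _ _ [[x1 x2]|//]] := family_alternative hx; case: nx.
  exact: (degenerate_planar (or_intror (erefl e2)) deg n2).
by left.
Qed.

End CalibratedFamily.

Lemma dot_delta (R : realType) (z : 'rV[R]_7) i : dot z (delta_mx 0 i) = z 0 i.
Proof.
rewrite /dot (bigD1 i) //= big1 => [|j ji]; first by rewrite mxE !eqxx mulr1 addr0.
by rewrite mxE (negPf ji) andbF mulr0.
Qed.

(** * From coassociativity to a common complex ratio *)

Section Calibration.
Variables (R : realType) (S : topologicalType) (A : set (chart R S)).
Variables (phi1 phi2 psi : S -> 'rV[R]_7).
Hypothesis hA : analytic_atlas A.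
Implicit Types (x y : chart R S) (p q : S) (r : 'rV[R]_2).

Local Notation iota := (ruled phi1 phi2 psi).

(** If the basis is negatively oriented, reversing its first vector gives an orthonormal positive
    one, and the value is -1; squaring removes the dependence on the orientation. *)
Lemma coassociative_form_sqr r p (E : 'M[R]_(4, 7)) : coassociative A iota ->
  tangent_basis A iota r p E -> E *m E^T = 1%:M -> starphi_form E ^+ 2 = 1.
Proof.
move=> [ori [_ _ oN _] cal] hE EE.
have [oE|oE] := pselect (ori r p E).
  by have := cal _ _ _ oE EE 1%:M; rewrite mul1mx det1 => ->; rewrite expr1n.
pose P : 'M[R]_4 := diag_mx (\row_j (if j == 0 then -1 else 1)).
have dP : \det P = -1 by rewrite det_diag !big_ord_recl big_ord0 !mxE /= !mulr1.
have dP0 : \det P < 0 by rewrite dP oppr_lt0 ltr01.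
have oPE : ori r p (P *m E) by apply/(oN _ _ _ _ hE dP0).
have PP : P *m P^T = 1%:M.
  rewrite tr_diag_mx mulmx_diag -diag_const_mx; congr diag_mx; apply/rowP => j.
  by rewrite !mxE; case: ifP => _; rewrite ?mulrNN mulr1.
have PE : (P *m E) *m (P *m E)^T = 1%:M.
  by rewrite trmx_mul mulmxA -(mulmxA P E) EE mulmx1.
have := cal _ _ _ oPE PE 1%:M; rewrite mul1mx det1 starphi_form_mul dP mulN1r => h.
by rewrite -sqrrN h expr1n.
Qed.

(** The set of points near which [f] vanishes is open by definition and closed by the identity
    theorem in a chart. *)
Lemma analytic_connected_eq0 (f : S -> R) p0 : connected [set: S] ->
  (forall x p, A x -> dom x p -> analytic_at (f \o param x) (coord x p)) ->
  (\forall p \near p0, f p = 0) -> forall p, f p = 0.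
Proof.
move=> conn fa f0 p; pose B : set S := [set q : S | \forall q' \near q, f q' = 0].
have [tA cov _] := hA.
suff BT : B = setT.
  have Bp : B p by rewrite BT.
  exact: (nbhs_singleton Bp).
apply: conn; first by exists p0.
  exists B; last by rewrite setTI.
  by rewrite openE => q Bq; exact: nbhs_interior.
exists B; last by rewrite setTI.
move=> q qB; have [x Ax xq] := cov q; have tx := tA _ Ax.
have [_ _ pK _ _] := tx; have [e e0 he] := analytic_identity (fa _ _ Ax xq).
have nearq : \forall q' \near q, dom x q' /\ `|coord x q' - coord x q| < e.
  apply: filterI; first exact: near_dom.
  by apply: (near_coord (P := fun u => `|u - coord x q| < e)) => //;
    apply: near_dist_lt; rewrite subrr normr0.
have [q' [Bq' [xq' q'e]]] := qB _ nearq.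
have z : \forall u \near coord x q', (f \o param x) u = 0.
  exact: (near_param (P := fun q => f q = 0)).
apply: filterS nearq => q2 [xq2 q2e].
by have := he _ q'e z _ q2e; rewrite /= pK.
Qed.

Hypotheses (han1 : analytic_map A phi1) (han2 : analytic_map A phi2).
Hypothesis hanpsi : analytic_map A psi.
Hypotheses (hunit1 : forall p, dot (phi1 p) (phi1 p) = 1).
Hypotheses (hunit2 : forall p, dot (phi2 p) (phi2 p) = 1).
Hypotheses (horth : forall p, dot (phi1 p) (phi2 p) = 0).

Local Notation cv x := (chart_velocity phi1 phi2 psi x).
Local Notation fam x r :=
  (calibrated_family (phi1 \o param x) (phi2 \o param x) (psi \o param x) r).

Lemma immersion_calibrated x r p : coassociative A iota -> A x -> dom x p ->
  immersion_at A iota r p ->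
  calibrated_pair (phi1 p) (phi2 p) (cv x r 0 p) (cv x r 1 p) /\
  starphi (phi1 p) (phi2 p) (cv x r 0 p) (cv x r 1 p) != 0.
Proof.
move=> co Ax xp imm; have fr := immersion_row_free hA han1 han2 hanpsi (atlas_local hA Ax) xp imm.
have ax := analytic_in_atlas han1 han2 hanpsi Ax xp.
have frE := coordinate_frameE r ax.
have cal E : (E == rows4 (phi1 p) (phi2 p) (cv x r 0 p) (cv x r 1 p))%MS ->
    E *m E^T = 1%:M -> starphi_form E ^+ 2 = 1.
  rewrite -frE => hE; apply: (coassociative_form_sqr (r := r) (p := p) co).
  by exists x; split.
rewrite frE in fr.
have [c1 c2 c3 c4] := calibrated_frame (hunit1 p) (hunit2 p) (horth p) fr cal.
by split; [split; [exact: c1|exact: c2|exact: c4]|exact: c3].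
Qed.

Hypothesis hsing : fibrewise_generic_immersion A iota.

Lemma coassociative_calibrated x r p : coassociative A iota -> A x -> dom x p ->
  calibrated_pair (phi1 p) (phi2 p) (cv x r 0 p) (cv x r 1 p).
Proof.
move=> co Ax xp; apply: (calibrated_pencil (hsing p)) => s imm.
have {}imm : immersion_at A iota s p by exact: contrapT.
by have [h _] := immersion_calibrated co Ax xp imm; exact: h.
Qed.

Lemma exists_immersion p : exists r, immersion_at A iota r p.
Proof.
apply: contrapT => h; have := hsing p; rewrite /nowhere_dense.
have -> : [set r | ~ immersion_at A iota r p] = setT.
  by apply/seteqP; split=> // r _ /= hr; apply: h; exists r.
rewrite closureT interiorT => /seteqP[/(_ 0 I)].
by [].
Qed.

(** One point [r] of the fibre serves all nearby fibres: the nonvanishing of [starphi] at the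
    immersed point persists by continuity, while the calibration conditions hold for every [r] by
    density. *)
Lemma near_calibrated_family x r p : coassociative A iota -> A x -> dom x p ->
  immersion_at A iota r p -> \forall u \near coord x p, fam x r u.
Proof.
move=> co Ax xp imm; have [tA _ _] := hA; have tx := tA _ Ax; have [_ _ pK _ _] := tx.
have fr u : codom_chart x u ->
    analytic_frame (phi1 \o param x) (phi2 \o param x) (psi \o param x) u.
  move=> [q xq <-]; have [h1 h2 h3] := analytic_in_atlas han1 han2 hanpsi Ax xq.
  by split => //; split; rewrite /= ?pK.
have sp : \forall u \near coord x p, starphi (phi1 (param x u)) (phi2 (param x u))
    (velocity (phi1 \o param x) (phi2 \o param x) (psi \o param x) r 0 u)
    (velocity (phi1 \o param x) (phi2 \o param x) (psi \o param x) r 1 u) != 0.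
  have frp := fr _ (codom_chartP xp); have [h1 h2 _ _] := frp.
  have an := analytic_dot (vanalytic_cross3 h1 h2 (vanalytic_velocity r 0 frp))
    (vanalytic_velocity r 1 frp).
  have [_ n0] := immersion_calibrated co Ax xp imm.
  have n0' : dot (cross3 ((phi1 \o param x) (coord x p)) ((phi2 \o param x) (coord x p))
      (cv x r 0 p)) (cv x r 1 p) != 0 by rewrite /= pK // cross3P.
  apply: filterS (cvgr_neq0 _ (analytic_continuous an) n0') => u.
  by rewrite cross3P.
apply: filterS2 (near_codom tx (codom_chartP xp)) sp => u xu su.
split; [exact: fr|move=> s|exact: su].
have [q xq qu] := xu; have := coassociative_calibrated s co Ax xq.
by rewrite -qu /= pK.
Qed.

Hypotheses (hconn : connected [set: S]) (hnonplanar : ~ planar iota).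

(** Orthogonality to the fixed normals spreads from a neighbourhood to the connected surface, which
    places the whole image in the affine 4-plane through [psi p] spanned by [phi1 p], [phi2 p], [v]
    and [J v]. These four vectors are independent because [starphi] takes the value [dot v v] on
    them. *)
Lemma not_degenerate x r p : A x -> dom x p -> fam x r (coord x p) ->
  ~ \forall u \near coord x p,
    degenerate_normals (phi1 \o param x) (phi2 \o param x) (psi \o param x) r (coord x p) u.
Proof.
move=> Ax xp fp deg; apply: hnonplanar.
have [tA _ _] := hA; have tx := tA _ Ax; have [_ _ pK _ _] := tx.
have [v0 _ _ _] := family_alternative fp; have [_ cal _] := fp.
move: v0 deg; set v := base_vector _ _ _ _ _ => v0 deg.
have hv : inW (phi1 p) (phi2 p) v.
  have [c _ _] := cal r; rewrite /= pK // in c.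
  by rewrite /v /base_vector /= pK //; exact: inW_bar.
pose n i := normal (phi1 p) (phi2 p) v (delta_mx 0 i).
have nearp : \forall q \near p, forall i,
    [/\ dot (phi1 q) (n i) = 0, dot (phi2 q) (n i) = 0 & dot (psi q - psi p) (n i) = 0].
  apply: filterS2 (near_dom tx xp) (near_coord tx xp deg) => q xq dq i.
  by have := dq i; rewrite /= !pK.
have glob (F : S -> 'rV[R]_7) i : analytic_map A F ->
    (\forall q \near p, dot (F q) (n i) = 0) -> forall q, dot (F q) (n i) = 0.
  move=> aF; apply: analytic_connected_eq0 => // y q Ay yq.
  apply: (@analytic_dot _ (F \o param y) (fun=> n i)) (vanalytic_cst _ _).
  by move=> j; exact: (aF _ Ay _ (codom_chartP yq)).
have g1 i := glob phi1 i han1 (filterS (fun q h => let: And3 k _ _ := h i in k) nearp).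
have g2 i := glob phi2 i han2 (filterS (fun q h => let: And3 _ k _ := h i in k) nearp).
have g3 i q : dot (psi q - psi p) (n i) = 0.
  apply: (glob (fun q => psi q - psi p) i _
    (filterS (fun q h => let: And3 _ _ k := h i in k) nearp)).
  move=> y Ay u yu j; have := hanpsi Ay yu j => hj.
  apply: analytic_ext (analyticB hj (analytic_cst (psi p 0 j) u)) => s.
  by rewrite !mxE.
have nE z : (forall i, dot z (n i) = 0) -> normal (phi1 p) (phi2 p) v z = 0.
  move=> h; apply/rowP => i; rewrite [RHS]mxE -dot_delta normalC.
  exact: h.
exists (psi p), (rows4 (phi1 p) (phi2 p) v (cross3 (phi1 p) (phi2 p) v)); split.
  apply: starphi_form_row_free; rewrite starphi_form_rows4 -cross3P.
  by rewrite (dot_J_J (hunit1 p) (hunit2 p) (horth p) _ hv) dot_eq0.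
move=> s q; have -> : iota s q - psi p = s 0 0 *: phi1 q + s 0 1 *: phi2 q + (psi q - psi p).
  by rewrite /ruled addrA.
have sub z : normal (phi1 p) (phi2 p) v z = 0 ->
    (z <= rows4 (phi1 p) (phi2 p) v (cross3 (phi1 p) (phi2 p) v))%MS.
  by move=> /span_normal_eq0 ->; exact: rows4_comb_sub.
apply: sub; apply: nE => i.
rewrite (dotDl _ (psi q - psi p)) (dotDl (_ *: phi1 q)) (dotZl _ (phi1 q)) (dotZl _ (phi2 q)).
by rewrite g1 g2 g3 !mulr0 !addr0.
Qed.

Lemma near_conformal p : coassociative A iota -> exists x r, [/\ A x, dom x p &
  \forall u \near coord x p, [/\ fam x r u,
    conformal (phi1 \o param x) (phi2 \o param x) (psi \o param x) r (phi1 \o param x) u,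
    conformal (phi1 \o param x) (phi2 \o param x) (psi \o param x) r (phi2 \o param x) u &
    conformal (phi1 \o param x) (phi2 \o param x) (psi \o param x) r (psi \o param x) u]].
Proof.
move=> co; have [tA cov _] := hA; have [x Ax xp] := cov p; have [r imm] := exists_immersion p.
have tx := tA _ Ax; have nf := near_calibrated_family co Ax xp imm.
exists x, r; split => //.
have nn : \forall u \near coord x p, \forall u' \near u, fam x r u' by exact: nbhs_interior.
apply: filterS2 (near_codom tx (codom_chartP xp)) nn => u xu fu.
have fu1 := nbhs_singleton fu.
have [_ _ c3 _] := family_alternative fu1.
have [[c1 c2]|deg] := conformal_or_degenerate fu.
  split; [exact: fu1|exact: c1|exact: c2|exact: c3 c1 c2].
have [q xq qu] := xu; rewrite -qu in fu1 deg; exact: (False_ind _ (not_degenerate Ax xq fu1 deg)).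
Qed.

End Calibration.

(** * Isothermal coordinates *)

(** Here [P] and [Q] are the derivatives in the new coordinates. For [D = Q - J P], inserting the
    Beltrami equation into the relation between [a] and [b] leaves [m2 (s0 - i t0) D = 0] modulo
    [e1] and [e2], hence [D = 0]. The Jacobian is [m2 * (s0 ^+ 2 + t0 ^+ 2)], so [phi] also vanishes
    on [P] and [Q]. *)
Lemma isothermal_J (R : realType) (e1 e2 a b P Q : 'rV[R]_7) (s0 s1 t0 t1 m1 m2 : R) :
  dot e1 e1 = 1 -> dot e2 e2 = 1 -> dot e1 e2 = 0 -> s0 != 0 -> m2 != 0 ->
  s1 = m1 * s0 - m2 * t0 /\ t1 = m1 * t0 + m2 * s0 ->
  phi e1 e2 a = 0 -> phi e1 e2 b = 0 -> bar e1 e2 b = cx e1 e2 m1 m2 (bar e1 e2 a) ->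
  a = s0 *: P + t0 *: Q -> b = s1 *: P + t1 *: Q ->
  phi e1 e2 P = 0 /\ bar e1 e2 Q = cross3 e1 e2 P.
Proof.
move=> u1 u2 o12 s00 m20 [s1E t1E] pa pb bab aE bE.
have det0 : s0 * t1 - t0 * s1 != 0.
  have -> : s0 * t1 - t0 * s1 = m2 * (s0 ^+ 2 + t0 ^+ 2) by rewrite s1E t1E; ring.
  rewrite mulf_neq0 // gt_eqF // ltr_wpDr ?sqr_ge0 // lt_neqAle sqr_ge0 andbT eq_sym.
  by rewrite sqrf_eq0.
have pP : phi e1 e2 P = 0.
  have : (s0 * t1 - t0 * s1) * phi e1 e2 P = t1 * phi e1 e2 a - t0 * phi e1 e2 b.
    by rewrite aE bE !phi_D3 !phi_Z3; ring.
  by rewrite pa pb !mulr0 subr0 => /eqP; rewrite mulf_eq0 (negPf det0) => /eqP.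
have pQ : phi e1 e2 Q = 0.
  have : (s0 * t1 - t0 * s1) * phi e1 e2 Q = s0 * phi e1 e2 b - s1 * phi e1 e2 a.
    by rewrite aE bE !phi_D3 !phi_Z3; ring.
  by rewrite pa pb !mulr0 subr0 => /eqP; rewrite mulf_eq0 (negPf det0) => /eqP.
split; first exact: pP.
have WP := inW_bar u1 u2 o12 pP; have WQ := inW_bar u1 u2 o12 pQ.
move: bab; rewrite aE bE !barD !barZ -(cross3_bar e1 e2 P).
move: (bar e1 e2 P) (bar e1 e2 Q) WP WQ => p q Wp Wq bab.
pose D := q - cross3 e1 e2 p.
have WD : inW e1 e2 D by exact: inWB Wq (inWJ _ _ _).
have JD : cross3 e1 e2 D = p + cross3 e1 e2 q.
  by rewrite /D cross3_D3 cross3_N3 (cross3K u1 u2 o12 Wp) opprK addrC.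
suff D0 : D = 0 by apply/eqP; rewrite -subr_eq0; apply/eqP.
apply/eqP/negPn/negP => D0.
have : cx e1 e2 s0 (- t0) D = 0.
  apply: (scalerI m20); rewrite scaler0 /cx JD /D.
  move: bab; rewrite /cx cross3_D3 !cross3_Z3 s1E t1E => bab.
  apply/rowP => i; move: (congr1 (fun z : 'rV[R]_7 => z 0 i) bab); rewrite !mxE.
  by move: (p 0 i) (q 0 i) => pi qi h; lra.
by move=> /(cx_eq0 u1 u2 o12 WD)/(_ D0)[/eqP]; rewrite (negPf s00).
Qed.

Section ChangeOfCoordinates.
Variables (R : realType) (S : topologicalType) (A : set (chart R S)).
Hypothesis hA : analytic_atlas A.
Variables (x : chart R S) (F G : 'rV[R]_2 -> 'rV[R]_2) (U V : set 'rV[R]_2).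
Hypotheses (Ax : A x) (oU : open U) (oV : open V).
Hypothesis hF : forall u, U u -> [/\ V (F u), G (F u) = u & codom_chart x u].
Hypothesis hG : forall v, V v -> U (G v) /\ F (G v) = v.
Hypotheses (aF : analytic_on U F) (aG : analytic_on V G).

Definition change_chart : chart R S :=
  Chart (dom x `&` [set p | U (coord x p)]) (F \o coord x) (param x \o G).

Let tx : topological_chart x. Proof. by have [tA _ _] := hA; exact: tA. Qed.
Let pK p : dom x p -> param x (coord x p) = p. Proof. by case: tx => _ _ + _ _; apply. Qed.

Lemma codom_change_chart : codom_chart change_chart = V.
Proof.
apply/seteqP; split=> [_ [p [xp Up] <-]|v Vv]; first by case: (hF Up).
have [UG FG] := hG Vv; have [_ _ [p xp pE]] := hF UG.
by exists p; [split=> //=; rewrite pE|rewrite /= pE].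
Qed.

Lemma topological_change_chart : topological_chart change_chart.
Proof.
have od : open (dom change_chart).
  rewrite openE => p [xp Up]; apply: filterI; first exact: near_dom.
  by apply: (near_coord (P := U)) => //; exact: open_nbhs_nbhs.
have oc : open (codom_chart change_chart) by rewrite codom_change_chart.
split=> //.
- by move=> p [xp /hF[_ GF _]]; rewrite /= GF pK.
- rewrite (continuous_open_subspace _ od) => p; rewrite inE => -[xp Up].
  apply: continuous_comp; first exact: chart_coord_continuous.
  by apply: differentiable_continuous; apply: vanalytic_differentiable => i; exact: aF.
- rewrite (continuous_open_subspace _ oc) => v; rewrite inE codom_change_chart => Vv.
  apply: continuous_comp.
    by apply: differentiable_continuous; apply: vanalytic_differentiable => i; exact: aG.
  by have [UG _] := hG Vv; have [_ _ xG] := hF UG; exact: chart_param_continuous.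
Qed.

Lemma local_change_chart : local_coordinates A change_chart.
Proof.
split; first exact: topological_change_chart.
have [_ _ trA] := hA.
move=> z Az; split.
- move=> _ [p [[xp Up] zp] <-]; have [VF GF _] := hF Up.
  have := @vanalytic_comp _ _ (coord z \o param x) G (F (coord x p)) (fun i => aG VF i).
  by rewrite GF => /(_ (analytic_transitionP (trA _ _ Ax Az) xp zp)) h i; exact: h.
- move=> _ [p [zp [xp Up]] <-].
  have [tA _ _] := hA; have [_ _ zK _ _] := tA _ Az.
  have := @vanalytic_comp _ _ F (coord x \o param z) (coord z p)
    (analytic_transitionP (trA _ _ Az Ax) zp xp).
  rewrite /= zK // => /(_ (fun i => aF Up i)) h i; exact: h.
Qed.

End ChangeOfCoordinates.

Section IsothermalChart.
Variables (R : realType) (S : topologicalType) (A : set (chart R S)).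
Variables (phi1 phi2 psi : S -> 'rV[R]_7).
Hypothesis hA : analytic_atlas A.
Hypotheses (han1 : analytic_map A phi1) (han2 : analytic_map A phi2).
Hypothesis hanpsi : analytic_map A psi.
Hypotheses (hunit1 : forall p, dot (phi1 p) (phi1 p) = 1).
Hypotheses (hunit2 : forall p, dot (phi2 p) (phi2 p) = 1).
Hypotheses (horth : forall p, dot (phi1 p) (phi2 p) = 0).
Implicit Types (x y : chart R S) (p q : S) (r : 'rV[R]_2).

(** The system makes [starphi] on the coordinate frame equal to the squared norm of the part of the
    s-velocity orthogonal to [phi1] and [phi2], so the orientation of the coordinates is
    automatic. *)
Lemma system_oriented y : local_coordinates A y ->
  ruled_coassociative_system phi1 phi2 psi y -> oriented_coordinates phi1 phi2 psi A y.
Proof.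
move=> hy sys; split=> // r p yp imm.
have ay := analytic_in_local hA han1 han2 hanpsi hy yp.
have fr := immersion_row_free hA han1 han2 hanpsi hy yp imm.
have [pA BJ] := system_velocity hunit1 hunit2 horth r sys yp.
rewrite (coordinate_frameE r ay) in fr.
rewrite (pder_ruled _ _ ay) (pder_ruled _ _ ay).
rewrite (starphi_bar_J (hunit1 p) (hunit2 p) (horth p) pA BJ) dot_gt0.
exact: rows4_bar_neq0 fr.
Qed.

Definition J_holomorphic y (F : S -> 'rV[R]_7) p : Prop :=
  phi (phi1 p) (phi2 p) (pder y 0 F p) = 0 /\
  bar (phi1 p) (phi2 p) (pder y 1 F p) = cross3 (phi1 p) (phi2 p) (pder y 0 F p).

Lemma dot_pder y k p F G (c : R) : vanalytic (F \o param y) (coord y p) ->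
  vanalytic (G \o param y) (coord y p) -> param y (coord y p) = p ->
  (forall q, dot (F q) (G q) = c) ->
  dot (pder y k F p) (G p) + dot (F p) (pder y k G p) = 0.
Proof.
move=> hF hG pK FG.
have h := is_derive_dot (vanalytic_is_derive (delta_mx 0 k) hF)
  (vanalytic_is_derive (delta_mx 0 k) hG).
have c0 : \forall u \near coord y p, dot ((F \o param y) u) ((G \o param y) u) = c.
  by near=> u; exact: FG.
by have := is_derive_near_cst c0 h; rewrite /= pK; exact: id.
Unshelve. all: by end_near. Qed.

Lemma frame_decomposition (e1 e2 Q P : 'rV[R]_7) (a b : R) : bar e1 e2 Q = cross3 e1 e2 P ->
  dot e1 Q = a -> dot e2 Q = b -> Q = cross3 e1 e2 P + a *: e1 + b *: e2.
Proof. by move=> h <- <-; rewrite -h; exact: barE. Qed.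

(** The functions [f], [g1], [g2] are components of the t-derivatives along [phi1] and [phi2]. Unit
    length removes the diagonal components, and orthogonality makes the other two opposite, which is
    why one [f] occurs with both signs. *)
Lemma J_holomorphic_system y : local_coordinates A y ->
  (forall p, dom y p ->
    [/\ J_holomorphic y phi1 p, J_holomorphic y phi2 p & J_holomorphic y psi p]) ->
  ruled_coassociative_system phi1 phi2 psi y.
Proof.
have self (a b : 'rV[R]_7) : dot a b + dot b a = 0 -> dot b a = 0.
  by rewrite (dotC a); lra.
have skew (a b c d : 'rV[R]_7) : dot a b + dot c d = 0 -> dot c d = - dot b a.
  by rewrite (dotC a); lra.
move=> hy hol; have [ty _] := hy; have [_ _ pK _ _] := ty.
have an (F G : S -> 'rV[R]_7) :
    (forall p, dom y p -> vanalytic (F \o param y) (coord y p)) ->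
    (forall p, dom y p -> vanalytic (G \o param y) (coord y p)) ->
    analytic_fun_in y (fun p => dot (F p) (pder y 1 G p)).
  move=> hF hG a ya; have [p yp pa] := ya.
  have := analytic_dot (hF _ yp) (vanalytic_derive 1 (hG _ yp)); rewrite pa.
  apply: analytic_near_eq; apply: filterS (near_codom ty ya) => u yu /=.
  by have [_ uK] := coord_paramK ty yu; rewrite /pder uK.
have an1 p : dom y p -> vanalytic (phi1 \o param y) (coord y p).
  by move=> /(analytic_in_local hA han1 han2 hanpsi hy)[].
have an2 p : dom y p -> vanalytic (phi2 \o param y) (coord y p).
  by move=> /(analytic_in_local hA han1 han2 hanpsi hy)[].
have an3 p : dom y p -> vanalytic (psi \o param y) (coord y p).
  by move=> /(analytic_in_local hA han1 han2 hanpsi hy)[].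
exists (fun p => dot (phi2 p) (pder y 1 phi1 p)), (fun p => dot (phi1 p) (pder y 1 psi p)),
  (fun p => dot (phi2 p) (pder y 1 psi p)).
split; [exact: an|exact: an|exact: an|move=> p yp].
have [[p1 j1] [p2 j2] [p3 j3]] := hol _ yp; have a1 := an1 _ yp; have a2 := an2 _ yp.
have k := pK _ yp.
have r11 := self _ _ (dot_pder 1 a1 a1 k hunit1).
have r22 := self _ _ (dot_pder 1 a2 a2 k hunit2).
have r12 := skew _ _ _ _ (dot_pder 1 a1 a2 k horth).
split; [exact: (conj p1 p2)|exact: p3| | |].
- apply: (etrans (frame_decomposition j1 r11 (erefl _))).
  by rewrite scale0r addr0.
- apply: (etrans (frame_decomposition j2 r12 r22)).
  by rewrite scale0r addr0 scaleNr.
- exact: (frame_decomposition j3 (erefl _) (erefl _)).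
Qed.

Lemma pder_change_chart x (F G : 'rV[R]_2 -> 'rV[R]_2) (U : set 'rV[R]_2) p k
    (H : S -> 'rV[R]_7) : open U -> U (coord x p) ->
  (forall u, U u -> G (F u) = u) -> vanalytic F (coord x p) -> vanalytic G (F (coord x p)) ->
  vanalytic (H \o param x) (coord x p) ->
  'D_(delta_mx 0 k) (H \o param x) (coord x p) =
    'D_(delta_mx 0 k) (fun u => F u 0 0) (coord x p) *: pder (change_chart x F G U) 0 H p +
    'D_(delta_mx 0 k) (fun u => F u 0 1) (coord x p) *: pder (change_chart x F G U) 1 H p.
Proof.
move=> oU Up GF hF hG hH.
have nE : \forall u \near coord x p, (H \o param x) u = ((H \o (param x \o G)) \o F) u.
  have nU : \forall u \near coord x p, U u by exact: open_nbhs_nbhs.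
  by apply: filterS nU => u /GF /= ->.
apply: (etrans (near_eq_derive _ nE)).
apply: (chain_rule k hF); apply: vanalytic_differentiable.
apply: (@vanalytic_comp _ _ (H \o param x) G) => //.
by rewrite GF.
Qed.

Lemma conformal_chart p : (exists x r, [/\ A x, dom x p &
    \forall u \near coord x p, [/\
      calibrated_family (phi1 \o param x) (phi2 \o param x) (psi \o param x) r u,
      conformal (phi1 \o param x) (phi2 \o param x) (psi \o param x) r (phi1 \o param x) u,
      conformal (phi1 \o param x) (phi2 \o param x) (psi \o param x) r (phi2 \o param x) u &
      conformal (phi1 \o param x) (phi2 \o param x) (psi \o param x) r (psi \o param x) u]]) ->
  exists y, [/\ local_coordinates A y, dom y p &
    forall q, dom y q ->
    [/\ J_holomorphic y phi1 q, J_holomorphic y phi2 q & J_holomorphic y psi q]].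
Proof.
move=> [x [r [Ax xp nc]]]; have [tA _ _] := hA; have tx := tA _ Ax.
have [_ _ pK _ _] := tx.
have [fam0 _ _ _] := nbhs_singleton nc.
have [am1 am2] := analytic_beltrami fam0; have [_ m20 _ _] := family_alternative fam0.
have [X [Y [aX aY X0 Y0 pde]]] := beltrami_solution am1 am2.
pose F u := row2 (X u) (Y u).
have F0 : (fun u => F u 0 0) = X by apply/funext => u; exact: row2_0.
have F1 : (fun u => F u 0 1) = Y by apply/funext => u; exact: row2_1.
have aF i : analytic_at (fun u => F u 0 i) (coord x p).
  by move: i; apply: forall_I2; rewrite ?F0 ?F1.
have [X1 Y1] := nbhs_singleton pde.
(* The normalisation [X_s = 1], [Y_s = 0] at the point reduces the Jacobian there to [beltrami2],
   which is nonzero. *)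
have det0 : 'D_(delta_mx 0 0) (fun u => F u 0 0) (coord x p) *
    'D_(delta_mx 0 1) (fun u => F u 0 1) (coord x p) -
    'D_(delta_mx 0 1) (fun u => F u 0 0) (coord x p) *
    'D_(delta_mx 0 0) (fun u => F u 0 1) (coord x p) != 0.
  by rewrite F0 F1 X1 Y1 X0 Y0 !mulr0 mul1r mulr1 add0r subr0.
have X0' : 'D_(delta_mx 0 0) X (coord x p) != 0 by rewrite X0 oner_eq0.
have nX : \forall u \near coord x p, 'D_(delta_mx 0 0) X u != 0.
  exact: (cvgr_neq0 _ (analytic_continuous (analytic_derive 0 aX)) X0').
(* Everything needed at a point is collected into one neighbourhood condition, so that the inverse
   function theorem delivers it on the whole domain of the new chart. *)
have good := filterI (filterI nc pde) (filterI nX (near_codom tx (codom_chartP xp))).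
have [G [U [V [[oU oV] Up hF hG [aFU aGV]]]]] := analytic_inverse aF det0 (good _ _ _).
have hF' u : U u -> [/\ V (F u), G (F u) = u & codom_chart x u].
  by move=> /hF[h1 h2 [_ [_ h3]]].
have hy := local_change_chart hA Ax oU oV hF' hG aFU aGV.
exists (change_chart x F G U); split; [exact: hy|by split|move=> q yq].
have [xq Uq] := yq; have [VF GF [[[fam c1 c2 c3] [XE YE]] [Xn _]]] := hF _ Uq.
have [fr cal _] := fam; have [b1 b2 b3 [k1 k2 k3]] := fr.
have [_ n2 _ _] := family_alternative fam.
have chain (H : S -> 'rV[R]_7) k : vanalytic (H \o param x) (coord x q) ->
    'D_(delta_mx 0 k) (H \o param x) (coord x q) =
    'D_(delta_mx 0 k) X (coord x q) *: pder (change_chart x F G U) 0 H q +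
    'D_(delta_mx 0 k) Y (coord x q) *: pder (change_chart x F G U) 1 H q.
  move=> hH; have GFu u : U u -> G (F u) = u by case/hF.
  have := pder_change_chart k oU Uq GFu (aFU _ Uq) (aGV _ VF) hH.
  by rewrite F0 F1.
have E1 : (phi1 \o param x) (coord x q) = phi1 q by rewrite /= pK.
have E2 : (phi2 \o param x) (coord x q) = phi2 q by rewrite /= pK.
rewrite /conformal E1 E2 in c1 c2 c3 cal.
have [d1 d2 d3] := phi_pencil_eq0 (fun s => let: And3 h _ _ := cal s in h).
have [d1' d2' d3'] := phi_pencil_eq0 (fun s => let: And3 _ h _ := cal s in h).
have J_hol := isothermal_J (hunit1 q) (hunit2 q) (horth q) Xn n2 (conj XE YE).
split.
- exact: (J_hol _ _ _ _ d1 d1' c1 (chain _ 0 b1) (chain _ 1 b1)).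
- exact: (J_hol _ _ _ _ d2 d2' c2 (chain _ 0 b2) (chain _ 1 b2)).
- exact: (J_hol _ _ _ _ d3 d3' c3 (chain _ 0 b3) (chain _ 1 b3)).
Qed.

End IsothermalChart.

Theorem theorem4p9 (R : realType) (Sigma : topologicalType)
    (A : set (chart R Sigma)) (phi1 phi2 psi : Sigma -> 'rV[R]_7)
    (hSigma : analytic_2manifold A)
    (hconn : connected [set: Sigma])
    (han1 : analytic_map A phi1)
    (han2 : analytic_map A phi2)
    (hanpsi : analytic_map A psi)
    (hunit1 : forall p, dot (phi1 p) (phi1 p) = 1)
    (hunit2 : forall p, dot (phi2 p) (phi2 p) = 1)
    (horth : forall p, dot (phi1 p) (phi2 p) = 0)
    (hsing : fibrewise_generic_immersion A (ruled phi1 phi2 psi))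
    (hnonplanar : ~ planar (ruled phi1 phi2 psi)) :
  coassociative A (ruled phi1 phi2 psi) <->
  (forall p : Sigma, exists x : chart R Sigma,
    [/\ oriented_coordinates phi1 phi2 psi A x, dom x p &
        ruled_coassociative_system phi1 phi2 psi x]).
Proof.
have [_ _ hA] := hSigma; split=> [co p|sys]; last first.
  apply: system_coassociative => // p; have [y [[hy _] yp ysys]] := sys p.
  by exists y.
have [y [hy yp hol]] := conformal_chart hA hunit1 hunit2 horth
  (near_conformal hA han1 han2 hanpsi hunit1 hunit2 horth hsing hconn hnonplanar p co).
have ysys := J_holomorphic_system hA han1 han2 hanpsi hunit1 hunit2 horth hy hol.
exists y; split; [|exact: yp|exact: ysys].
exact: system_oriented hy ysys.
Qed.
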